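(* Let $\Lambda_n\subseteq\Delta_n^d$ be a sequence of sets with $\Lambda_n\Rightarrow\rho$ for a Lebesgue density $\rho$ with $\rho\ne0$ (i.e. $N_\rho:=\int_{\mathbb{T}^d}\rho\,d\lambda>0$), put $\tilde\rho:=N_\rho^{-1}\rho$, and let $\tilde\beta_n\to\tilde\beta$ in $[0,\infty)$. Let $P_n:=\mu_{\Lambda_n,\tilde\beta_n,2}\circ(\pi_{\Lambda_n})^{-1}$, a probability measure on $\mathcal{P}(\mathbb{T}^d\times\{1,2\})$ (defined for all $n$ with $\Lambda_n\neq\emptyset$). Then one of the following two situations occurs. (a) There is exactly one global minimizer $\phi^*=\phi^*(\tilde\rho,\tilde\beta)$ of $I_{\tilde\rho,\tilde\beta}$, and it is the spatially homogeneous equidistribution $\phi^*[1]=\phi^*[2]=\frac12\tilde\rho\lambda$, i.e. the one with local magnetization $m_{\tilde\rho,\tilde\beta}=0$. Moreover $P_n\to\delta_{\phi^*}$ weakly. (b) There are exactly two global minimizers $\phi^{*,+}$ and $\phi^{*,-}$ of $I_{\tilde\rho,\tilde\beta}$. Writing $m_{\tilde\rho,\tilde\beta}$ for the local magnetization of $\phi^{*,+}$, the function $m_{\tilde\rho,\tilde\beta}$ is everywhere positive ($\tilde\rho\lambda$-a.e.), and the local magnetization of $\phi^{*,-}$ equals $-m_{\tilde\rho,\tilde\beta}$. Moreover $P_n\to\frac12(\delta_{\phi^{*,+}}+\delta_{\phi^{*,-}})$ weakly.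
   Context: $\mathbb{T}^d=\mathbb{R}^d/\mathbb{Z}^d$ with Lebesgue measure $\lambda$; $\Delta_n^d=\mathbb{Z}^d/n\mathbb{Z}^d$. $J:\mathbb{T}^d\to(0,\infty)$ is continuous, symmetric ($J(-v)=J(v)$) with $\int J\,d\lambda=1$. $\Lambda_n\Rightarrow\rho$ means that the measures $\frac1{n^d}\sum_{x\in\Lambda_n}\delta_{x/n}$ converge weakly on $\mathbb{T}^d$ to $\rho\lambda$. For nonempty $\Lambda\subseteq\Delta_n^d$, $\mu_{\Lambda,\beta,r}$ is the probability measure on $\{1,\dots,r\}^\Lambda$ proportional to $\exp(-\beta H_\Lambda(\sigma))$ with $H_\Lambda(\sigma)=-\frac1{|\Lambda|}\sum_{x,y\in\Lambda}J\big(\frac{x-y}{n}\big)1_{\sigma(x)=\sigma(y)}$. $\pi_\Lambda(\sigma)$ is the probability measure on $\mathbb{T}^d\times\{1,\dots,r\}$ with components $\pi_\Lambda[a](\sigma)=\frac1{|\Lambda|}\sum_{x\in\Lambda}1_{\sigma(x)=a}\delta_{x/n}$. For a measure $\phi$ on $\mathbb{T}^d\times\{1,2\}$, $\phi[a]$ denotes $\phi(\cdot\times\{a\})$. All spaces of probability measures carry the weak topology. The functional $I_{\tilde\rho,\tilde\beta}:\mathcal{P}(\mathbb{T}^d\times\{1,2\})\to(-\infty,\infty]$ is $$I_{\tilde\rho,\tilde\beta}(\phi)=-\tilde\beta\sum_{a=1}^2\iint \tilde\rho(u)\alpha[a](u)\,J(u-v)\,\tilde\rho(v)\alpha[a](v)\,du\,dv+\int\tilde\rho(u)\sum_{a=1}^2\alpha[a](u)\log\big(2\alpha[a](u)\big)\,du$$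 if $\phi[a]=\alpha[a]\tilde\rho\lambda$ for $a=1,2$ with measurable $\alpha[a]\ge0$, $\alpha[1]+\alpha[2]=1$ a.e. (convention $0\log0=0$), and $I_{\tilde\rho,\tilde\beta}(\phi)=\infty$ otherwise. For such $\phi=\alpha\tilde\rho\lambda$ the local magnetization is $m(u)=\alpha[1](u)-\alpha[2](u)$, which is determined up to $\tilde\rho\lambda$-null sets. *)

(* Defs.v *)
From HB Require Import structures.
From mathcomp Require Import all_boot all_order all_algebra.
From mathcomp Require Import all_classical all_reals all_analysis.
From mathcomp Require Import giry.

Set Implicit Arguments.
Unset Strict Implicit.
Unset Printing Implicit Defensive.

Import Order.TTheory GRing.Theory Num.Theory numFieldNormedType.Exports.

Local Open Scope classical_set_scope.
Local Open Scope ring_scope.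
Local Open Scope quotient_scope.

HB.instance Definition _ (X Y : ptopologicalType) := Pointed.on (X * Y)%type.

Definition borel (X : ptopologicalType) := g_sigma_algebraType (@open X).
HB.instance Definition _ (X : ptopologicalType) := Measurable.on (borel X).

Definition Cb (R : realType) (X : topologicalType) : Type :=
  {f : X -> R | continuous f /\ bounded_fun f}.

(* The weak topology is the coarsest one making every mu |-> \int f dmu, with f
   bounded and continuous, continuous.
   Pitfall: a MathComp-Analysis measure is a function on all subsets whose
   values on non-measurable sets are unconstrained, so that elements of
   [Pr R X] are to be compared with [measure_eq] (equality on measurable sets),
   not with Leibniz equality. *)
Definition Pr (R : realType) (X : ptopologicalType) : Type :=
  probability (borel X) R.
HB.instance Definition _ R X := Pointed.on (Pr R X).
HB.instance Definition _ (R : realType) (X : ptopologicalType) :=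
  Topological.copy (Pr R X)
    (sup_topology (fun f : Cb R X => Topological.class
      (initial_topology (fun mu : probability (borel X) R =>
        (\int[mu]_x (sval f x))%R)))).

Lemma cvg_PrP (R : realType) (X : ptopologicalType) (mu_ : nat -> Pr R X)
  (mu : Pr R X) :
  mu_ n @[n --> \oo] --> mu <->
  forall f : X -> R, continuous f -> bounded_fun f ->
   (\int[mu_ n]_x f x)%R @[n --> \oo] --> (\int[mu]_x f x)%R.
Proof.
split.
- move=> h f cf bf.
  have /cvg_sup/(_ (exist _ f (conj cf bf))) /= := h.
  move=> h1.
  have := @initial_continuous (probability (borel X) R) R (fun mu : probability (borel X) R => (\int[mu]_x (f x))%R) mu.
  exact: cvg_trans (cvg_app _ h1).
- move=> h; apply/cvg_sup => -[f [cf bf]].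
  move=> A /=; rewrite (@nbhsE (initial_topology (fun mu : probability (borel X) R => \int[mu]_x f x)%R)) => -[B [[C oC <-] Cmu] sBA].
  apply: filterS sBA _; apply: (h f cf bf).
  exact: open_nbhs_nbhs.
Qed.

Definition delta (R : realType) (X : ptopologicalType) (x : X) : Pr R X :=
  @dirac _ (borel X) x R.

Section half_mix.
Context d (T : measurableType d) (R : realType) (P Q : probability T R).
Local Open Scope ereal_scope.

Definition half_mix : set T -> \bar R :=
  mscale (2^-1)%:nng%R (measure_add P Q).
HB.instance Definition _ := Measure.on half_mix.

Let half_mixT : half_mix setT = 1.
Proof.
have PQ : measure_add P Q setT = (1 + 1)%:E.
  by rewrite measure_addE EFinD; congr (_ + _); exact: probability_setT.
by rewrite /half_mix /mscale/= [X in _ * X]PQ -EFinM mulVf// pnatr_eq0.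
Qed.
HB.instance Definition _ := Measure_isProbability.Build _ _ _ half_mix half_mixT.
End half_mix.

Section wdirac.
Context d (T : measurableType d) (R : realType).
Variables (I : finType) (w : I -> {nonneg R}) (p : I -> T).
Local Open Scope ereal_scope.

(* \sum_i w_i delta_(p_i) *)
Definition wdirac (A : set T) : \bar R :=
  \sum_(i : I) (w i)%:num%:E * \d_(p i) A.

Let wdirac0 : wdirac set0 = 0.
Proof. by rewrite /wdirac big1// => i _; rewrite measure0 mule0. Qed.

Let wdirac_ge0 A : 0 <= wdirac A.
Proof. by apply: sume_ge0 => i _; rewrite mule_ge0. Qed.

Let wdirac_sigma_additive : semi_sigma_additive wdirac.
Proof.
move=> F mF tF mUF; rewrite [X in _ --> X](_ : _ =
    lim ((fun n => \sum_(0 <= i < n) wdirac (F i)) @ \oo)).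
  by apply: is_cvg_ereal_nneg_natsum => k _; exact: wdirac_ge0.
rewrite nneseries_sum//; last by move=> *; rewrite mule_ge0.
apply: eq_bigr => /= i _.
rewrite -[LHS]/(mscale (w i) (@dirac _ T (p i) R) _).
exact: measure_semi_bigcup.
Qed.

HB.instance Definition _ := isMeasure.Build _ _ _ wdirac
  wdirac0 wdirac_ge0 wdirac_sigma_additive.
End wdirac.

Definition Zlattice (R : realType) (d : nat) : {pred 'rV[R]_d} :=
  fun v => [forall i, v 0 i \is a Num.int].

Fact Zlattice_zmod_closed (R : realType) (d : nat) :
  zmod_closed (@Zlattice R d).
Proof.
split; first by apply/forallP => i; rewrite mxE.
move=> u v /forallP hu /forallP hv; apply/forallP => i.
by rewrite !mxE rpredB.
Qed.
HB.instance Definition _ R d :=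
  GRing.isZmodClosed.Build _ (@Zlattice R d) (@Zlattice_zmod_closed R d).

Definition torus (R : realType) (d : nat) : Type :=
  quotient_topology (Quotient.quot (@Zlattice R d)).
HB.instance Definition _ R d := Topological.on (torus R d).
HB.instance Definition _ R d := Quotient.on (torus R d).
HB.instance Definition _ R d :=
  GRing.Zmodule.copy (torus R d) (Quotient.quot (@Zlattice R d)).
HB.instance Definition _ R d := isPointed.Build (torus R d) 0.

Section lebesgue_torus.
Context (R : realType).
Local Notation mR := (measurableTypeR R).

Definition cons_cube n (p : mR * n.-tuple mR) : n.+1.-tuple mR :=
  [tuple of p.1 :: p.2].

Fact measurable_cons_cube n : measurable_fun setT (@cons_cube n).
Proof.
by apply: measurable_cons; [exact: measurable_fst | exact: measurable_snd].
Qed.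
HB.instance Definition _ n := isMeasurableFun.Build _ _ _ _
  (@cons_cube n) (@measurable_cons_cube n).

Fixpoint cube_lebesgue n : probability (n.-tuple mR) R :=
  match n with
  | 0%N => dirac [tuple]
  | n.+1 => distribution (uniform_prob (@ltr01 R) \x cube_lebesgue n)%E
              (@cons_cube n)
  end.

(* The Lebesgue measure of the torus is the image of that of [0, 1]^d. *)
Definition cube_torus d (t : d.-tuple mR) : borel (torus R d) :=
  \pi_(torus R d) (\row_(i < d) tnth t i).

Fact measurable_cube_torus d : measurable_fun setT (@cube_torus d).
Proof.
apply: (@measurability _ _ _ (borel (torus R d)) setT (@cube_torus d) (@open (torus R d))) => //.
move=> _ [U oU <-]; rewrite setTI.
set W := (\pi_(torus R d) @^-1` U : set 'rV[R]_d).
have oW : open W by exact: oU.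
pose box (q : 'I_d -> rat) (e : R) : set (d.-tuple mR) :=
  \bigcap_(i in [set: 'I_d]) (@tnth d mR ^~ i @^-1`
      [set` `]ratr (q i) - e, ratr (q i) + e[]).
have mbox q e : measurable (box q e).
  apply: fin_bigcap_measurable; first exact: finite_finset.
  move=> i _; rewrite -[X in measurable X]setTI.
  by apply: measurable_tnth => //; exact: measurable_itv.
pose f (k : nat) : set (d.-tuple mR) :=
  if unpickle k is Some qn then
    let B := box (qn : {ffun 'I_d -> rat} * nat).1 qn.2.+1%:R^-1 in
    if `[< forall t, B t -> W (\row_i tnth t i) >] then B else set0
  else set0.
rewrite (_ : _ @^-1` U = \bigcup_k f k); last first.
  apply/seteqP; split => [t Ut|t [k _]]; last first.
    rewrite /f; case: unpickle => //= qn; case: asboolP => // h /h //.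
  have : nbhs (\row_i tnth t i : 'rV[R]_d) W.
    by apply: open_nbhs_nbhs; split.
  move=> /nbhs_ballP [e /= e0 We].
  have e20 : 0 < e / 2 by rewrite divr_gt0.
  have [n ne] : exists n : nat, n.+1%:R^-1 < e / 2.
    have [n _ /(_ n)/= h] := near_infty_natSinv_lt (PosNum e20).
    by exists n; apply: h => /=.
  have n0 : 0 < (n.+1%:R^-1 : R) by rewrite invr_gt0.
  have /choice [q qt] : forall i : 'I_d, exists r : rat,
      `|ratr r - (tnth t i : R)| < n.+1%:R^-1.
    move=> i; have : (tnth t i : R) - n.+1%:R^-1 < tnth t i + n.+1%:R^-1.
      by rewrite ltrD2l gtrN.
    move=> /rat_in_itvoo [r]; rewrite in_itv/= => /andP[h1 h2]; exists r.
    by rewrite ltr_distl h1 h2.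
  exists (pickle ([ffun i => q i] : {ffun 'I_d -> rat}, n)) => //.
  rewrite /f pickleK /=; case: asboolP => [_|[]].
    by move=> i _ /=; rewrite ffunE in_itv/= -ltr_distl distrC; exact: qt.
  move=> s Bs; apply: We; split => // i j; rewrite !mxE.
  have := Bs j I; rewrite /= ffunE in_itv/= -ltr_distl => sj.
  rewrite /ball/= -(subrKA (ratr (q j) : R)).
  rewrite (le_lt_trans (ler_normD _ _))// (splitr e) ltrD//.
    by rewrite distrC (lt_trans (qt j)).
  by rewrite distrC (lt_trans sj).
apply: bigcup_measurable => k _; rewrite /f.
by case: unpickle => //= qn; case: asboolP.
Qed.
HB.instance Definition _ d := isMeasurableFun.Build _ _ _ _
  (@cube_torus d) (@measurable_cube_torus d).

Definition lambda d : probability (borel (torus R d)) R :=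
  distribution (cube_lebesgue d) (@cube_torus d).

End lebesgue_torus.

(* {1, 2} with the discrete topology; [ord0] stands for 1, [ord_max] for 2. *)
Definition spin : Type := discrete_topology 'I_2.
HB.instance Definition _ := Finite.copy spin 'I_2.
HB.instance Definition _ := DiscreteTopology.copy spin (discrete_topology 'I_2).
HB.instance Definition _ := isPointed.Build spin ord0.

(* The elements of Z^d / n Z^d are given by their representatives in
   {0, ..., n-1}^d. The class of (x - y) / n in the torus is
   [site_pt x - site_pt y]. *)
Definition dtorus (d n : nat) : finType := 'rV['I_n]_d.

Definition site d n (L : {set dtorus d n}) : finType :=
  {x : dtorus d n | x \in L}.

Definition config d n (L : {set dtorus d n}) : Type := {ffun site L -> spin}.
HB.instance Definition _ d n L := Finite.on (@config d n L).
HB.instance Definition _ d n L :=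
  isPointed.Build (@config d n L) [ffun=> ord0].
HB.instance Definition _ d n L := @isMeasurable.Build default_measure_display
  (@config d n L) discrete_measurable discrete_measurable0
  discrete_measurableC discrete_measurableU.

Section model.
Context (R : realType) (d : nat).
Local Notation T := (torus R d).

Definition site_pt n (x : dtorus d n) : T :=
  \pi_T (\row_(i < d) ((x 0 i : nat)%:R / n%:R)).

Definition hamiltonian (J : T -> R) n (L : {set dtorus d n}) (s : config L) : R :=
  - (#|L|%:R^-1 * \sum_(x : site L) \sum_(y : site L)
       J (site_pt (val x) - site_pt (val y)) * (s x == s y)%:R).

Definition gibbs (J : T -> R) (beta : R) n (L : {set dtorus d n}) :
    probability (config L) R :=
  mnormalize
    (wdirac (fun s : config L => NngNum (expR_ge0 (- beta * hamiltonian J s)))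
            id)
    (dirac point).

(* (1 / |L|) \sum_(x in L) delta_(x / n, s x), whose mass is one unless [L] is
   empty; only in that case does [mnormalize] change anything, returning a
   junk value. *)
Definition empirical n (L : {set dtorus d n}) (s : config L) :
    Pr R (T * spin)%type :=
  mnormalize
    (wdirac (fun _ : site L => (#|L|%:R^-1)%:nng)
            (fun x => (site_pt (val x), s x) : borel (T * spin)%type))
    (dirac point).

Lemma empiricalE n (L : {set dtorus d n}) (s : config L) : L != finset.set0 ->
  empirical s = wdirac (fun _ : site L => (#|L|%:R^-1)%:nng)
    (fun x => (site_pt (val x), s x) : borel (T * spin)%type)
  :> (set (borel (T * spin)%type) -> \bar R).
Proof.
rewrite -card_gt0 => L0; rewrite /empirical /=; set w := wdirac _ _.
have w1 : w setT = 1%E.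
  rewrite /w /wdirac (eq_bigr (fun=> (#|L|%:R^-1)%:E)) => [|i _].
    rewrite sumEFin sumr_const card_sig.
    rewrite -[_ *+ _]mulr_natl /=.
    by rewrite mulfV// pnatr_eq0 -lt0n.
  by rewrite diracT mule1.
apply/funext => A; rewrite /mnormalize [_ setT]w1 onee_eq0/= invr1.
by rewrite mule1.
Qed.

Fact measurable_empirical n (L : {set dtorus d n}) :
  measurable_fun setT (@empirical n L : config L -> borel (Pr R _)).
Proof. by []. Qed.
HB.instance Definition _ n (L : {set dtorus d n}) :=
  isMeasurableFun.Build _ _ _ (borel (Pr R (T * spin)%type))
    (@empirical n L : config L -> borel (Pr R _)) (@measurable_empirical n L).

Definition empirical_law (J : T -> R) (beta : R) n (L : {set dtorus d n}) :
    Pr R (Pr R (T * spin)%type) :=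
  distribution (gibbs J beta L) (@empirical n L : config L -> borel (Pr R _)).

Definition density_measure (f : T -> R) (A : set (borel T)) : \bar R :=
  (\int[lambda R d]_(u in A) (f u)%:E)%E.

Definition component (phi : Pr R (T * spin)%type) (a : spin)
    (A : set (borel T)) : \bar R :=
  phi (A `*` [set a]).

(* Weak convergence of n^-d \sum_(x in L n) delta_(x / n) to the measure of
   density [rho] with respect to [lambda R d]. *)
Definition cvg_density (L : forall n, {set dtorus d n}) (rho : T -> R) : Prop :=
  forall f : T -> R, continuous f -> bounded_fun f ->
    (\int[wdirac (fun _ : site (L n) => ((n ^ d)%:R^-1)%:nng)
                 (fun x => site_pt (val x) : borel T)]_u f u)%R
      @[n --> \oo] -->
    (\int[lambda R d]_u (f u * rho u))%R.

Definition has_density (rho : T -> R) (phi : Pr R (T * spin)%type)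
    (alpha : spin -> T -> R) : Prop :=
  [/\ forall a, measurable_fun setT (alpha a : borel T -> R),
      forall a u, 0 <= alpha a u,
      {ae lambda R d, forall u, alpha ord0 u + alpha ord_max u = 1} &
      forall a A, measurable A ->
        component phi a A = density_measure (fun u => alpha a u * rho u) A].

(* [ln 0 = 0] in the library, in accordance with the convention 0 log 0 = 0. *)
Definition free_energy_density (J : T -> R) (rho : T -> R) (beta : R)
    (alpha : spin -> T -> R) : \bar R :=
  (- (beta%:E *
      \sum_(a : spin) \int[lambda R d]_u \int[lambda R d]_v
        (rho u * alpha a u * J (u - v) * (rho v * alpha a v))%:E)
   + \int[lambda R d]_u
       (rho u * \sum_(a : spin) alpha a u * ln (2 * alpha a u))%:E)%E.

(* Two densities [alpha] of the same [phi] agree almost everywhere for the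
   measure of density [rho], so the value below does not depend on which one
   is chosen by [xget]. *)
Definition free_energy (J : T -> R) (rho : T -> R) (beta : R)
    (phi : Pr R (T * spin)%type) : \bar R :=
  if `[< exists alpha, has_density rho phi alpha >]
  then free_energy_density J rho beta
         (xget (fun _ _ => 0) [set alpha | has_density rho phi alpha])
  else +oo%E.

(* [m] is a version of the local magnetization of [phi]. *)
Definition is_magnetization (rho : T -> R) (phi : Pr R (T * spin)%type)
    (m : T -> R) : Prop :=
  exists2 alpha, has_density rho phi alpha &
    {ae density_measure rho, forall u, m u = alpha ord0 u - alpha ord_max u}.

Definition minimizer (J : T -> R) (rho : T -> R) (beta : R)
    (phi : Pr R (T * spin)%type) : Prop :=
  forall psi, (free_energy J rho beta phi <= free_energy J rho beta psi)%E.

End model.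

(* Main.v *)
(* Write a state as (1 + m)/2, (1 - m)/2 times the density; up to a constant the
   free energy is F(m) = E[h(m)] - (beta/2) E[m K m], where h is the entropy
   and K is the integral operator with kernel J(u - v).  Let M > 0 be a
   continuous solution of beta K M = artanh M.  Since h(m) is strongly convex
   as a function of m^2, and since m(u) m(v) is at most the mean of
   m(u)^2 M(v)/M(u) and m(v)^2 M(u)/M(v), one gets F(m) - F(M) >=
   E[(m^2 - M^2)^2]/12 + c Var(m/M), so that M and -M are the only minimizers.
   The monotone iteration M_(k+1) = tanh(beta K M_k) from M_0 = 1 either
   converges to such an M or tends to 0; in the latter case the M_k replace M
   in the above inequality, and 0 is the only minimizer.

   The same inequality holds when E is the average over the sites, which makes
   it stable: block magnetizations of almost minimal free energy are close to
   M or to -M.  A Gibbs configuration has almost minimal block free energy with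
   probability exponentially close to one, because there are only polynomially
   many block magnetizations, the number of configurations with a given one is
   bounded by its entropy, and the partition function is bounded from below by
   Jensen's inequality for a product measure.  Spin-flip symmetry yields the
   weights 1/2. *)
From HB Require Import structures.
Require Import Defs.
From mathcomp Require Import all_boot all_order all_algebra.
From mathcomp Require Import all_classical all_reals all_analysis.
From mathcomp Require Import measurable_realfun giry.
From mathcomp Require Import ring lra.

Set Implicit Arguments.
Unset Strict Implicit.
Unset Printing Implicit Defensive.

Import Order.TTheory GRing.Theory Num.Theory numFieldNormedType.Exports.

Local Open Scope classical_set_scope.
Local Open Scope ring_scope.
Local Open Scope quotient_scope.

(** * Entropy and hyperbolic tangent *)

Section entropy.
Context {R : realType}.
Implicit Types (m M x y : R).

(** The free energy is in general not convex in m; the substitution s = m^2 replaces convexity. The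
    function h is [neg_entropy], the relative entropy of the spin law of mean m with respect to the
    uniform law. Its derivative in s is artanh(m)/(2m) = (1 + s/3 + s^2/5 + ...)/2, of slope at
    least 1/6, whence the constant 1/12. The term in m^2 forgets the sign of m; the variance of m/M
    recovers it, because J > 0 makes it costly for two regions to choose opposite signs. When there
    is no positive solution M, the comparison uses a positive e with b K e <= (1 + delta) e, for
    every delta > 0. The inequality asks only for an expectation E and a symmetric K, and it is
    quantitative. It therefore applies to the sites themselves, where M solves the equation up to a
    small error, and neither a large deviation principle nor compactness of the space of measures
    enters. Blocks are the boxes of a grid on the torus whose mesh does not depend on n: this is
    what keeps the number of block magnetizations polynomial. *)

Definition neg_entropy m : R :=
  (1 + m) / 2 * ln (1 + m) + (1 - m) / 2 * ln (1 - m).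

Definition artanh m : R := (ln (1 + m) - ln (1 - m)) / 2.

(** Written with a single exponential, so that monotonicity and the bound by 1 can be read off. *)
Definition tanh x : R := 1 - 2 / (expR (2 * x) + 1).

Lemma tanh0 : tanh 0 = 0.
Proof. by rewrite /tanh mulr0 expR0 divff ?subrr. Qed.

Lemma tanh_lt1 x : tanh x < 1.
Proof.
by rewrite /tanh ltrBlDr ltrDl divr_gt0// addr_gt0// expR_gt0.
Qed.

Lemma tanh_le x y : x <= y -> tanh x <= tanh y.
Proof.
move=> xy; rewrite /tanh lerD2l lerN2 ler_pM2l// lef_pV2 ?posrE ?addr_gt0 ?expR_gt0//.
by rewrite lerD2r ler_expR ler_pM2l.
Qed.

Lemma tanh_ge0 x : 0 <= x -> 0 <= tanh x.
Proof. by move=> /tanh_le; rewrite tanh0. Qed.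

Lemma tanh_gt0 x : 0 < x -> 0 < tanh x.
Proof.
move=> x0; rewrite /tanh subr_gt0 ltr_pdivrMr ?addr_gt0 ?expR_gt0//.
rewrite mul1r -[X in X < _]/(1 + 1)%R ltrD2r expR_gt1 ?mulr_gt0//.
Qed.

Lemma tanhN x : tanh (- x) = - tanh x.
Proof.
rewrite /tanh mulrN expRN.
have := expR_gt0 (2 * x); set E := expR _ => E0.
have E1 : E + 1 != 0 by rewrite gt_eqF// addr_gt0.
have E2 : E != 0 by rewrite gt_eqF.
have E3 : 1 + E != 0 by rewrite addrC.
field; by rewrite ?E1 ?E2 ?E3.
Qed.

Lemma tanh_gtN1 x : -1 < tanh x.
Proof. by rewrite ltrNl -tanhN tanh_lt1. Qed.

Lemma tanhK x : artanh (tanh x) = x.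
Proof.
rewrite /artanh /tanh.
have := expR_gt0 (2 * x); set E := expR _ => E0.
have E1 : 0 < E + 1 by rewrite addr_gt0.
have E1n : E + 1 != 0 by rewrite gt_eqF.
have -> : 1 + (1 - 2 / (E + 1)) = E * (2 / (E + 1)) by field.
have -> : 1 - (1 - 2 / (E + 1)) = 2 / (E + 1) by field.
by rewrite lnM ?posrE ?divr_gt0// addrK /E expRK; field.
Qed.

Lemma continuous_tanh : continuous tanh.
Proof.
move=> x; apply: cvgB; first exact: cvg_cst.
apply: cvgM; first exact: cvg_cst.
apply: cvgV; first by rewrite gt_eqF// addr_gt0// expR_gt0.
apply: cvgD; last exact: cvg_cst.
apply: continuous_comp; last exact: continuous_expR.
by apply: cvgM; [exact: cvg_cst|exact: cvg_id].
Qed.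

Lemma neg_entropyN m : neg_entropy (- m) = neg_entropy m.
Proof. by rewrite /neg_entropy opprK addrC. Qed.

Lemma neg_entropy0 : neg_entropy 0 = 0.
Proof. by rewrite /neg_entropy subr0 addr0 ln1 mulr0 addr0. Qed.

Lemma neg_entropy1 : neg_entropy 1 = ln 2.
Proof. by rewrite /neg_entropy subrr mul0r mul0r addr0 divff ?mul1r. Qed.

Lemma neg_entropy_le_ln2 m : -1 <= m <= 1 -> neg_entropy m <= ln 2.
Proof.
move=> /andP[m1 m2]; rewrite /neg_entropy.
have l (t : R) : 0 <= t <= 2 -> t / 2 * ln t <= t / 2 * ln 2.
  move=> /andP[t0 t2]; apply: ler_wpM2l; first by rewrite divr_ge0.
  move: t0; rewrite le_eqVlt => /predU1P[<-|t0]; last by rewrite ler_ln ?posrE.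
  by rewrite ln0// ln_ge0// ler1n.
apply: (@le_trans _ _ ((1 + m) / 2 * ln 2 + (1 - m) / 2 * ln 2)).
  by apply: lerD; apply: l; lra.
by rewrite -mulrDl; lra.
Qed.

Lemma neg_entropy_ge0 m : -1 <= m <= 1 -> 0 <= neg_entropy m.
Proof.
move=> /andP[m1 m2]; rewrite /neg_entropy.
(* Tangent bound at t = 1. For t = 1 + m and t = 1 - m the lower bounds m and -m cancel. *)
have l (t : R) : 0 <= t -> t - 1 <= t * ln t.
  rewrite le_eqVlt => /predU1P[<-|t0]; first by rewrite mul0r; lra.
  have := @le_ln1Dx R (t^-1 - 1).
  rewrite addrCA subrr addr0 ltrBrDl subrr invr_gt0 => /(_ t0).
  rewrite lnV ?posrE// => h.
  have := ler_wpM2l (ltW t0) h.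
  rewrite mulrBr divff ?gt_eqF// mulr1 mulrN; lra.
have := l (1 + m); have := l (1 - m); lra.
Qed.

Lemma is_derive_ln1D x : -1 < x -> is_derive x 1 (fun t => ln (1 + t)) (1 + x)^-1.
Proof.
move=> x1; have x0 : 0 < 1 + x by lra.
have := @is_derive1_comp R (@ln R) (fun t => 1 + t) x _ _ (is_derive1_ln x0).
move=> /(_ 1); rewrite mulr1; apply.
by rewrite -[X in is_derive _ _ _ X]add0r; exact: is_deriveD.
Qed.

Lemma is_derive_ln1B x : x < 1 -> is_derive x 1 (fun t => ln (1 - t)) (- (1 - x)^-1).
Proof.
move=> x1; have x0 : 0 < 1 - x by lra.
have := @is_derive1_comp R (@ln R) (fun t => 1 - t) x _ _ (is_derive1_ln x0).
move=> /(_ (- 1)); rewrite mulrN1; apply.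
by rewrite -[X in is_derive _ _ _ X]add0r; exact: is_deriveB.
Qed.

Lemma is_derive_neg_entropy x : -1 < x < 1 -> is_derive x 1 neg_entropy (artanh x).
Proof.
move=> /andP[x1 x2]; rewrite /neg_entropy.
have d1 := is_derive_ln1D x1; have d2 := is_derive_ln1B x2.
apply: is_derive_eq.
rewrite /artanh /GRing.scale /=.
have n1 : 1 + x != 0 by rewrite gt_eqF//; lra.
have n2 : 1 - x != 0 by rewrite gt_eqF//; lra.
set a := ln _; set b := ln _.
field. by rewrite n1 n2.
Qed.

Lemma is_derive_artanh x : -1 < x < 1 -> is_derive x 1 artanh (1 - x ^+ 2)^-1.
Proof.
move=> /andP[x1 x2]; rewrite /artanh.
have d1 := is_derive_ln1D x1; have d2 := is_derive_ln1B x2.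
apply: is_derive_eq.
rewrite /GRing.scale /=.
have n1 : 1 + x != 0 by rewrite gt_eqF//; lra.
have n2 : 1 - x != 0 by rewrite gt_eqF//; lra.
have -> : 1 - x ^+ 2 = (1 + x) * (1 - x) by ring.
field. by rewrite n1 n2.
Qed.

Lemma le_of_derive_ge0 (f f' : R -> R) x y : x <= y ->
  (forall t, x <= t <= y -> is_derive t 1 f (f' t)) ->
  (forall t, x <= t <= y -> 0 <= f' t) -> f x <= f y.
Proof.
move=> xy df f'0; apply: (@ger0_derive1_ndecr _ f x y) => //.
- by move=> t; rewrite in_itv/= => /andP[/ltW a /ltW b]; have [] := df t; rewrite ?a.
- move=> t; rewrite in_itv/= => /andP[/ltW a /ltW b].
  by have := df t; rewrite a b derive1E => /(_ isT)/@derive_val ->; rewrite f'0 ?a.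
apply: derivable_within_continuous => t; rewrite in_itv/= => h.
by have [] := df t h.
Qed.

(** The derivative of [neg_entropy x - x ^+ 4 / 12]. Splitting off the quartic term leaves a
    function that is still convex in x^2, and the quartic term yields the squared defect with factor
    1/12. *)
Let p x := artanh x - x ^+ 3 / 3.

Let is_derive_p x : -1 < x < 1 -> is_derive x 1 p ((1 - x ^+ 2)^-1 - x ^+ 2).
Proof.
move=> x1; have d := is_derive_artanh x1; rewrite /p; apply: is_derive_eq.
rewrite /GRing.scale /=; field.
by rewrite subr_eq0 eq_sym sqrf_eq1; apply/norP; split; apply/eqP; lra.
Qed.

Let p0 : p 0 = 0.
Proof. by rewrite /p /artanh subr0 addr0 ln1 subrr mul0r expr0n/= mul0r subrr. Qed.

(** In terms of a = x^2 the derivative of [p] is (1 - a)^-1 - a, which increases on [0, 1[. This is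
    the convexity of [p]. *)
Let le_dp x y : 0 <= x -> x <= y -> y < 1 ->
  (1 - x ^+ 2)^-1 - x ^+ 2 <= (1 - y ^+ 2)^-1 - y ^+ 2.
Proof.
move=> x0 xy y1.
have xx : x ^+ 2 <= y ^+ 2 by nra.
have yy : y ^+ 2 < 1 by nra.
have xx0 : 0 <= x ^+ 2 by nra.
set a := x ^+ 2 in xx xx0 *; set b := y ^+ 2 in xx yy *.
have a1 : 0 < 1 - a by lra. have b1 : 0 < 1 - b by lra.
rewrite -subr_ge0.
have -> : (1 - b)^-1 - b - ((1 - a)^-1 - a) =
   (b - a) * (1 - (1 - a) * (1 - b)) / ((1 - a) * (1 - b)).
  by field; rewrite !gt_eqF.
rewrite divr_ge0 ?mulr_ge0 ?subr_ge0//; [|lra..].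
nra.
Qed.

(* [p] is convex on [0, 1[ and vanishes at 0. *)
Let p_star x y : 0 <= x -> x <= y -> y < 1 -> p x * y <= p y * x.
Proof.
move=> x0 xy y1.
have [->|y0] := eqVneq y 0.
  by rewrite mulr0 p0 mul0r.
have yp : 0 < y by rewrite lt_neqAle eq_sym y0 (le_trans x0 xy).
set l := x / y.
have l0 : 0 <= l by rewrite divr_ge0// ltW.
have l1 : l <= 1 by rewrite ler_pdivrMr// mul1r.
have -> : x = l * y by rewrite /l divfK.
rewrite mulrA ler_pM2r// [p y * l]mulrC -subr_ge0.
(* [q] vanishes at 0 and has derivative l (p'(t) - p'(l t)) >= 0 by [le_dp]; its value at t = y is
   the claim. *)
pose q t := l * p t - p (l * t).
have q0 : q 0 = 0 by rewrite /q mulr0 p0 mulr0 subrr.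
rewrite -[leLHS]q0; apply: (@le_of_derive_ge0 q (fun t => l *
   (((1 - t ^+ 2)^-1 - t ^+ 2) - ((1 - (l * t) ^+ 2)^-1 - (l * t) ^+ 2)))).
- exact: ltW.
- move=> t /andP[t0 ty]; rewrite /q.
  have lt : 0 <= l * t <= t by nra.
  have d1 : is_derive t 1 p ((1 - t ^+ 2)^-1 - t ^+ 2) by apply: is_derive_p; lra.
  have d2 : is_derive (l * t) 1 p ((1 - (l * t) ^+ 2)^-1 - (l * t) ^+ 2).
    by apply: is_derive_p; lra.
  have d4 : is_derive t 1 (fun u => l * u) l.
    by apply: is_derive_eq; rewrite /GRing.scale/= mulr1.
  have d3 := @is_derive1_comp R p (fun u => l * u) t _ _ d2 d4.
  by apply: is_derive_eq; rewrite /GRing.scale /=; ring.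
- move=> t /andP[t0 ty]; rewrite mulr_ge0// subr_ge0 le_dp//; nra.
Qed.

(** Derivatives are available only inside ]-1, 1[. Negative m follow by evenness; m = 1 follows by a
    left limit of the polynomial alone, since [neg_entropy] attains its upper bound ln 2 there. *)
Let from_lt1 (k c : R) : (forall m, 0 <= m < 1 -> k * m ^+ 2 + m ^+ 4 / 12 + c <= neg_entropy m) ->
  forall m, -1 <= m <= 1 -> k * m ^+ 2 + m ^+ 4 / 12 + c <= neg_entropy m.
Proof.
move=> H.
have H1 m : 0 <= m <= 1 -> k * m ^+ 2 + m ^+ 4 / 12 + c <= neg_entropy m.
  move=> /andP[m0]; rewrite le_eqVlt => /predU1P[->|m1]; last by apply: H; rewrite m0.
  rewrite neg_entropy1 !expr1n.
  apply/ler_addgt0Pr => e e0.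
  pose F (t : R) := k * t ^+ 2 + t ^+ 4 / 12 + c.
  have cF : F t @[t --> (1 : R)^'-] --> F 1.
    apply: cvg_at_left_filter.
    apply: cvgD; last exact: cvg_cst.
    apply: cvgD.
      apply: cvgM; first exact: cvg_cst.
      exact: (@exprn_continuous _ 2).
    apply: cvgM; last exact: cvg_cst.
    exact: (@exprn_continuous _ 4).
  have -> : k * 1 + 1 / 12 + c = F 1 by rewrite /F !expr1n.
  suff : F 1 <= ln 2 by lra.
  rewrite -(cvg_lim _ cF)//; apply: limr_le; first by apply: cvgP cF.
  near=> t.
  have t01 : 0 <= t < 1 by apply/andP; split; near: t; [exact: nbhs_left_ge|exact: nbhs_left_lt].
  apply: (le_trans (H t t01)); apply: neg_entropy_le_ln2; lra.
move=> m m1; have [m0|m0] := leP 0 m; first by apply: H1; lra.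
have := H1 (- m); rewrite neg_entropyN sqrrN.
have -> : (- m) ^+ 4 = m ^+ 4 by ring.
by apply; lra.
Unshelve. all: by end_near.
Qed.

(* Strong convexity of the entropy as a function of the square of the
   magnetization. *)
Lemma neg_entropy_tangent M m : 0 < M < 1 -> -1 <= m <= 1 ->
  neg_entropy M + (m ^+ 2 - M ^+ 2) / 2 * (artanh M / M)
    + (m ^+ 2 - M ^+ 2) ^+ 2 / 12 <= neg_entropy m.
Proof.
move=> /andP[M0 M1].
(* This is p(M)/M, so that the derivative p(x) - k x of [u] vanishes at M. As p(x)/x is
   nondecreasing, [u] decreases before M and increases after it; expanding u(M) <= u(m) gives the
   claim. *)
pose k := artanh M / M - M ^+ 2 / 3.
pose u x := neg_entropy x - (k / 2 * x ^+ 2 + x ^+ 4 / 12).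
have kE : k = p M / M by rewrite /k /p; field; rewrite gt_eqF.
have du x : 0 <= x < 1 -> is_derive x 1 u (p x - k * x).
  move=> x01; have d : is_derive x 1 neg_entropy (artanh x) by apply: is_derive_neg_entropy; lra.
  rewrite /u; apply: is_derive_eq; rewrite /GRing.scale/= /p; by field; rewrite ?gt_eqF.
have uM x : 0 <= x < 1 -> u M <= u x.
  move=> /andP[x0 x1]; have [Mx|xM] := leP M x.
    apply: (@le_of_derive_ge0 u (fun t => p t - k * t) M x) => //.
      move=> t /andP[Mt tx]; apply: du; apply/andP; split; lra.
    move=> t /andP[Mt tx]; rewrite kE subr_ge0 mulrAC ler_pdivrMr//.
    by apply: p_star => //; lra.
  rewrite -lerN2.
  apply: (@le_of_derive_ge0 (fun t => - u t) (fun t => - (p t - k * t)) x M).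
  - exact: ltW.
  - move=> t /andP[Mt tx]; have d : is_derive t 1 u (p t - k * t).
      by apply: du; apply/andP; split; lra.
    exact: is_deriveN.
  - move=> t /andP[Mt tx]; rewrite kE oppr_ge0 subr_le0 mulrAC ler_pdivlMr//.
  by apply: p_star => //; lra.
have H x : 0 <= x < 1 -> k / 2 * x ^+ 2 + x ^+ 4 / 12 + u M <= neg_entropy x.
  by move=> /uM; rewrite {2}/u; lra.
move=> /(from_lt1 H); rewrite /u /k.
set A := artanh M / M.
set hM := neg_entropy M; set hm := neg_entropy m.
by apply: le_trans; rewrite le_eqVlt; apply/orP; left; apply/eqP; field.
Qed.

(** The limit M -> 0 of [neg_entropy_tangent], where artanh M / M tends to 1. It rests on p(x) >= x,
    which holds because p' >= p'(0) = 1. *)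
Lemma neg_entropy_ge m : -1 <= m <= 1 ->
  m ^+ 2 / 2 + m ^+ 4 / 12 <= neg_entropy m.
Proof.
have p_ge x : 0 <= x < 1 -> x <= p x.
  move=> /andP[x0 x1].
  rewrite -subr_ge0.
  pose q t := p t - t.
  have q0 : q 0 = 0 by rewrite /q p0 subrr.
  rewrite -[leLHS]q0; apply: (@le_of_derive_ge0 q (fun t => (1 - t ^+ 2)^-1 - t ^+ 2 - 1)) => //.
    move=> t /andP[t0 tx]; have t1 : -1 < t < 1 by apply/andP; split; lra.
    by have d := is_derive_p t1; rewrite /q; apply: is_deriveB.
  move=> t /andP[t0 tx]; have := @le_dp 0 t.
  by rewrite expr0n/= !subr0 invr1 subr_ge0; apply => //; lra.
pose u x := neg_entropy x - (x ^+ 2 / 2 + x ^+ 4 / 12).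
have u0 : u 0 = 0 by rewrite /u neg_entropy0 !expr0n/=; lra.
suff H x : 0 <= x < 1 -> 2^-1 * x ^+ 2 + x ^+ 4 / 12 + 0 <= neg_entropy x.
  by move=> /(from_lt1 H); rewrite addr0 [_^-1 * _]mulrC.
move=> /andP[x0 x1]; rewrite addr0 -subr_ge0 [_^-1 * _]mulrC -/(u x) -[leLHS]u0.
apply: (@le_of_derive_ge0 u (fun t => p t - t) 0 x) => //.
  move=> t /andP[t0 tx]; have t1 : -1 < t < 1 by apply/andP; split; lra.
  have d := is_derive_neg_entropy t1; rewrite /u.
  by apply: is_derive_eq; rewrite /GRing.scale/= /p; field.
move=> t /andP[t0 tx]; rewrite subr_ge0 p_ge//; lra.
Qed.

Lemma artanh_gt0 x : 0 < x < 1 -> 0 < artanh x.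
Proof.
move=> /andP[x0 x1]; rewrite /artanh divr_gt0// subr_gt0 ltr_ln ?posrE; lra.
Qed.

(** Shows that artanh is almost linear near 0: artanh x <= (1 + delta) x as soon as x <= delta / (1
    + delta). *)
Lemma artanh_le x : 0 <= x < 1 -> artanh x <= x / (1 - x).
Proof.
move=> /andP[x0 x1]; rewrite /artanh.
have h1 : ln (1 + x) <= x by apply: le_ln1Dx; lra.
have h2 : - ln (1 - x) <= x / (1 - x).
  rewrite -lnV ?posrE ?subr_gt0//.
  rewrite [X in ln X](_ : _ = 1 + x / (1 - x)); last by field; rewrite gt_eqF ?subr_gt0.
  by apply: le_ln1Dx; rewrite (@lt_le_trans _ _ 0)// divr_ge0// subr_ge0 ltW.
have : x <= x / (1 - x) by rewrite ler_pdivlMr ?subr_gt0//; nra.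
move: h1 h2; set a := ln _; set b := ln _; lra.
Qed.

Lemma le_artanh_of_tanh_le x y : y < 1 -> tanh x <= y -> x <= artanh y.
Proof.
move=> y1 h; rewrite -[leLHS]tanhK /artanh ler_pM2r//.
have := tanh_gtN1 x; have := tanh_lt1 x => t1 t2.
by apply: lerB; rewrite ler_ln ?posrE; lra.
Qed.

End entropy.

(** * Mean-field Gibbs weights on a finite set *)

Section spins.
Context {R : realType}.

Definition sgn (a : spin) : R := if a == ord0 then 1 else -1.

Lemma sum_spin (F : spin -> R) : \sum_(a : spin) F a = F ord0 + F ord_max.
Proof.
rewrite (eq_bigr (fun a : 'I_2 => F a))//.
transitivity (\sum_(a < 2) F a); first by [].
by rewrite big_ord_recl big_ord1; congr (_ + F _); apply/val_inj.
Qed.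

Lemma sgn0 : sgn ord0 = 1. Proof. by []. Qed.

Lemma sgn_max : sgn ord_max = -1. Proof. by []. Qed.

Lemma spinP (a : spin) : a = ord0 \/ a = ord_max.
Proof. by case: a => -[|[|//]] i; [left|right]; apply/val_inj. Qed.

Lemma sgnM a b : (a == b)%:R = (1 + sgn a * sgn b) / 2 :> R.
Proof.
by have [->|->] := spinP a; have [->|->] := spinP b; rewrite ?eqxx ?sgn0 ?sgn_max /=; lra.
Qed.

Lemma normr_sgn a : `|sgn a| = 1.
Proof. by have [->|->] := spinP a; rewrite ?sgn0 ?sgn_max ?normrN1 ?normr1. Qed.

Lemma sgn_bound a : -1 <= sgn a <= 1.
Proof. by have [->|->] := spinP a; rewrite ?sgn0 ?sgn_max; lra. Qed.

(** The law of a single spin whose sign has mean m; for a state of magnetization m it is also the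
    density [alpha]. *)
Definition bern (m : R) (a : spin) : R := (1 + sgn a * m) / 2.

Lemma bern_ge0 m a : -1 <= m <= 1 -> 0 <= bern m a.
Proof. by rewrite /bern; have [->|->] := spinP a; rewrite ?sgn0 ?sgn_max; lra. Qed.

Lemma bern_gt0 m a : -1 < m < 1 -> 0 < bern m a.
Proof. by rewrite /bern; have [->|->] := spinP a; rewrite ?sgn0 ?sgn_max; lra. Qed.

Lemma sum_bern m : \sum_(a : spin) bern m a = 1.
Proof. by rewrite sum_spin /bern sgn0 sgn_max; lra. Qed.

Lemma sum_bern_sgn m : \sum_(a : spin) bern m a * sgn a = m.
Proof. by rewrite sum_spin /bern sgn0 sgn_max; lra. Qed.

Lemma sum_bern_ln m : -1 <= m <= 1 ->
  \sum_(a : spin) bern m a * ln (bern m a) = neg_entropy m - ln 2.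
Proof.
move=> m1.
have l (t : R) : 0 <= t -> t / 2 * ln (t / 2) = t / 2 * ln t - t / 2 * ln 2.
  rewrite le_eqVlt => /predU1P[<-|t0]; first by rewrite !mul0r subrr.
  by rewrite ln_div ?posrE// mulrBr.
rewrite sum_spin /bern sgn0 sgn_max mul1r mulN1r !l; [|lra..].
by rewrite /neg_entropy; set a := ln 2; lra.
Qed.

(** The logarithm is affine in the sign of the spin, hence the log-probability of a configuration
    under a product law is linear in its signs and, if m is constant on blocks, depends only on the
    block means. *)
Lemma ln_bernE m a : ln (bern m a) =
  (ln ((1 + m) / 2) + ln ((1 - m) / 2)) / 2
    + sgn a * ((ln ((1 + m) / 2) - ln ((1 - m) / 2)) / 2).
Proof.
rewrite /bern; have [->|->] := spinP a; rewrite ?sgn0 ?sgn_max ?mul1r ?mulN1r.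
all: set u := ln _; set v := ln _; lra.
Qed.

End spins.

Section mean_field.
Context {R : realType} {X I : finType}.
Implicit Types (s : {ffun X -> spin}) (m M : X -> R).

Local Notation N := (#|X|%:R : R).

Lemma sum_prod_spin (f : X -> spin -> R) :
  \sum_(s : {ffun X -> spin}) \prod_x f x (s x) = \prod_x \sum_(a : spin) f x a.
Proof. by rewrite bigA_distr_bigA. Qed.

Definition prodm m s : R := \prod_x bern (m x) (s x).

Lemma sum_prodm m : \sum_(s : {ffun X -> spin}) prodm m s = 1.
Proof.
by rewrite /prodm (sum_prod_spin (fun x => bern (m x))) big1// => x _; rewrite sum_bern.
Qed.

Lemma prodm_gt0 m s : (forall x, -1 < m x < 1) -> 0 < prodm m s.
Proof. by move=> m1; apply: prodr_gt0 => x _; exact: bern_gt0. Qed.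

Lemma prodm_ge0 m s : (forall x, -1 <= m x <= 1) -> 0 <= prodm m s.
Proof. by move=> m1; apply: prodr_ge0 => x _; exact: bern_ge0. Qed.

Lemma prodm_marginal m x (g : spin -> R) :
  \sum_(s : {ffun X -> spin}) prodm m s * g (s x) = \sum_(a : spin) bern (m x) a * g a.
Proof.
transitivity (\sum_(s : {ffun X -> spin}) \prod_y (bern (m y) (s y) * (if y == x then g (s y) else 1))).
  apply: eq_bigr => s _; rewrite big_split/=; congr (_ * _).
  by rewrite -big_mkcond/= big_pred1_eq.
rewrite (sum_prod_spin (fun y a => bern (m y) a * (if y == x then g a else 1))).
rewrite (bigD1 x)//= [X in _ * X]big1 ?mulr1.
  by apply: eq_bigr => a _; rewrite eqxx.
move=> y /negPf yx; rewrite yx -[RHS](sum_bern (m y)).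
by under eq_bigr do rewrite mulr1.
Qed.

Lemma prodm_corr m x y : x != y ->
  \sum_(s : {ffun X -> spin}) prodm m s * (sgn (s x) * sgn (s y)) = m x * m y.
Proof.
move=> xy.
transitivity (\sum_(s : {ffun X -> spin}) \prod_z (bern (m z) (s z) *
    ((if z == x then sgn (s z) else 1) * (if z == y then sgn (s z) else 1)))).
  apply: eq_bigr => s _; rewrite big_split/=; congr (_ * _).
  rewrite big_split/=; congr (_ * _).
    by rewrite -big_mkcond/= big_pred1_eq.
  by rewrite -big_mkcond/= big_pred1_eq.
rewrite (sum_prod_spin (fun z a => bern (m z) a * ((if z == x then sgn a else 1) *
  (if z == y then sgn a else 1)))).
rewrite (bigD1 x)//= (bigD1 y)/=; last by rewrite eq_sym.
rewrite [X in _ * (_ * X)]big1 ?mulr1 => [|z /andP[/negPf zx /negPf zy]]; last first.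
  rewrite zx zy -[RHS](sum_bern (m z)).
  by under eq_bigr do rewrite !mulr1.
rewrite eqxx (negPf xy) eqxx [y == x]eq_sym (negPf xy).
under eq_bigr do rewrite mulr1.
under [X in _ * X]eq_bigr do rewrite mul1r.
by rewrite !sum_bern_sgn.
Qed.

(* Jensen's inequality for the product measure with means [M]. *)
Lemma gibbs_variational (E : {ffun X -> spin} -> R) M :
  (forall x, -1 < M x < 1) ->
  expR (\sum_(s : {ffun X -> spin}) prodm M s * E s - \sum_x (neg_entropy (M x) - ln 2))
    <= \sum_(s : {ffun X -> spin}) expR (E s).
Proof.
move=> M1; set A := (X in expR X).
have p0 s : 0 < prodm M s by exact: prodm_gt0.
have lnp s : ln (prodm M s) = \sum_x ln (bern (M x) (s x)).
  apply: expR_inj; rewrite expR_sum lnK ?posrE//; apply: eq_bigr => x _.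
  by rewrite lnK ?posrE// bern_gt0.
(* Jensen by the tangent of exp at A: the correction E s - ln (prodm M s) - A has mean zero under
   [prodm M], because A is the mean of the other two terms. *)
have -> : expR A = \sum_(s : {ffun X -> spin}) prodm M s * (expR A * (1 + (E s - ln (prodm M s) - A))).
  rewrite -[LHS]mulr1 -[X in _ * X](sum_prodm M) mulr_sumr.
  apply/eqP; rewrite -subr_eq0 -sumrB.
  rewrite (eq_bigr (fun s => - expR A * (prodm M s * E s - prodm M s * ln (prodm M s) - A * prodm M s))); last first.
    by move=> s _; ring.
  rewrite -mulr_sumr !sumrB -mulr_sumr sum_prodm mulr1.
  rewrite [X in _ - X - _](_ : _ = \sum_x (neg_entropy (M x) - ln 2)) ?subrr ?mulr0//.
  under eq_bigr do rewrite lnp mulr_sumr.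
  rewrite exchange_big/=; apply: eq_bigr => x _.
  rewrite (prodm_marginal M x (fun a => ln (bern (M x) a))); apply: sum_bern_ln.
  by have /andP[/ltW-> /ltW->] := M1 x.
apply: ler_sum => s _.
apply: (@le_trans _ _ (prodm M s * (expR A * expR (E s - ln (prodm M s) - A)))).
  rewrite ler_pM2l// ler_pM2l ?expR_gt0//; exact: expR_ge1Dx.
by rewrite -expRD addrCA subrr addr0 expRB lnK ?posrE// mulrC divfK// gt_eqF.
Qed.

(** * Block magnetizations *)

Variable c : X -> I.

(** A function of the site rather than of its colour, so that it can be inserted as a magnetization
    into the free energy. *)
Definition block_mean s x : R :=
  (\sum_(y | c y == c x) sgn (s y)) / #|[pred y | c y == c x]|%:R.

Lemma card_block_gt0 x : (0 < #|[pred y | c y == c x]|)%N.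
Proof. by apply/card_gt0P; exists x; rewrite inE. Qed.

Lemma block_mean_bound s x : -1 <= block_mean s x <= 1.
Proof.
rewrite -ler_norml /block_mean normrM normfV [X in _ / X]ger0_norm//.
rewrite ler_pdivrMr ?ltr0n ?card_block_gt0// mul1r.
rewrite (le_trans (ler_norm_sum _ _ _))//.
rewrite (eq_bigr (fun=> 1)) => [|y _]; last by rewrite normr_sgn.
by rewrite sumr_const.
Qed.

Lemma block_mean_eq s x y : c x = c y -> block_mean s x = block_mean s y.
Proof. by rewrite /block_mean => ->. Qed.

Lemma sum_block_mean s (G : X -> R) : (forall x y, c x = c y -> G x = G y) ->
  \sum_x G x * (sgn (s x) - block_mean s x) = 0.
Proof.
move=> Gc; rewrite (partition_big c xpredT)//= big1// => i _.
have [/existsP[x /eqP xi]|/existsPn n] := boolP [exists x, c x == i]; last first.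
  by rewrite big_pred0// => x; apply/negbTE.
rewrite (eq_bigr (fun y => G x * (sgn (s y) - block_mean s x))) => [|y /eqP yi]; last first.
  by rewrite (Gc y x) ?(@block_mean_eq s y x) ?xi ?yi.
rewrite -mulr_sumr sumrB sumr_const -xi /block_mean -[_ *+ _]mulr_natr divfK ?subrr ?mulr0//.
by rewrite pnatr_eq0 -lt0n card_block_gt0.
Qed.

(** Replace G by its value at one representative of each block: this changes G by at most e and, by
    [sum_block_mean], the replaced sum vanishes. The factor 2 bounds the distance of a sign from a
    mean. *)
Lemma sum_block_mean_le s (G : X -> R) (e : R) :
  (forall x y, c x = c y -> `|G x - G y| <= e) ->
  `|\sum_x G x * (sgn (s x) - block_mean s x)| <= 2 * e * N.
Proof.
move=> Ge.
pose G0 x := G (odflt x [pick y | c y == c x]).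
have G0c x y : c x = c y -> G0 x = G0 y.
  rewrite /G0 => xy; rewrite xy; case: pickP => //= /(_ y); by rewrite eqxx.
have -> : \sum_x G x * (sgn (s x) - block_mean s x) =
    \sum_x (G x - G0 x) * (sgn (s x) - block_mean s x).
  rewrite -[RHS]addr0 -[X in _ + X](sum_block_mean s G0c) -big_split/=.
  by apply: eq_bigr => x _; ring.
rewrite (le_trans (ler_norm_sum _ _ _))//.
have -> : 2 * e * N = \sum_(x : X) (2 * e) by rewrite sumr_const mulr_natr.
apply: ler_sum => x _; rewrite normrM [2 * e]mulrC ler_pM//.
  rewrite /G0; case: pickP => [y /eqP yx|/(_ x)]; last by rewrite eqxx.
  by apply: Ge; rewrite yx.
rewrite (le_trans (ler_normB _ _))// normr_sgn.
have := block_mean_bound s x; rewrite -ler_norml; lra.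
Qed.

(** Under the product law whose means are the block means of s0, all configurations with these block
    means have the same probability, the inverse of the right-hand side, and these probabilities add
    up to at most 1. *)
Lemma card_block_mean s0 :
  \sum_(s | [forall x, block_mean s x == block_mean s0 x]) 1
    <= expR (\sum_x (ln 2 - neg_entropy (block_mean s0 x))) :> R.
Proof.
set m := block_mean s0.
have m1 x : -1 <= m x <= 1 by exact: block_mean_bound.
pose B x : R := (ln ((1 + m x) / 2) - ln ((1 - m x) / 2)) / 2.
have Bc x y : c x = c y -> B x = B y.
  by move=> xy; rewrite /B /m (block_mean_eq s0 xy).
have prodE s : [forall x, block_mean s x == m x] ->
    prodm m s = expR (\sum_x (neg_entropy (m x) - ln 2)).
  move=> /forallP ms.
  (* The mean may be 1 or -1, where [bern] can vanish and [ln] takes its default value. But s agrees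
     with m there: otherwise the non-negative numbers sgn(s x) sgn(s y) + 1 would sum to 0 over the
     block, although y = x contributes 2. *)
  have pos x : 0 < bern (m x) (s x).
    rewrite lt_neqAle bern_ge0// andbT eq_sym; apply/eqP.
    rewrite /bern => e.
    have e0 : sgn (s x) * m x = -1 by lra.
    have sm : sgn (s x) * sgn (s x) = 1 :> R.
      by have [->|->] := spinP (s x); rewrite ?sgn0 ?sgn_max; lra.
    have : \sum_(y | c y == c x) (sgn (s x) * sgn (s y) + 1) = 0 :> R.
      rewrite big_split/= -mulr_sumr sumr_const.
      have /eqP := ms x; rewrite /block_mean => /(congr1 (fun t => t * #|[pred y | c y == c x]|%:R)).
      rewrite divfK ?pnatr_eq0 -?lt0n ?card_block_gt0// => ->.
      by rewrite mulrA e0 mulN1r addrC subrr.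
    move/eqP; rewrite psumr_eq0 => [/allP/(_ x)|y _]; last first.
      by have [->|->] := spinP (s x); have [->|->] := spinP (s y); rewrite ?sgn0 ?sgn_max; lra.
    by rewrite mem_index_enum eqxx sm/= => /(_ isT)/eqP; lra.
  rewrite /prodm -[LHS]lnK ?posrE; last by apply: prodr_gt0.
  congr expR; apply: expR_inj; rewrite lnK ?posrE; last by apply: prodr_gt0.
  rewrite (eq_bigr (fun x => expR (ln (bern (m x) (s x))))); last first.
    by move=> x _; rewrite lnK ?posrE.
  rewrite -expR_sum; congr expR.
  (* By [ln_bernE] the two logarithms differ by the sum of B x (sgn (s x) - m x), which vanishes
     since B is constant on blocks. *)
  apply: subr0_eq; rewrite -sumrB -[RHS](sum_block_mean s Bc); apply: eq_bigr => x _.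
  rewrite -sum_bern_ln// sum_spin !ln_bernE (eqP (ms x)) /bern sgn0 sgn_max /B.
  by set u := ln _; set v := ln _; field.
set K := (X in _ <= expR X).
have KE : K = - \sum_x (neg_entropy (m x) - ln 2).
  by rewrite /K -sumrN; apply: eq_bigr => x _; rewrite opprB.
rewrite (eq_bigr (fun s => expR K * prodm m s)) => [|s /prodE ->]; last first.
  by rewrite KE -expRD addNr expR0.
rewrite -mulr_sumr ler_piMr ?expR_ge0// -(sum_prodm m) [leRHS](bigID (fun s => [forall x, block_mean s x == m x]))/=.
by rewrite lerDl sumr_ge0// => s _; exact: prodm_ge0.
Qed.

Variables (J : X -> X -> R) (b : R).

Definition free_energyX m : R :=
  N^-1 * \sum_x neg_entropy (m x) - b / 2 * (N^-1 ^+ 2 * \sum_x \sum_y J x y * (m x * m y)).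

Definition weightX s : R :=
  expR (b * (N^-1 * \sum_x \sum_y J x y * (s x == s y)%:R)).

Hypotheses (N0 : (0 < #|X|)%N) (b0 : 0 <= b) (J0 : forall x y, 0 <= J x y).

Let NR0 : 0 < N. Proof. by rewrite ltr0n. Qed.

Let NRn0 : N != 0. Proof. by rewrite gt_eqF. Qed.

(** The part of the exponent that does not depend on the spins, coming from the 1 in 1_{a = b} = (1
    + sgn a sgn b)/2. It cancels against the partition function. *)
Let C0 : R := b / 2 * (N^-1 * \sum_x \sum_y J x y).

Let weightXE s : weightX s =
  expR (C0 + b / 2 * (N^-1 * \sum_x \sum_y J x y * (sgn (s x) * sgn (s y)))).
Proof.
rewrite /weightX /C0 -mulrDr -mulrDr; congr expR.
rewrite -mulrA; congr (_ * _); rewrite mulrCA; congr (_ * _).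
rewrite -big_split/= mulr_sumr; apply: eq_bigr => x _.
rewrite -big_split/= mulr_sumr; apply: eq_bigr => y _.
by rewrite sgnM; field.
Qed.

(** [gibbs_variational] with the product law of means M. Pairs x != y are exact by independence; the
    diagonal terms only help, as J >= 0 and M^2 <= 1. *)
Lemma sum_weightX_ge M : (forall x, -1 < M x < 1) ->
  expR (C0 + N * (ln 2 - free_energyX M)) <= \sum_(s : {ffun X -> spin}) weightX s.
Proof.
move=> M1; have := gibbs_variational
  (fun s => b * (N^-1 * \sum_x \sum_y J x y * (s x == s y)%:R)) M1.
apply: le_trans; rewrite ler_expR.
have -> : \sum_x (neg_entropy (M x) - ln 2) = \sum_x neg_entropy (M x) - ln 2 *+ #|X|.
  by rewrite sumrB sumr_const.
have -> : C0 + N * (ln 2 - free_energyX M) =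
  b * (N^-1 * \sum_x \sum_y J x y * ((1 + M x * M y) / 2))
  - (\sum_x neg_entropy (M x) - ln 2 *+ #|X|).
  rewrite /C0 /free_energyX -[ln 2 *+ _]mulr_natl.
  have -> : \sum_x \sum_y J x y * ((1 + M x * M y) / 2) =
     (\sum_x \sum_y J x y) / 2 + (\sum_x \sum_y J x y * (M x * M y)) / 2.
    rewrite -mulrDl -big_split/= mulr_suml; apply: eq_bigr => x _.
    by rewrite -big_split/= mulr_suml; apply: eq_bigr => y _; field.
  set u := \sum_x _; set v := \sum_x _; set w := \sum_x _.
  by set l := ln 2; field.
rewrite lerD2r.
under [leRHS]eq_bigr do rewrite mulrCA (mulrCA (prodm _ _)).
rewrite -!mulr_sumr; apply: ler_wpM2l => //; apply: ler_wpM2l; first by rewrite invr_ge0.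
under [leRHS]eq_bigr do rewrite mulr_sumr.
rewrite [leRHS]exchange_big/=; apply: ler_sum => x _.
under [leRHS]eq_bigr do rewrite mulr_sumr.
rewrite [leRHS]exchange_big/=; apply: ler_sum => y _.
under eq_bigr do rewrite mulrCA.
rewrite -mulr_sumr; apply: ler_wpM2l => //.
have [->|xy] := eqVneq x y.
  under eq_bigr do rewrite eqxx mulr1.
  rewrite sum_prodm; have := M1 y => /andP[? ?]; nra.
under eq_bigr do rewrite sgnM mulrA mulrDr mulr1.
by rewrite -mulr_suml big_split/= sum_prodm prodm_corr.
Qed.

(** Signs are replaced by block means in one factor at a time; each replacement costs 2 e N per site
    by [sum_block_mean_le]. *)
Lemma block_mean_quadratic s (e : R) :
  (forall x y x' y', c x = c x' -> c y = c y' -> `|J x y - J x' y'| <= e) ->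
  `|\sum_x \sum_y J x y * (sgn (s x) * sgn (s y)) -
    \sum_x \sum_y J x y * (block_mean s x * block_mean s y)| <= 4 * e * N ^+ 2.
Proof.
move=> Je; set m := block_mean s.
have -> : \sum_x \sum_y J x y * (sgn (s x) * sgn (s y)) -
    \sum_x \sum_y J x y * (m x * m y) =
  \sum_x sgn (s x) * (\sum_y J x y * (sgn (s y) - m y)) +
  \sum_y m y * (\sum_x J x y * (sgn (s x) - m x)).
  have -> : \sum_y m y * (\sum_x J x y * (sgn (s x) - m x)) =
     \sum_x \sum_y m y * (J x y * (sgn (s x) - m x)).
    by rewrite exchange_big/=; apply: eq_bigr => y _; rewrite mulr_sumr.
  rewrite -sumrB -big_split/=; apply: eq_bigr => x _.
  rewrite mulr_sumr -sumrB -big_split/=; apply: eq_bigr => y _.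
  by ring.
have -> : 4 * e * N ^+ 2 = \sum_(x : X) (2 * e * N) + \sum_(x : X) (2 * e * N).
  by rewrite sumr_const -[_ *+ _]mulr_natl; ring.
rewrite (le_trans (ler_normD _ _))// lerD//.
all: rewrite (le_trans (ler_norm_sum _ _ _))//; apply: ler_sum => x _; rewrite normrM.
  by rewrite normr_sgn mul1r; apply: sum_block_mean_le => y y' yy'; exact: Je.
rewrite (@le_trans _ _ (1 * `|\sum_y J y x * (sgn (s y) - m y)|))//.
  by rewrite ler_wpM2r// ler_norml block_mean_bound.
by rewrite mul1r; apply: sum_block_mean_le => y y' yy'; exact: Je.
Qed.

(** For each block profile, entropy bounds the number of configurations and J is nearly constant on
    pairs of blocks, so the class weighs at most exp of minus N times its free energy, up to the
    constants of [sum_weightX_ge]. The loss 2 b e per site is the error 4 e N^2 multiplied by b / (2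
    N). *)
Lemma sum_weightX_le M (e eta : R) :
  (forall x, -1 < M x < 1) ->
  (forall x y x' y', c x = c x' -> c y = c y' -> `|J x y - J x' y'| <= e) ->
  \sum_(s | free_energyX M + eta < free_energyX (block_mean s)) weightX s
    <= (#|X|.+1 ^ #|I|)%:R * expR (- (N * (eta - 2 * b * e))) * \sum_(s : {ffun X -> spin}) weightX s.
Proof.
move=> M1 Je.
set bad := fun s => free_energyX M + eta < free_energyX (block_mean s).
pose B : R := expR (C0 + N * (ln 2 - free_energyX M) - N * (eta - 2 * b * e)).
suff H : \sum_(s | bad s) weightX s <= (#|X|.+1 ^ #|I|)%:R * B.
  apply: (le_trans H); rewrite -mulrA; apply: ler_wpM2l => //.
  rewrite /B expRD mulrC; apply: ler_wpM2l; first exact: expR_ge0.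
  exact: sum_weightX_ge.
(* The number of positive spins in each block determines the block means, and it takes at most #|X|
   + 1 values; [inord] therefore never truncates. *)
pose k s : {ffun I -> 'I_#|X|.+1} := [ffun i => inord #|[pred y | (c y == i) && (s y == ord0)]|].
have kE s s' : k s = k s' -> forall x, block_mean s x = block_mean s' x.
  move=> kk x; rewrite /block_mean; congr (_ / _).
  have E (t : {ffun X -> spin}) : \sum_(y | c y == c x) sgn (t y) =
      (k t (c x) : nat)%:R *+ 2 - #|[pred y | c y == c x]|%:R :> R.
    rewrite ffunE inordK ?ltnS ?max_card//.
    rewrite (eq_bigr (fun y => (t y == ord0)%:R *+ 2 - 1)) => [|y _].
      rewrite sumrB sumr_const; congr (_ - _).
      rewrite sumrMnl; congr (_ *+ 2).
      rewrite -natr_sum -big_mkcondr/= sum1_card.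
      by congr (_%:R); apply: eq_card => y; rewrite !inE.
    by have [->|->] := spinP (t y); rewrite ?sgn0 ?sgn_max/= ?mulr2n; lra.
  by rewrite !E kk.
rewrite (partition_big k xpredT)//=.
have -> : (#|X|.+1 ^ #|I|)%:R * B = \sum_(i : {ffun I -> 'I_#|X|.+1}) B.
  by rewrite sumr_const card_ffun card_ord mulr_natl.
apply: ler_sum => i _.
have [/existsP[s0 /andP[bs0 /eqP ks0]]|/existsPn n] := boolP [exists s, bad s && (k s == i)]; last first.
  by rewrite big_pred0 ?expR_ge0// => s; apply/negbTE.
set m := block_mean s0.
pose D := C0 + b / 2 * (N^-1 * \sum_x \sum_y J x y * (m x * m y)) + 2 * b * e * N.
(* Enlarging the class to all configurations with the block means of s0 brings [card_block_mean]
   into play; the common weight bound is [expR D]. *)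
apply: (@le_trans _ _ (\sum_(s | [forall x, block_mean s x == m x]) expR D)).
  rewrite big_mkcond [leRHS]big_mkcond; apply: ler_sum => s _.
  case: ifPn => [/andP[bs /eqP ks]|_]; last by case: ifP; rewrite ?expR_ge0.
  have ms : forall x, block_mean s x = m x by apply: kE; rewrite ks ks0.
  rewrite ifT; last by apply/forallP => x; rewrite ms.
  rewrite weightXE ler_expR /D -addrA lerD2l.
  have := block_mean_quadratic s Je.
  under [X in _ - X]eq_bigr do under eq_bigr do rewrite !ms.
  set u := \sum_x _; set v := \sum_x _ => /(le_trans (ler_norm _)).
  rewrite lerBlDl => uv.
  have bN : 0 <= b / 2 * N^-1 by rewrite mulr_ge0 ?divr_ge0 ?invr_ge0.
  rewrite !mulrA; apply: (le_trans (ler_wpM2l bN uv)).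
  by rewrite le_eqVlt; apply/orP; left; apply/eqP; field.
rewrite (eq_bigr (fun s => expR D * 1)) => [|s _]; last by rewrite mulr1.
rewrite -mulr_sumr; apply: (le_trans (ler_wpM2l (expR_ge0 _) (card_block_mean s0))).
rewrite -expRD ler_expR /D -/m.
move: bs0; rewrite /bad -/m => /ltW fm.
rewrite sumrB sumr_const -[ln 2 *+ _]mulr_natl.
have -> : C0 + b / 2 * (N^-1 * \sum_x \sum_y J x y * (m x * m y)) + 2 * b * e * N
   + (N * ln 2 - \sum_x neg_entropy (m x)) = C0 + N * (ln 2 - free_energyX m) + 2 * b * e * N.
  rewrite /free_energyX; set u := \sum_x _; set v := \sum_x _; set l := ln 2.
  by field.
have : 0 <= N * (free_energyX m - (free_energyX M + eta)).
  by rewrite mulr_ge0 ?subr_ge0.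
set u := free_energyX M; set v := free_energyX m; set l := ln 2 => h.
by rewrite -subr_ge0 (le_trans h)// le_eqVlt; apply/orP; left; apply/eqP; ring.
Qed.

End mean_field.

(** * The topology of the torus *)

Section borel.
Context {R : realType} {X : ptopologicalType}.

Lemma continuous_borel_measurable (Y : ptopologicalType) (f : X -> Y) : continuous f ->
  measurable_fun setT (f : borel X -> borel Y).
Proof.
move=> /continuousP cf; apply: (@measurability _ _ _ (borel Y) setT _ (@open Y)) => //.
move=> _ [U oU <-]; rewrite setTI; apply: sub_sigma_algebra; exact: cf.
Qed.

Lemma continuous_borel_realfun (f : X -> R) : continuous f ->
  measurable_fun setT (f : borel X -> R).
Proof.
move=> /continuousP cf; apply: (measurability _ (measurable_realfun.RGenOInfty.measurableE R)).
move=> _ [_ [a ->] <-]; rewrite setTI; apply: sub_sigma_algebra.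
by apply: cf; exact: interval_open.
Qed.

End borel.

Section torus.
Context {R : realType} {d : nat}.
Local Notation T := (torus R d).
Local Notation piT := (\pi_(torus R d) : 'rV[R]_d -> T).

Lemma piTD x y : piT (x + y) = piT x + piT y.
Proof. exact: Quotient.pi_add. Qed.

Lemma piTN x : piT (- x) = - piT x.
Proof. exact: Quotient.pi_opp. Qed.

Lemma piTB x y : piT (x - y) = piT x - piT y.
Proof. by rewrite piTD piTN. Qed.

Lemma piT_int (z : 'rV[R]_d) : (forall i, z 0 i \is a Num.int) -> piT z = 0.
Proof.
move=> zi; rewrite -[RHS](subrr (piT 0)) -piTB subrr.
have := @Quotient.idealrBE _ (@Zlattice R d) z 0.
rewrite subr0 => h; have /eqP : z == 0 %[mod {ideal_quot (@Zlattice R d)}].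
  by rewrite -h; exact/forallP.
exact.
Qed.

Lemma continuous_torusP (f : T -> R) : continuous f <-> continuous (f \o piT).
Proof. exact: quotient_continuous. Qed.

Definition rfrac (x : 'rV[R]_d) : 'rV[R]_d :=
  \row_i (x 0 i - (Num.floor (x 0 i))%:~R).

Lemma rfrac_bound x i : 0 <= rfrac x 0 i < 1.
Proof.
rewrite mxE subr_ge0 floor_le_tmp/= ltrBlDl.
by have := lt_succ_floor (x 0 i); rewrite intrD1.
Qed.

Lemma pi_rfrac x y : piT (rfrac x + y) = piT (x + y).
Proof.
have -> : x + y = rfrac x + y + \row_i (Num.floor (x 0 i))%:~R.
  by apply/rowP => i; rewrite !mxE; ring.
rewrite [RHS]piTD [X in _ = _ + X]piT_int ?addr0// => i.
by rewrite mxE intr_int.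
Qed.

(** Taken closed to be compact, although [rfrac] only reaches the half-open cube. *)
Definition unit_cube : set 'rV[R]_d := [set v | forall i, `[0, 1]%classic (v 0 i)].

Lemma rfrac_cube x : unit_cube (rfrac x).
Proof. by move=> i /=; rewrite in_itv/=; have /andP[-> /ltW ->] := rfrac_bound x i. Qed.

Lemma compact_unit_cube : compact unit_cube.
Proof. by apply: (@rV_compact R d (fun=> `[0, 1]%classic)) => i; exact: segment_compact. Qed.

(** The modulus is stated for lifts to R^d, where distances are coordinatewise. Compactness of the
    cube gives one r for all x in it, and other x are moved into the cube by an integer vector. *)
Lemma torus_uniform_continuity (G : T -> R) (e : R) : continuous G -> 0 < e ->
  exists2 r : R, 0 < r & forall x y : 'rV[R]_d,
    (forall i, `|x 0 i - y 0 i| < r) -> `|G (piT x) - G (piT y)| < e.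
Proof.
move=> /continuous_torusP cG e0.
pose P (r : R) (x : 'rV[R]_d) := forall y : 'rV[R]_d, (forall i, `|x 0 i - y 0 i| < r) -> `|G (piT x) - G (piT y)| < e.
have e20 : 0 < e / 2 by rewrite divr_gt0.
have H : \forall r \near 0^'+, unit_cube `<=` P r.
  have := compact_unit_cube; rewrite compact_near_coveringP; apply => x _.
  have /(@cvgrPdist_lt _ _ _ (nbhs x))/(_ _ e20) := cG x; rewrite /= => /nbhs_ballP[r /= r0 hr].
  have r20 : 0 < r / 2 by rewrite divr_gt0.
  exists (ball x (r / 2), [set s | s < r / 2]).
    by split => /=; [exact: nbhsx_ballx|exact: nbhs_right_lt].
  move=> [x' s] /= [[_ xx'] sr] y x'y.
  have xx'i i : `|x 0 i - x' 0 i| < r / 2 by exact: xx'.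
  have h1 : `|G (piT x) - G (piT x')| < e / 2.
    by apply: hr; split => // i j; rewrite [i]ord1; apply: lt_le_trans; [exact: xx'i|lra].
  have h2 : `|G (piT x) - G (piT y)| < e / 2.
    apply: hr; split => // i j; rewrite ord1 /ball/= -(subrKA (x' 0 j)).
    by rewrite (le_lt_trans (ler_normD _ _))//; have := xx'i j; have := x'y j; lra.
  rewrite -(subrKA (G (piT x))) (le_lt_trans (ler_normD _ _))//.
  by rewrite distrC; lra.
have [r [r0 hr]] : exists r, 0 < r /\ unit_cube `<=` P r.
  near (0 : R)^'+ => r; exists r; split; near: r; last exact: H.
  exact: nbhs_right_gt.
exists r => // x y xy.
(* Both points are shifted by the same integer vector [rfrac x - x], which preserves their
   difference and their images in the torus. *)
have := hr _ (rfrac_cube x) (y + (rfrac x - x)).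
rewrite -[piT (rfrac x)]/(piT (rfrac x)) -[in piT (rfrac x)](addr0 (rfrac x)) pi_rfrac addr0.
have -> : piT (y + (rfrac x - x)) = piT y.
  by rewrite addrCA pi_rfrac addrCA subrr addr0.
by apply => i; have := xy i; rewrite !mxE; congr (`|_| < _); ring.
Unshelve. all: by end_near. Qed.

Lemma continuous_torus_modulus (F : T -> R) :
  (forall e : R, 0 < e -> exists2 r : R, 0 < r & forall x y : 'rV[R]_d,
    (forall i, `|x 0 i - y 0 i| < r) -> `|F (piT x) - F (piT y)| <= e) ->
  continuous F.
Proof.
move=> H; apply: (proj2 (continuous_torusP F)) => x; apply/(@cvgrPdist_le _ _ _ (nbhs x)) => e e0.
have [r r0 hr] := H _ e0.
apply/nbhs_ballP; exists r => //= y [_ xy]; apply: hr => i; exact: xy.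
Qed.

Lemma continuous_translate (G : T -> R) (v : T) : continuous G -> continuous (fun u : T => G (u + v)).
Proof.
move=> cG; apply: continuous_torus_modulus => e e0.
have [r r0 hr] := torus_uniform_continuity cG e0; exists r => // x y xy.
rewrite -(reprK v) -!piTD ltW//; apply: hr => i; rewrite !mxE.
by have := xy i; congr (`|_| < _); ring.
Qed.

Lemma continuous_opp (G : T -> R) : continuous G -> continuous (fun u : T => G (- u)).
Proof.
move=> cG; apply: continuous_torus_modulus => e e0.
have [r r0 hr] := torus_uniform_continuity cG e0; exists r => // x y xy.
rewrite -!piTN ltW//; apply: hr => i; rewrite !mxE.
by rewrite opprK addrC distrC; exact: xy.
Qed.

Lemma torus_max (G : T -> R) : continuous G -> exists u0, forall u, G u <= G u0.
Proof.
move=> /continuous_torusP cG.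
have cube0 : unit_cube !=set0 by exists (rfrac 0); exact: rfrac_cube.
have [|x _ hx] := @EVT_max_rV R d (G \o piT) _ cube0 compact_unit_cube.
  exact: continuous_subspaceT.
exists (piT x) => u.
have := hx (rfrac (repr u)); rewrite inE => /(_ (rfrac_cube _)) /=.
by rewrite -[X in piT X](addr0 (rfrac _)) pi_rfrac addr0 reprK.
Qed.

Lemma torus_min (G : T -> R) : continuous G -> exists u0, forall u, G u0 <= G u.
Proof.
move=> cG; have [|u hu] := @torus_max (fun v => - G v).
  by move=> x; exact: (cvgN (cG x)).
by exists u => v; have := hu v; rewrite lerN2.
Qed.

Lemma torus_bounded (G : T -> R) : continuous G ->
  exists2 C : R, 0 <= C & forall u, `|G u| <= C.
Proof.
move=> cG; have [|u hu] := @torus_max (fun v => `|G v|).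
  by move=> x; exact: (cvg_norm (cG x)).
by exists `|G u|.
Qed.

(** The grid box of side 1/(k + 1) that contains the representative of u in [0, 1[^d. The integer
    part is at most k, so [inord] never truncates. *)
Definition color (k : nat) (u : T) : {ffun 'I_d -> 'I_k.+1} :=
  [ffun i => inord (Num.truncn (k.+1%:R * rfrac (repr u) 0 i))].

Lemma color_dist k (u u' : T) : color k u = color k u' -> forall i,
  `|rfrac (repr u) 0 i - rfrac (repr u') 0 i| < k.+1%:R^-1.
Proof.
move=> /ffunP cu i; have := cu i; rewrite !ffunE => /(congr1 val) /=.
have b (v : T) : 0 <= k.+1%:R * rfrac (repr v) 0 i < k.+1%:R.
  have /andP[r0 r1] := rfrac_bound (repr v) i.
  by rewrite mulr_ge0//= -[ltRHS]mulr1 ltr_pM2l.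
have t (v : T) : (Num.truncn (k.+1%:R * rfrac (repr v) 0 i)%R < k.+1)%N.
  by have /andP[b0 b1] := b v; rewrite -(ltr_nat R) (le_lt_trans _ b1)// truncn_le.
rewrite !inordK// => e.
have /andP[u0 u1] := b u; have /andP[v0 v1] := b u'.
have := truncn_itv u0; have := truncn_itv v0; rewrite e => /andP[a1 a2] /andP[b1 b2].
rewrite -(@ltr_pM2l _ k.+1%:R)// divff// -[X in X * _]ger0_norm// -normrM mulrBr.
by rewrite ltr_norml; move: a1 a2 b1 b2; rewrite -natr1; lra.
Qed.

(** Uniform in the translation v: with v ranging over the torus it controls J(u - v) in one
    argument, with v = 0 it controls a test function. *)
Lemma color_continuous (G : T -> R) (e : R) : continuous G -> 0 < e ->
  \forall k \near \oo, forall u u' : T, color k u = color k u' ->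
    forall v : T, `|G (u + v) - G (u' + v)| <= e.
Proof.
move=> cG e0; have [r r0 hr] := torus_uniform_continuity cG e0.
near=> k => u u' /color_dist uu' v.
have E (w : T) : w + v = piT (rfrac (repr w) + repr v) by rewrite pi_rfrac piTD !reprK.
rewrite !E ltW//; apply: hr => i; rewrite !mxE.
have := uu' i; rewrite !mxE; set a := _ - _; set b := _ - _ => h.
have -> : b = a by rewrite /a /b; ring.
apply: (lt_trans h); near: k; exact: (near_infty_natSinv_lt (PosNum r0)).
Unshelve. all: by end_near. Qed.

End torus.

(** * Free energy of a magnetization *)

(* [E] is an expectation defined on an algebra [bm] of functions: below, either
   the integral against a density or the average over a finite set. *)
Record mean_functional (R : realType) (X : Type) (bm : (X -> R) -> Prop)
    (E : (X -> R) -> R) := MeanFunctional {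
  bmD : forall f g, bm f -> bm g -> bm (fun u => f u + g u) ;
  bmM : forall f g, bm f -> bm g -> bm (fun u => f u * g u) ;
  bmC : forall c : R, bm (fun=> c) ;
  meanD : forall f g, bm f -> bm g -> E (fun u => f u + g u) = E f + E g ;
  meanZ : forall (c : R) f, bm f -> E (fun u => c * f u) = c * E f ;
  mean_le : forall f g, bm f -> bm g -> (forall u, f u <= g u) -> E f <= E g ;
  mean1 : E (fun=> 1) = 1 }.

Section mean_functional.
Context {R : realType} {X : Type} {bm : (X -> R) -> Prop} {E : (X -> R) -> R}.
Variable mf : mean_functional bm E.

Lemma bmZ (c : R) f : bm f -> bm (fun u => c * f u).
Proof. by move=> bf; apply: (bmM mf) => //; exact: (bmC mf). Qed.

Lemma bmB f g : bm f -> bm g -> bm (fun u => f u - g u).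
Proof.
move=> bf bg; rewrite (_ : (fun u => _) = (fun u => f u + (-1) * g u)).
  by apply: (bmD mf) => //; exact: bmZ.
by apply/funext => u; rewrite mulN1r.
Qed.

Lemma bmX f n : bm f -> bm (fun u => f u ^+ n).
Proof.
move=> bf; elim: n => [|n IH]; first exact: (bmC mf).
rewrite (_ : (fun u => _) = (fun u => f u * f u ^+ n)); first exact: (bmM mf).
by apply/funext => u; rewrite exprS.
Qed.

Lemma meanB f g : bm f -> bm g -> E (fun u => f u - g u) = E f - E g.
Proof.
move=> bf bg; rewrite (_ : (fun u => _) = (fun u => f u + (-1) * g u)).
  by rewrite (meanD mf)// ?(meanZ mf)// ?mulN1r//; exact: bmZ.
by apply/funext => u; rewrite mulN1r.
Qed.

Lemma meanC (c : R) : E (fun=> c) = c.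
Proof.
rewrite -[RHS]mulr1 -(mean1 mf) -(meanZ mf); last exact: (bmC mf).
by congr E; apply/funext => u; rewrite mulr1.
Qed.

Lemma mean_ge0 f : bm f -> (forall u, 0 <= f u) -> 0 <= E f.
Proof. by move=> bf f0; rewrite -(meanC 0) (mean_le mf)//; exact: (bmC mf). Qed.

Lemma mean_norm_le f : bm f -> bm (fun u => `|f u|) -> `|E f| <= E (fun u => `|f u|).
Proof.
move=> bf bg; rewrite ler_norml; apply/andP; split.
  rewrite -mulN1r -(meanZ mf)//; apply: (mean_le mf) => //; first exact: bmZ.
  by move=> u; rewrite mulN1r lerNl -normrN ler_norm.
by apply: (mean_le mf) => // u; exact: ler_norm.
Qed.

Variable J : X -> X -> R.

Definition kernel_op (f : X -> R) (u : X) : R := E (fun v => J u v * f v).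

Local Notation K := kernel_op.

Hypotheses (bmJ : forall u, bm (J u)) (bmK : forall f, bm f -> bm (K f)).
Hypothesis K_sym : forall f g, bm f -> bm g ->
  E (fun u => f u * K g u) = E (fun u => g u * K f u).

Local Ltac bmtac := repeat (first [ assumption | exact: (bmC mf) | exact: bmJ | apply: bmB
  | apply: (bmD mf) | apply: bmZ | apply: bmX | apply: (bmM mf) | apply: bmK ]).

Definition free_energyE (b : R) (m : X -> R) : R :=
  E (fun u => neg_entropy (m u)) - b / 2 * E (fun u => m u * K m u).

Variables (e ei : X -> R) (j0 e0 : R).
Hypotheses (be : bm e) (bei : bm ei) (e_gt0 : forall u, 0 < e u)
  (eiE : forall u, ei u = (e u)^-1).
Hypotheses (j00 : 0 <= j0) (e00 : 0 <= e0) (Jj0 : forall u v, j0 <= J u v)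
  (ee0 : forall u, e0 <= e u).

Let eei u : e u * ei u = 1. Proof. by rewrite eiE divff// gt_eqF. Qed.

(* Half of the integral of J(u, v) e(u) e(v) (m(u)/e(u) - m(v)/e(v))^2, i.e. the
   defect in the inequality
   m(u) m(v) <= (m(u)^2 e(v) / e(u) + m(v)^2 e(u) / e(v)) / 2. *)
Lemma quadratic_defect m : bm m ->
  j0 * e0 ^+ 2 * (E (fun u => (m u * ei u) ^+ 2) - E (fun u => m u * ei u) ^+ 2)
  <= E (fun u => m u ^+ 2 * ei u * K e u) - E (fun u => m u * K m u).
Proof.
move=> bm_; pose r u := m u * ei u.
have br : bm r by exact: (bmM mf).
pose w u := m u ^+ 2 * ei u.
have bw : bm w by apply: (bmM mf) => //; exact: bmX.
pose j := j0 * e0 ^+ 2.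
have j_ge0 : 0 <= j by rewrite mulr_ge0// sqr_ge0.
have pt u v : j * (r u ^+ 2 - 2 * r u * r v + r v ^+ 2) <=
  w u * (J u v * e v) - 2 * m u * (J u v * m v) + e u * (J u v * w v).
  have -> : w u * (J u v * e v) - 2 * m u * (J u v * m v) + e u * (J u v * w v) =
     J u v * (e u * e v) * (r u - r v) ^+ 2.
    have mE x : m x = e x * r x by rewrite /r mulrCA eei mulr1.
    have wE x : w x = e x * r x ^+ 2.
      by rewrite /w /r exprMn mulrCA expr2 (mulrA (e x)) eei mul1r.
    by rewrite !wE !mE; ring.
  rewrite (_ : _ + _ = (r u - r v) ^+ 2); last by ring.
  apply: ler_wpM2r; first exact: sqr_ge0.
  apply: ler_pM => //; first by rewrite sqr_ge0.
  by rewrite expr2; apply: ler_pM.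
have bJ u f : bm f -> bm (fun v => J u v * f v) by move=> bf; exact: (bmM mf).
have inner u : j * (r u ^+ 2 - 2 * r u * E r + E (fun v => r v ^+ 2)) <=
   w u * K e u - 2 * m u * K m u + e u * K w u.
  have <- : E (fun v => j * (r u ^+ 2 - 2 * r u * r v + r v ^+ 2)) =
      j * (r u ^+ 2 - 2 * r u * E r + E (fun v => r v ^+ 2)).
    rewrite (meanZ mf) 1?(meanD mf) 1?meanB ?meanC ?(meanZ mf)//.
    all: try solve [bmtac].
  have <- : E (fun v => w u * (J u v * e v) - 2 * m u * (J u v * m v) + e u * (J u v * w v)) =
      w u * K e u - 2 * m u * K m u + e u * K w u.
    rewrite /K (meanD mf) 1?meanB ?(meanZ mf)//.
    all: try solve [bmtac].
  apply: (mean_le mf) => //.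
    all: try solve [bmtac].
    all: try solve [bmtac].
have : E (fun u => j * (r u ^+ 2 - 2 * E r * r u + E (fun v => r v ^+ 2))) <=
   E (fun u => w u * K e u - 2 * (m u * K m u) + e u * K w u).
  apply: (mean_le mf).
  - bmtac.
  - bmtac.
  - move=> u; have := inner u; rewrite -!(mulrA 2) (mulrC (E r)) (mulrA 2 (m u)).
    by rewrite -(mulrA 2).
rewrite (meanZ mf) 1?(meanD mf) 1?meanB ?meanC ?(meanZ mf)
  1?(meanD mf) 1?meanB ?(meanZ mf)//.
all: try solve [bmtac].
all: try solve [bmtac].
(* Symmetry of K identifies E(e K w) with E(w K e), so both outer terms of the expanded square are
   the same. *)
rewrite (K_sym be bw) -/j /w -/r.
set A := E _; set B := E _; set C := E _; set D := E _.
have -> : j * (A - 2 * B * B + A) = 2 * (j * (A - B ^+ 2)) by ring.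
lra.
Qed.

(** The comparison profile is M = c e, with c = 1 and e = M in the magnetized case, and c = 0 with e
    an auxiliary positive function when M = 0. The function g is twice the slope of the entropy in
    m^2 at M; the last hypothesis says that it balances b K e / e up to delta, so that the terms
    linear in m^2 - M^2 nearly cancel. *)
Lemma free_energyE_ge (b delta c : R) (m M g : X -> R) :
  0 <= b -> bm m -> bm M -> bm g ->
  bm (fun u => neg_entropy (m u)) -> bm (fun u => neg_entropy (M u)) ->
  (forall u, M u = c * e u) ->
  (forall u, neg_entropy (M u) + (m u ^+ 2 - M u ^+ 2) / 2 * g u
     + (m u ^+ 2 - M u ^+ 2) ^+ 2 / 12 <= neg_entropy (m u)) ->
  (forall u, - delta <= (m u ^+ 2 - M u ^+ 2) * (g u - b * K e u * ei u)) ->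
  free_energyE b M + E (fun u => (m u ^+ 2 - M u ^+ 2) ^+ 2) / 12
    + b / 2 * (j0 * e0 ^+ 2 * (E (fun u => (m u * ei u) ^+ 2) - E (fun u => m u * ei u) ^+ 2))
    - delta / 2 <= free_energyE b m.
Proof.
move=> b0 bm_ bM bg bhm bhM Mc ht hd.
have bKe := bmK be.
have qd := quadratic_defect bm_.
pose z u := m u ^+ 2 - M u ^+ 2.
have bz : bm z by apply: bmB; exact: bmX.
have H : E (fun u => neg_entropy (M u)) + E (fun u => z u * (2^-1 * g u)) +
   12^-1 * E (fun u => z u ^+ 2) <= E (fun u => neg_entropy (m u)).
  rewrite -(meanZ mf) -?(meanD mf).
  - apply: (mean_le mf) => //.
      by bmtac.
    move=> u; have := ht u; rewrite -/(z u).
    rewrite (mulrC 12^-1) (mulrA (z u)); apply: le_trans.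
    by rewrite lexx.
  all: try solve [bmtac].
have H2 : - (delta / 2) <= E (fun u => z u * (2^-1 * g u)) - b / 2 * E (fun u => z u * (K e u * ei u)).
  rewrite -(meanZ mf) -?meanB -1?(meanC (- _)).
  - apply: (mean_le mf); first exact: (bmC mf).
      by bmtac.
    move=> u; have := hd u; rewrite -/(z u); set y := K e u * ei u.
    by rewrite -(mulrA b); rewrite -/y; lra.
  all: try solve [bmtac].
have H3 : E (fun u => z u * (K e u * ei u)) =
    E (fun u => m u ^+ 2 * ei u * K e u) - E (fun u => M u * K M u).
  rewrite -meanB.
  - congr E; apply/funext => u; rewrite /z.
    (* Because M = c e, the term M^2 K e / e is M K M. *)
    have -> : K M u = c * K e u.
      rewrite /kernel_op -(meanZ mf); last exact: (bmM mf).
      by congr E; apply/funext => v; rewrite Mc; ring.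
    rewrite mulrBl; congr (_ - _); first by ring.
    by rewrite Mc; have := eei u; set x := K e u => eq1; rewrite -[RHS]mulr1 -eq1; ring.
  all: try solve [bmtac].
move: H H2; rewrite H3 /free_energyE -/z.
have {}qd := ler_wpM2l (divr_ge0 b0 (ler0n R 2)) qd.
move: qd; rewrite [X in _ <= X -> _]mulrBr mulrBr.
set a1 := E _; set a2 := E _; set a3 := E _; set a4 := E _; set a5 := E _; set a6 := E _.
set a7 := E _; set a8 := E _.
lra.
Qed.

End mean_functional.

Arguments kernel_op {R X} E J f u.
Arguments free_energyE {R X} E J b m.

(** * The mean field equation *)

Section dichotomy.
Context {R : realType} {X : Type} {bm : (X -> R) -> Prop} {E : (X -> R) -> R}.
Variable mf : mean_functional bm E.
Variables (J : X -> X -> R) (j0 j1 : R).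
Local Notation K := (kernel_op E J).
Hypotheses (bmJ : forall u, bm (J u)) (bmK : forall f, bm f -> bm (K f)).
Hypotheses (j0_gt0 : 0 < j0) (J_ge : forall u v, j0 <= J u v) (J_le : forall u v, J u v <= j1).
Hypothesis bm_tanh : forall f, bm f -> bm (fun u => tanh (f u)).
Hypothesis bm_cvg : forall (f_ : nat -> X -> R) (f : X -> R) (C : R),
  (forall n, bm (f_ n)) -> (forall n u, `|f_ n u| <= C) ->
  (forall u, f_ n u @[n --> \oo] --> f u) -> bm f.
Hypothesis mean_cvg : forall (f_ : nat -> X -> R) (f : X -> R) (C : R),
  (forall n, bm (f_ n)) -> bm f -> (forall n u, `|f_ n u| <= C) ->
  (forall u, f_ n u @[n --> \oo] --> f u) -> E (f_ n) @[n --> \oo] --> E f.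

Let J_ge0 u v : 0 <= J u v.
Proof. exact: le_trans (ltW j0_gt0) (J_ge u v). Qed.

Let bJM u f : bm f -> bm (fun v => J u v * f v).
Proof. by move=> bf; apply: (bmM mf). Qed.

Lemma kernel_op_le (f g : X -> R) u : bm f -> bm g -> (forall v, f v <= g v) ->
  K f u <= K g u.
Proof.
by move=> bf bg fg; apply: (mean_le mf (bJM u bf) (bJM u bg)) => v; rewrite ler_wpM2l.
Qed.

Lemma kernel_op_ge (f : X -> R) u : bm f -> (forall v, 0 <= f v) -> j0 * E f <= K f u.
Proof.
move=> bf f0; rewrite -(meanZ mf)//; apply: (mean_le mf (bmZ mf j0 bf) (bJM u bf)) => v.
by rewrite ler_wpM2r.
Qed.

Lemma kernel_op_le_mean (f : X -> R) u : bm f -> (forall v, 0 <= f v) -> K f u <= j1 * E f.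
Proof.
move=> bf f0; rewrite -(meanZ mf)//; apply: (mean_le mf (bJM u bf) (bmZ mf j1 bf)) => v.
by rewrite ler_wpM2r.
Qed.

Variable b : R.
Hypothesis b_ge0 : 0 <= b.

Fixpoint mean_field_iter (n : nat) : X -> R :=
  if n is n'.+1 then fun u => tanh (b * K (mean_field_iter n') u) else fun=> 1.

Local Notation Mk := mean_field_iter.

Let Mk_bm n : bm (Mk n).
Proof.
elim: n => [|n IH]; first exact: (bmC mf).
exact/bm_tanh/(bmZ mf)/bmK.
Qed.

Let Mk_bound n u : 0 <= Mk n u <= 1.
Proof.
elim: n u => [|n IH] u /=; first by rewrite ler01 lexx.
rewrite (ltW (tanh_lt1 _)) andbT tanh_ge0// mulr_ge0//.
have Mge v : 0 <= Mk n v by have /andP[] := IH v.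
apply: le_trans (kernel_op_ge u (Mk_bm n) Mge).
by rewrite mulr_ge0 ?(ltW j0_gt0)// (mean_ge0 mf).
Qed.

Let Mk_ge0 n u : 0 <= Mk n u.
Proof. by have /andP[] := Mk_bound n u. Qed.

Let Mk_norm n u : `|Mk n u| <= 1.
Proof. by rewrite ger0_norm//; have /andP[] := Mk_bound n u. Qed.

Let Mk_dec n u : Mk n.+1 u <= Mk n u.
Proof.
elim: n u => [|n IH] u; first exact/ltW/tanh_lt1.
apply: tanh_le; apply: ler_wpM2l => //.
exact: (kernel_op_le u (Mk_bm n.+1) (Mk_bm n) IH).
Qed.

Let M_ u : R := limn (Mk ^~ u).

Let Mk_cvg u : Mk n u @[n --> \oo] --> M_ u.
Proof.
apply: nonincreasing_is_cvgn.
  by apply/nonincreasing_seqP => n; exact: Mk_dec.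
by exists 0 => _ [n _ <-].
Qed.

Let M_ge0 u : 0 <= M_ u.
Proof.
apply: limr_ge; first by apply/cvg_ex; exists (M_ u); exact: Mk_cvg.
by apply: nearW => n.
Qed.

Let M_bm : bm M_.
Proof. exact: (bm_cvg Mk_bm Mk_norm Mk_cvg). Qed.

Let M_eq u : M_ u = tanh (b * K M_ u).
Proof.
have c1 : Mk n.+1 u @[n --> \oo] --> M_ u by rewrite (cvg_shiftS (fun n => Mk n u)).
have c2 : Mk n.+1 u @[n --> \oo] --> tanh (b * K M_ u).
  have c3 : b * K (Mk n) u @[n --> \oo] --> b * K M_ u.
    apply: cvgMr.
    apply: (mean_cvg (C := j1) (fun n => bJM u (Mk_bm n)) (bJM u M_bm)).
      move=> n v; rewrite normrM -[leRHS]mulr1; apply: ler_pM => //.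
      by rewrite ger0_norm.
    by move=> v; apply: cvgMr; exact: Mk_cvg.
  exact: (cvg_comp _ _ c3 (@continuous_tanh R _)).
by rewrite -(cvg_lim _ c1)// (cvg_lim _ c2).
Qed.

(* The decreasing iterates of the mean field equation, started at 1, converge
   either to a positive solution or to 0; in the latter case they are
   supersolutions of the linearized equation up to a small factor. *)
Lemma mean_field_dichotomy :
  (exists2 M : X -> R, bm M & (forall u, M u = tanh (b * K M u)) /\
     exists2 c : R, 0 < c & forall u, c <= M u) \/
  (forall delta : R, 0 < delta -> exists (a : R) (f e : X -> R), [/\ bm f,
     forall u, e u = tanh (a * K f u),
     exists2 c : R, 0 < c & forall u, c <= e u &
     forall u, b * K e u <= (1 + delta) * e u]).
Proof.
have EM0 : 0 <= E M_ := mean_ge0 mf M_bm M_ge0.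
(* For b = 0 the iterates vanish after one step and cannot serve as e. Then b K e = 0, any positive
   e will do, and the one obtained from the constant 1 has the required form. *)
move: b_ge0; rewrite le_eqVlt => /predU1P[b0|b_gt0].
  right => delta delta0; exists 1, (fun=> 1), (fun u => tanh (1 * K (fun=> 1) u)); split => //.
  - exact: (bmC mf).
  - exists (tanh j0); first exact: tanh_gt0.
    move=> u; apply: tanh_le; rewrite mul1r -[leLHS]mulr1 -[X in _ * X](mean1 mf).
    by apply: kernel_op_ge => //; exact: (bmC mf).
  - move=> u; rewrite -b0 mul0r mulr_ge0//; first lra.
    apply: tanh_ge0; rewrite mul1r; apply: le_trans (kernel_op_ge u (bmC mf 1) _) => //.
    by rewrite (mean1 mf) mulr1 ltW.
(* Since J >= j0 > 0, a limit of positive mean is bounded below everywhere: M = tanh(b K M) >=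
   tanh(b j0 E M). *)
move: EM0; rewrite le_eqVlt => /predU1P[EM0|EM_gt0]; last first.
  left; exists M_ => //; split; first exact: M_eq.
  exists (tanh (b * (j0 * E M_))); first by apply: tanh_gt0; rewrite !mulr_gt0.
  by move=> u; rewrite M_eq; apply: tanh_le; rewrite ler_pM2l// kernel_op_ge.
right => delta delta0.
have EMk : E (Mk n) @[n --> \oo] --> 0.
  by rewrite EM0; apply: (mean_cvg Mk_bm M_bm Mk_norm Mk_cvg).
(* With K f <= j1 E f, convergence of the means to 0 makes the iterates uniformly small. *)
have tE : tanh (b * (j1 * E (Mk n))) @[n --> \oo] --> 0.
  have c : b * (j1 * E (Mk n)) @[n --> \oo] --> b * (j1 * 0).
    by apply: cvgMr; apply: cvgMr.
  by have := cvg_comp _ _ c (@continuous_tanh R _); rewrite !mulr0 tanh0.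
pose eta := delta / (1 + delta).
have eta0 : 0 < eta by rewrite divr_gt0//; lra.
(* Below eta = delta / (1 + delta) one has x / (1 - x) <= (1 + delta) x. *)
have [n hn] : exists n, tanh (b * (j1 * E (Mk n))) < eta.
  have /cvgr_lt/(_ _ eta0)[n _ hn] := tE.
  by exists n; apply: hn => /=.
have e_gt0 k : exists2 c : R, 0 < c & forall u, c <= Mk k u.
  elim: k => [|k [c c0 hc]]; first by exists 1.
  exists (tanh (b * (j0 * c))); first by apply: tanh_gt0; rewrite !mulr_gt0.
  move=> u; apply: tanh_le; rewrite ler_pM2l//.
  apply: le_trans (kernel_op_ge u (Mk_bm k) (Mk_ge0 k)).
  rewrite ler_pM2l// -(meanC mf c); apply: (mean_le mf) => //.
  exact: (bmC mf).
exists b, (Mk n), (Mk n.+1); split => // u.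
set x := Mk n.+1 u.
have [c c0 hc] := e_gt0 n.+1.
have x0 : 0 < x by apply: lt_le_trans (hc u).
have x_eta : x < eta.
  by apply: le_lt_trans hn; apply: tanh_le; rewrite ler_pM2l// kernel_op_le_mean.
have eta1 : eta < 1 by rewrite ltr_pdivrMr; lra.
have x1 : 0 <= x < 1 by apply/andP; split; lra.
(* The next iterate tanh(b K e) is at most e, since the iterates decrease; hence b K e <= artanh
   e. *)
apply: (@le_trans _ _ (artanh x)).
  apply: le_artanh_of_tanh_le; first lra.
  exact: (Mk_dec n.+1 u).
apply: (le_trans (artanh_le x1)).
rewrite mulrC ler_wpM2r ?(ltW x0)//.
have : x * (1 + delta) <= delta.
  by rewrite -ler_pdivlMr ?(ltW x_eta)//; lra.
by rewrite -div1r ler_pdivrMr; [nra|lra].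
Qed.

End dichotomy.

(** * Densities *)

Section bounded_measurable.
Context {dY : measure_display} {Y : measurableType dY} {R : realType}.

Definition bounded_measurable (f : Y -> R) : Prop :=
  measurable_fun setT f /\ exists C : R, forall u, `|f u| <= C.

Lemma bounded_measurableD (f g : Y -> R) : bounded_measurable f -> bounded_measurable g ->
  bounded_measurable (fun u => f u + g u).
Proof.
move=> [mf [C hC]] [mg [D hD]]; split; first exact: measurable_funD.
by exists (C + D) => u; rewrite (le_trans (ler_normD _ _))// lerD.
Qed.

Lemma bounded_measurableM (f g : Y -> R) : bounded_measurable f -> bounded_measurable g ->
  bounded_measurable (fun u => f u * g u).
Proof.
move=> [mf [C hC]] [mg [D hD]]; split; first exact: measurable_funM.
by exists (C * D) => u; rewrite normrM ler_pM.
Qed.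

Lemma bounded_measurable_cst (c : R) : bounded_measurable (fun=> c).
Proof. by split; [exact: measurable_cst|exists `|c|]. Qed.

Lemma bounded_measurable_norm (f : Y -> R) : bounded_measurable f ->
  bounded_measurable (fun u => `|f u|).
Proof.
move=> [mf [D hD]]; split; first exact: measurableT_comp.
by exists D => u; rewrite normr_id.
Qed.

Lemma bounded_measurable_tanh (f : Y -> R) : bounded_measurable f ->
  bounded_measurable (fun u => tanh (f u)).
Proof.
move=> [mf _]; split; last first.
  by exists 1 => u; rewrite ler_norml (ltW (tanh_gtN1 _)) (ltW (tanh_lt1 _)).
by apply: (measurableT_comp _ mf); apply: continuous_measurable_fun; exact: continuous_tanh.
Qed.

Lemma bounded_measurable_neg_entropy (f : Y -> R) : measurable_fun setT f ->
  (forall u, -1 <= f u <= 1) -> bounded_measurable (fun u => neg_entropy (f u)).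
Proof.
move=> mf f1; split; last first.
  exists (ln 2) => u; rewrite ger0_norm ?neg_entropy_ge0//.
  exact: neg_entropy_le_ln2.
have mD : measurable_fun setT (fun u => 1 + f u) by exact: measurable_funD.
have mB : measurable_fun setT (fun u => 1 - f u) by exact: measurable_funB.
apply: measurable_funD; apply: measurable_funM.
- exact: measurable_funM.
- exact: (measurableT_comp (@measurable_ln R) mD).
- exact: measurable_funM.
- exact: (measurableT_comp (@measurable_ln R) mB).
Qed.

Lemma bounded_measurable_cvg (f_ : nat -> Y -> R) (f : Y -> R) (C : R) :
  (forall n, bounded_measurable (f_ n)) -> (forall n u, `|f_ n u| <= C) ->
  (forall u, f_ n u @[n --> \oo] --> f u) -> bounded_measurable f.
Proof.
move=> bf fC ff; split.
  apply: (@measurable_fun_cvg _ _ _ setT f_) => //.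
    by move=> n; case: (bf n).
exists C => u; have c : `|f_ n u| @[n --> \oo] --> `|f u| by apply: cvg_norm; exact: ff.
rewrite -(cvg_lim _ c)//; apply: limr_le; first by apply/cvg_ex; exists `|f u|.
by apply: nearW => n.
Qed.

Variable mu : probability Y R.

Definition density_mean (rho : Y -> R) (f : Y -> R) : R :=
  (\int[mu]_u (f u * rho u))%R.

End bounded_measurable.

Section density_mean.
Context {dY : measure_display} {Y : measurableType dY} {R : realType}.
Variable mu : probability Y R.
Variable rho : Y -> R.
Hypothesis rho_ge0 : forall u, 0 <= rho u.
Hypothesis rho_int : mu.-integrable setT (fun u => (rho u)%:E).
Hypothesis rho1 : (\int[mu]_u rho u)%R = 1.

Let rho_meas : measurable_fun setT rho.
Proof. by have /integrableP[/measurable_EFinP] := rho_int. Qed.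

Local Notation E := (density_mean mu rho).

Lemma integrable_density (f : Y -> R) : bounded_measurable f ->
  mu.-integrable setT (fun u => (f u * rho u)%:E).
Proof.
move=> [mf [C hC]].
have C0 : 0 <= C by apply: le_trans (hC point); exact: normr_ge0.
apply: (@le_integrable _ _ _ mu _ measurableT _ (fun u : Y => C%:E * (rho u)%:E)%E).
- by apply/measurable_EFinP; exact: measurable_funM.
- move=> u _; rewrite -EFinM !abse_EFin lee_fin !normrM.
  by rewrite (ger0_norm C0) ler_wpM2r.
- exact: integrableZl.
Qed.

Lemma density_meanE (f : Y -> R) : bounded_measurable f ->
  (E f)%:E = (\int[mu]_u (f u * rho u)%:E)%E.
Proof.
move=> bf; rewrite /density_mean /Rintegral fineK//.
exact/integrable_fin_num/integrable_density.
Qed.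

Lemma density_mean_functional : mean_functional bounded_measurable E.
Proof.
split.
- exact: bounded_measurableD.
- exact: bounded_measurableM.
- exact: bounded_measurable_cst.
- move=> f g bf bg; rewrite /density_mean -RintegralD//; [|exact: integrable_density..].
  by congr Rintegral; apply/funext => u; rewrite mulrDl.
- move=> c f bf; rewrite /density_mean -RintegralZl//; last exact: integrable_density.
  by congr Rintegral; apply/funext => u; rewrite mulrA.
- move=> f g bf bg fg; apply: le_Rintegral => //; [exact: integrable_density..|].
  by move=> u _; rewrite ler_wpM2r.
- by rewrite /density_mean -[RHS]rho1; congr Rintegral; apply/funext => u; rewrite mul1r.
Qed.

Lemma density_mean_cvg (f_ : nat -> Y -> R) (f : Y -> R) (C : R) :
  (forall n, bounded_measurable (f_ n)) -> bounded_measurable f ->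
  (forall n u, `|f_ n u| <= C) -> (forall u, f_ n u @[n --> \oo] --> f u) ->
  E (f_ n) @[n --> \oo] --> E f.
Proof.
move=> bf_ bf fC ff.
have C0 : 0 <= C by apply: le_trans (fC 0%N point); exact: normr_ge0.
have [|||||_ _] := @dominated_convergence _ _ _ mu _ measurableT
  (fun n u => (f_ n u * rho u)%:E) (fun u => (f u * rho u)%:E) (fun u => C%:E * (rho u)%:E)%E.
- by move=> n; apply/measurable_EFinP; apply: measurable_funM => //; case: (bf_ n).
- by apply/measurable_EFinP; apply: measurable_funM => //; case: bf.
- apply: aeW => u _ /=; apply: cvg_EFin; first by near=> n.
  by apply: cvgMl; exact: ff.
- exact: integrableZl.
- apply: aeW => u n _ /=; rewrite lee_fin normrM (ger0_norm (rho_ge0 u)).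
  by rewrite ler_wpM2r.
move=> h; rewrite /density_mean /Rintegral; apply: fine_cvg.
rewrite fineK; first exact: h.
exact/integrable_fin_num/integrable_density.
Unshelve. all: by end_near. Qed.

Lemma density_mean_eq0 (f : Y -> R) : bounded_measurable f -> (forall u, 0 <= f u) ->
  E f = 0 -> {ae mu, forall u, f u * rho u = 0}.
Proof.
move=> bf f0 Ef.
have : (\int[mu]_u (f u * rho u)%:E = 0)%E by rewrite -density_meanE// Ef.
have mfr : measurable_fun setT (fun u => (f u * rho u)%:E).
  by apply/measurable_EFinP; apply: measurable_funM => //; case: bf.
rewrite (eq_integral (fun u => `|(f u * rho u)%:E|)%E); last first.
  by move=> u _; rewrite gee0_abs// lee_fin mulr_ge0.
move=> /(ae_eq_integral_abs mu measurableT mfr).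
by apply: filterS => u /(_ I) [].
Qed.

End density_mean.

(** * Symmetry of the integral operator *)

Section density_mean_sym.
Context {dY dZ : measure_display} {Y : measurableType dY} {Z : measurableType dZ}
  {R : realType}.
Variables (nu : probability Z R) (p : {mfun Z >-> Y}).
Variable mu : probability Y R.
Hypothesis mu_distribution : mu = distribution nu p.
Variable rho : Y -> R.
Hypothesis rho_ge0 : forall u, 0 <= rho u.
Hypothesis rho_int : mu.-integrable setT (fun u => (rho u)%:E).
Variables (k : Y -> Y -> R) (Ck : R).
Hypothesis k_sym : forall u v, k u v = k v u.
Hypothesis k_bounded : forall u v, `|k u v| <= Ck.
Hypothesis k_meas : forall u, measurable_fun setT (k u).
Hypothesis kp_meas : measurable_fun setT (fun st : Z * Z => k (p st.1) (p st.2)).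

Let rho_meas : measurable_fun setT rho.
Proof. by have /integrableP[/measurable_EFinP] := rho_int. Qed.

Local Notation E := (density_mean mu rho).
Local Notation K := (kernel_op E k).
Hypothesis bmK : forall f, bounded_measurable f -> bounded_measurable (K f).

Let integrable_pull (h : Y -> R) : measurable_fun setT h ->
  mu.-integrable setT (fun u => (h u)%:E) -> nu.-integrable setT (fun s => (h (p s))%:E).
Proof.
move=> mh /integrableP[_ hoo]; apply/integrableP; split.
  by apply/measurable_EFinP; apply: measurableT_comp.
move: hoo; rewrite mu_distribution ge0_integral_distribution//.
by apply: measurableT_comp => //; exact/measurable_EFinP.
Qed.

Let integral_pull (h : Y -> R) : measurable_fun setT h ->
  mu.-integrable setT (fun u => (h u)%:E) ->
  (\int[mu]_u (h u)%:E = \int[nu]_s (h (p s))%:E)%E.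
Proof.
move=> mh ih; rewrite mu_distribution integral_distribution//; first exact/measurable_EFinP.
exact: integrable_pull.
Qed.

(** Fubini is applied on Z x Z after pulling back along p, because joint measurability of the kernel
    is given there. For the torus, Z is the space of tuples, on which subtraction is measurable
    coordinate by coordinate. *)
Lemma kernel_op_sym (f g : Y -> R) : bounded_measurable f -> bounded_measurable g ->
  E (fun u => f u * K g u) = E (fun u => g u * K f u).
Proof.
move=> bf bg.
pose Phi (f g : Y -> R) (st : Z * Z) : R :=
  (f (p st.1) * rho (p st.1)) * k (p st.1) (p st.2) * (g (p st.2) * rho (p st.2)).
have bk u : bounded_measurable (k u) by split => //; exists Ck.
have mfst h : measurable_fun setT h ->
    measurable_fun setT (fun st : Z * Z => h (p st.1) : R).
  move=> mh; apply: (measurableT_comp mh); exact: measurableT_comp.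
have msnd h : measurable_fun setT h ->
    measurable_fun setT (fun st : Z * Z => h (p st.2) : R).
  move=> mh; apply: (measurableT_comp mh); exact: measurableT_comp.
have mPhi f' g' : bounded_measurable f' -> bounded_measurable g' ->
    measurable_fun setT (Phi f' g').
  move=> [mf' _] [mg' _].
  apply: measurable_funM; [apply: measurable_funM|].
  - by apply: measurable_funM; exact: mfst.
  - exact: kp_meas.
  - by apply: measurable_funM; exact: msnd.
have EE f' g' : bounded_measurable f' -> bounded_measurable g' ->
    (E (fun u => f' u * K g' u))%:E =
    (\int[nu]_s \int[nu]_t (Phi f' g' (s, t))%:E)%E.
  move=> bf' bg'.
  have bfK := bounded_measurableM bf' (bmK bg').
  rewrite density_meanE// integral_pull; last 2 first.
  - by apply: measurable_funM => //; case: bfK.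
  - exact: integrable_density.
  apply: eq_integral => s _.
  have bkg : bounded_measurable (fun v => k (p s) v * g' v).
    exact: bounded_measurableM.
  have mkg : measurable_fun setT (fun v => k (p s) v * g' v * rho v).
    by apply: measurable_funM => //; case: bkg.
  have ikg := integrable_density rho_int bkg.
  rewrite mulrAC EFinM {1}/kernel_op density_meanE// integral_pull//.
  have ikp := integrable_pull mkg ikg.
  rewrite -integralZl//.
  apply: eq_integral => t _; rewrite -EFinM /Phi /=.
  by congr EFin; ring.
apply: EFin_inj; rewrite (EE _ _ bf bg) (EE _ _ bg bf).
have [_ [Cf hCf]] := bf; have [_ [Cg hCg]] := bg.
pose C := Cf * Ck * Cg.
have Cf0 : 0 <= Cf by apply: le_trans (hCf point); exact: normr_ge0.
have Cg0 : 0 <= Cg by apply: le_trans (hCg point); exact: normr_ge0.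
have Ck0 : 0 <= Ck by apply: le_trans (k_bounded point point); exact: normr_ge0.
have C0 : 0 <= C by rewrite !mulr_ge0.
have rho_nu : nu.-integrable setT (fun s => (rho (p s))%:E) by exact: integrable_pull.
have mrho2 : measurable_fun setT (fun st : Z * Z => (C * rho (p st.1))%:E * (rho (p st.2))%:E)%E.
  by apply: emeasurable_funM; apply/measurable_EFinP; [apply: measurable_funM => //; exact: mfst|exact: msnd].
(* Boundedness of f, g and k leaves the majorant C rho(p s) rho(p t), whose iterated integral is
   finite. *)
have iPhi : (nu \x nu)%E.-integrable setT (fun st => (Phi f g st)%:E).
  apply: (@le_integrable _ _ _ (nu \x nu)%E _ measurableT _
      (fun st : Z * Z => (C * rho (p st.1))%:E * (rho (p st.2))%:E)%E).
  - by apply/measurable_EFinP; exact: mPhi.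
  - move=> [s t] _; rewrite -EFinM !abse_EFin lee_fin /Phi /C /= !normrM.
    rewrite !(ger0_norm (rho_ge0 _)) (ger0_norm Cf0) (ger0_norm Cg0) (ger0_norm Ck0).
    rewrite [leRHS](_ : _ = (Cf * rho (p s)) * Ck * (Cg * rho (p t))); last by ring.
    by rewrite !ler_pM// ?mulr_ge0// ler_wpM2r.
  apply/integrable12ltyP => //.
  rewrite (eq_integral (fun s => (C * rho (p s))%:E * \int[nu]_t (rho (p t))%:E)%E); last first.
    move=> s _; rewrite -integralZl//; apply: eq_integral => t _ /=.
    by rewrite ger0_norm ?mulr_ge0// EFinM.
  have [r rE] : exists r : R, (\int[nu]_t (rho (p t))%:E = r%:E)%E.
    exists (fine (\int[nu]_t (rho (p t))%:E)%E); rewrite fineK//.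
    exact: integrable_fin_num.
  rewrite rE (eq_integral (fun s => (C * r)%:E * (rho (p s))%:E)%E); last first.
    by move=> s _; rewrite -!EFinM; congr EFin; ring.
  by rewrite integralZl// rE -EFinM ltry.
rewrite (Fubini iPhi); apply: eq_integral => t _; apply: eq_integral => s _.
by rewrite /Phi/= k_sym; congr EFin; ring.
Qed.

End density_mean_sym.

(** * Convolution with J on the torus *)

Lemma continuous_tanhZ {R : realType} {X : topologicalType} (a : R) (f : X -> R) :
  continuous f -> continuous (fun u => tanh (a * f u)).
Proof.
move=> cf u; have c : a * f v @[v --> u] --> a * f u by apply: cvgMr; exact: cf.
exact: (cvg_comp _ _ c (@continuous_tanh R _)).
Qed.

Section torus_kernel.
Context {R : realType} {d : nat}.
Local Notation T := (torus R d).
Local Notation lam := (lambda R d).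
Local Notation mR := (measurableTypeR R).
Local Notation cube := (d.-tuple mR).
Local Notation p := (@cube_torus R d).

Definition bmT (f : T -> R) : Prop := @bounded_measurable _ (borel T) R f.

Definition torus_kernel (J : T -> R) (u v : T) : R := J (u - v).

Lemma continuous_bmT (f : T -> R) : continuous f -> bmT f.
Proof.
move=> cf; split; first exact: continuous_borel_realfun.
by have [C _ hC] := torus_bounded cf; exists C.
Qed.

(** A lift of subtraction on the torus. Its values may leave [0, 1]^d, which is harmless since
    [cube_torus] is defined on all real tuples. *)
Definition cube_sub (st : cube * cube) : cube := [tuple tnth st.1 i - tnth st.2 i | i < d].

Lemma measurable_cube_sub : measurable_fun setT cube_sub.
Proof.
apply/measurable_fun_tnthP => i.
rewrite (_ : _ \o _ = (fun st : cube * cube => (tnth st.1 i : mR) - tnth st.2 i)); last first.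
  by apply/funext => st /=; rewrite tnth_mktuple.
apply: (@measurable_funB _ _ R _ (fun st : cube * cube => tnth st.1 i) (fun st : cube * cube => tnth st.2 i)).
  exact: (measurableT_comp (measurable_tnth i) measurable_fst).
exact: (measurableT_comp (measurable_tnth i) measurable_snd).
Qed.

Lemma cube_torusB (s t : cube) : p (cube_sub (s, t)) = (p s : T) - p t.
Proof.
rewrite /cube_torus -piTB; congr (\pi_T _); apply/rowP => i.
by rewrite !mxE tnth_mktuple.
Qed.

Variable J : T -> R.
Hypothesis J_cont : continuous J.
Hypothesis J_sym : forall v, J (- v) = J v.

Lemma torus_kernel_continuous (u : T) : continuous (torus_kernel J u).
Proof.
have := continuous_opp (@continuous_translate _ _ J u J_cont).
by rewrite /torus_kernel; under eq_fun do rewrite addrC.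
Qed.

Lemma torus_kernelC (u v : T) : torus_kernel J u v = torus_kernel J v u.
Proof. by rewrite /torus_kernel -J_sym opprB. Qed.

Lemma kernel_bmT (u : T) : bmT (torus_kernel J u).
Proof. exact/continuous_bmT/torus_kernel_continuous. Qed.

Lemma torus_kernel_meas :
  measurable_fun setT (fun st : cube * cube => torus_kernel J (p st.1) (p st.2)).
Proof.
have mJ := continuous_borel_realfun J_cont.
have mp : measurable_fun setT (fun st => p (cube_sub st)).
  exact: (@measurableT_comp _ _ _ _ cube (borel T) p setT cube_sub (@measurable_cube_torus R d) measurable_cube_sub).
have := @measurableT_comp _ _ _ _ (borel T) R (J : borel T -> R) setT (fun st => p (cube_sub st)) mJ mp.
congr (measurable_fun _ _); apply/funext => -[s t] /=.
by rewrite cube_torusB.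
Qed.

Variable rho : T -> R.
Hypothesis rho_ge0 : forall u, 0 <= rho u.
Hypothesis rho_int : lam.-integrable setT (fun u => (rho u)%:E).
Hypothesis rho1 : (\int[lam]_u rho u)%R = 1.

Definition torus_mean (f : T -> R) : R := @density_mean _ (borel T) R lam rho f.

Local Notation E := torus_mean.
Local Notation K := (kernel_op E (torus_kernel J)).

Lemma torus_mean_functional : mean_functional bmT E.
Proof. exact: (@density_mean_functional _ (borel T) R lam rho rho_ge0 rho_int rho1). Qed.

Local Notation mf := torus_mean_functional.

(** A modulus of continuity of J passes to K f when f is bounded, because E is an expectation.
    Dividing by C + 1 avoids a vanishing bound C. *)
Lemma kernel_op_continuous (f : T -> R) : bmT f -> continuous (K f).
Proof.
move=> bf; have [_ [C hC]] := bf.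
have C0 : 0 <= C by apply: le_trans (hC 0); exact: normr_ge0.
apply: continuous_torus_modulus => e e0.
have eC : 0 < e / (C + 1) by rewrite divr_gt0// ltr_wpDl.
have [r r0 hr] := torus_uniform_continuity J_cont eC; exists r => // x y xy.
have bJ u := bmM mf (kernel_bmT u) bf.
have b1 := bmB mf (bJ (\pi_T x)) (bJ (\pi_T y)).
have b2 := bounded_measurable_norm b1.
rewrite /kernel_op -(meanB mf (bJ _) (bJ _)).
apply: (le_trans (mean_norm_le mf b1 b2)).
rewrite -[leRHS](meanC mf); apply: (mean_le mf b2 (bmC mf e)).
move=> v; rewrite -mulrBl normrM /torus_kernel -(reprK v) -!piTB.
apply: (@le_trans _ _ (e / (C + 1) * C)).
  apply: ler_pM => //; first apply/ltW/hr => i.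
  by rewrite !mxE; have := xy i; congr (`|_| < _); ring.
by rewrite mulrAC ler_pdivrMr ?ltr_wpDl// ler_pM2l//; lra.
Qed.

Lemma kernel_op_bmT (f : T -> R) : bmT f -> bmT (K f).
Proof. by move=> bf; exact/continuous_bmT/kernel_op_continuous. Qed.

Lemma lambdaE : lam = distribution (cube_lebesgue R d) p :> probability (borel T) R.
Proof. by []. Qed.

Lemma torus_kernel_op_sym (f g : T -> R) : bmT f -> bmT g ->
  E (fun u => f u * K g u) = E (fun u => g u * K f u).
Proof.
have [C _ hC] := torus_bounded J_cont.
have kb u v : `|torus_kernel J u v| <= C by exact: hC.
exact: (@kernel_op_sym _ _ (borel T) cube R (cube_lebesgue R d) p lam lambdaE rho rho_ge0 rho_int
  (torus_kernel J) C torus_kernelC kb (fun u => proj1 (kernel_bmT u)) torus_kernel_meas kernel_op_bmT f g).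
Qed.

Hypothesis J_gt0 : forall v, 0 < J v.
Variable b : R.
Hypothesis b_ge0 : 0 <= b.

(** Continuity is gained from the fixed-point form: M = tanh(b K M) and e = tanh(a K f), where K
    maps bounded measurable functions to continuous ones. *)
Lemma torus_dichotomy :
  (exists M : T -> R, [/\ continuous M, forall u, 0 < M u < 1 &
     forall u, b * K M u = artanh (M u)]) \/
  (forall delta : R, 0 < delta -> exists e : T -> R, [/\ continuous e, forall u, 0 < e u &
     forall u, b * K e u <= (1 + delta) * e u]).
Proof.
have [u0 hu0] := torus_min J_cont.
have [u1 hu1] := torus_max J_cont.
have ct (a : R) (f : T -> R) : bmT f -> continuous (fun u => tanh (a * K f u)).
  by move=> bf; exact/continuous_tanhZ/kernel_op_continuous.
have Jge u v : J u0 <= torus_kernel J u v by exact: hu0.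
have Jle u v : torus_kernel J u v <= J u1 by exact: hu1.
have mc (f_ : nat -> T -> R) (f : T -> R) (C : R) :
  (forall n, bmT (f_ n)) -> bmT f -> (forall n u, `|f_ n u| <= C) ->
  (forall u, f_ n u @[n --> \oo] --> f u) -> E (f_ n) @[n --> \oo] --> E f.
  exact: (@density_mean_cvg _ (borel T) R lam rho rho_ge0 rho_int).
have [[M bM [hM [c c0 hc]]]|H] := mean_field_dichotomy mf kernel_bmT kernel_op_bmT (J_gt0 u0)
  Jge Jle (@bounded_measurable_tanh _ (borel T) R) (@bounded_measurable_cvg _ (borel T) R) mc b_ge0.
  left; exists M; split.
  - have -> : M = (fun u => tanh (b * K M u)) by apply/funext.
    exact: ct.
  - by move=> u; rewrite (lt_le_trans c0)//= hM tanh_lt1.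
  - by move=> u; rewrite [in RHS]hM tanhK.
right => delta /H[a [f [e [bf ef [c c0 hc] he]]]]; exists e; split => //.
- have -> : e = (fun u => tanh (a * K f u)) by apply/funext.
  exact: ct.
- by move=> u; exact: lt_le_trans (hc u).
Qed.

End torus_kernel.

(** * Measures on a product with the set of spins *)

Section with_density.
Context {dY : measure_display} {Y : measurableType dY} {R : realType}.
Variables (mu : probability Y R) (f : Y -> R).
Variable f0 : forall u, 0 <= f u.
Variable fi : mu.-integrable setT (fun u => (f u)%:E).

(** The two proofs are arguments so that the measure and finiteness structures, which are built from
    them, can be attached to this constant. *)
Definition with_density (_ : forall u, 0 <= f u)
    (_ : mu.-integrable setT (fun u => (f u)%:E)) (A : set Y) : \bar R :=
  (\int[mu]_(u in A) (f u)%:E)%E.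

Let nu := with_density f0 fi.

Let nu0 : nu set0 = 0%E.
Proof. by rewrite /nu /with_density integral_set0. Qed.

Let nu_ge0 A : (0 <= nu A)%E.
Proof. by apply: integral_ge0 => u _; rewrite lee_fin. Qed.

Let nu_sigma_additive : semi_sigma_additive nu.
Proof.
apply: semi_sigma_additive_nng_induced; first by case/integrableP: fi.
by move=> u; rewrite lee_fin.
Qed.

HB.instance Definition _ := isMeasure.Build _ _ _ (with_density f0 fi)
  nu0 nu_ge0 nu_sigma_additive.

Let nu_fin : fin_num_fun nu.
Proof.
move=> A mA; apply: integrable_fin_num => //.
exact: (integrableS measurableT).
Qed.

HB.instance Definition _ := Measure_isFinite.Build _ _ _ (with_density f0 fi) nu_fin.

(** Change of variables for the Radon-Nikodym derivative, which equals f almost everywhere because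
    both have the same integral over every measurable set. *)
Lemma integral_with_density (h : Y -> R) : bounded_measurable h ->
  (\int[with_density f0 fi]_u (h u)%:E = \int[mu]_u (h u * f u)%:E)%E.
Proof.
move=> bh; have [mh [C hC]] := bh.
pose nuf : {finite_measure set Y -> \bar R} := with_density f0 fi.
have numu : nuf `<< mu.
  apply/null_content_dominatesP => A mA A0.
  by apply: null_set_integral => //; apply: measurable_funTS; case/integrableP: fi.
have ih : nuf.-integrable setT (fun u => (h u)%:E).
  apply: measurable_bounded_integrable => //.
    by rewrite ltey_eq; apply/orP; left; exact: fin_num_measure.
  exists C; split; first by rewrite num_real.
  by move=> x Cx u _ /=; rewrite (le_trans (hC u))// ltW.
rewrite -[LHS](Radon_Nikodym_change_of_variables numu measurableT ih).
have mRN : measurable_fun setT (Radon_Nikodym (charge_of_finite_measure nuf) mu).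
  by have /integrableP[] := Radon_Nikodym_integrable numu.
apply: ae_eq_integral => //.
- by apply: emeasurable_funM => //; exact/measurable_EFinP.
- apply/measurable_EFinP; apply: measurable_funM => //.
  by apply/measurable_EFinP; case/integrableP: fi.
have : ae_eq mu setT (Radon_Nikodym (charge_of_finite_measure nuf) mu) (fun u => (f u)%:E).
  apply: integral_ae_eq => //.
  - exact: Radon_Nikodym_integrable.
  - by case/integrableP: fi.
  - by move=> A _ mA; rewrite -Radon_Nikodym_integral.
by apply: filterS => u /(_ I) fu _; rewrite fu// EFinM.
Qed.

End with_density.

Section spin_measure.
Context {R : realType} {X : ptopologicalType}.
Variables (mu : probability (borel X) R).

Definition with_spin (a : spin) (u : borel X) : borel (X * spin)%type := (u, a).

Lemma measurable_with_spin a : measurable_fun setT (with_spin a).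
Proof.
apply: (continuous_borel_measurable (Y := (X * spin)%type) (f := fun u : X => (u, a))).
move=> u A [[P Q] /= [uP aQ] PQA]; apply: filterS uP => v Pv; apply: PQA.
by split => //=; exact: nbhs_singleton.
Qed.
HB.instance Definition _ a := isMeasurableFun.Build _ _ _ _ (with_spin a) (@measurable_with_spin a).

Section spin_push.
Variables (nu : {measure set (borel X) -> \bar R}) (a : spin).

Definition spin_push : set (borel (X * spin)%type) -> \bar R := pushforward nu (with_spin a).

Let spin_push0 : spin_push set0 = 0%E.
Proof. by rewrite /spin_push /pushforward preimage_set0 measure0. Qed.

Let spin_push_ge0 B : (0 <= spin_push B)%E.
Proof. exact: measure_ge0. Qed.

Let spin_push_sigma_additive : semi_sigma_additive spin_push.
Proof. exact: measure_semi_sigma_additive. Qed.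

HB.instance Definition _ := isMeasure.Build _ _ _ spin_push
  spin_push0 spin_push_ge0 spin_push_sigma_additive.

Lemma integral_spin_push (g : X * spin -> R) :
  @bounded_measurable _ (borel (X * spin)%type) R g -> (nu setT < +oo)%E ->
  spin_push.-integrable setT (fun z => (g z)%:E) /\
  (\int[spin_push]_z (g z)%:E = \int[nu]_u (g (u, a))%:E)%E.
Proof.
move=> [mg [C hC]] nuy.
have mga : measurable_fun setT (fun u : borel X => g (u, a)).
  exact: (measurableT_comp mg (@measurable_with_spin a)).
have inu : nu.-integrable setT (fun u => (g (u, a))%:E).
  apply: measurable_bounded_integrable => //.
  exists C; split; first by rewrite num_real.
  by move=> x Cx u _ /=; rewrite (le_trans (hC _))// ltW.
have mgE : measurable_fun setT (fun z : borel (X * spin)%type => (g z)%:E).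
  exact/measurable_EFinP.
have mw := @measurable_with_spin a.
split.
  exact: (integrable_pushforward mw mgE inu measurableT).
by have := integral_pushforward mw mgE inu measurableT; rewrite preimage_setT.
Qed.

End spin_push.

Definition spin_sum (nu0 nu1 : {measure set (borel X) -> \bar R}) : set (borel (X * spin)%type) -> \bar R :=
  measure_add (spin_push nu0 ord0) (spin_push nu1 ord_max).
HB.instance Definition _ nu0 nu1 := Measure.on (spin_sum nu0 nu1).

Lemma measurable_spin_rect (A : set (borel X)) (a : spin) : measurable A ->
  measurable (A `*` [set a] : set (borel (X * spin)%type)).
Proof.
move=> mA.
have m1 : measurable_fun setT (fst : borel (X * spin)%type -> borel X).
  by apply: (continuous_borel_measurable (f := fst)) => u; exact: cvg_fst.
have m2 : measurable (snd @^-1` [set a] : set (borel (X * spin)%type)).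
  apply: sub_sigma_algebra; have /continuousP : continuous (snd : X * spin -> spin).
    by move=> u; exact: cvg_snd.
  by apply; exact: discrete_open.
have := m1 measurableT A mA; rewrite setTI => mA1.
exact: measurableI mA1 m2.
Qed.

(** A Borel set of the product is the disjoint union of its two slices, each of which is a
    measurable rectangle. *)
Lemma spin_measure_eq (phi psi : Pr R (X * spin)%type) :
  (forall a (A : set (borel X)), measurable A -> phi (A `*` [set a]) = psi (A `*` [set a])) ->
  measure_eq phi psi.
Proof.
move=> H B mB.
pose S a : set (borel X) := with_spin a @^-1` B.
have mS a : measurable (S a).
  by rewrite -[S a]setTI; exact: measurable_with_spin.
have BE : B = (S ord0 `*` [set ord0]) `|` (S ord_max `*` [set ord_max]).
  apply/seteqP; split => [[u a] Bu|[u a] [|] /= [+ ->]//].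
  by have [aE|aE] := spinP a; rewrite aE in Bu *; [left|right].
have disj : (S ord0 `*` [set ord0]) `&` (S ord_max `*` [set ord_max]) = set0 :> set (X * spin).
  by apply/seteqP; split => // -[u a] /= [[_ ->] [_ ]].
have m0 := measurable_spin_rect ord0 (mS ord0).
have m1 := measurable_spin_rect ord_max (mS ord_max).
have U (chi : Pr R (X * spin)%type) : chi B =
    (chi (S ord0 `*` [set ord0]) + chi (S ord_max `*` [set ord_max]))%E.
  by rewrite [in LHS]BE; exact: (measureU chi m0 m1 disj).
apply: (etrans (U phi)); apply: (etrans _ (esym (U psi))).
by congr (_ + _)%E; exact: H.
Qed.

Lemma spin_measure_exists (f : spin -> X -> R) :
  (forall a u, 0 <= f a u) -> (forall a, measurable_fun setT (f a : borel X -> R)) ->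
  (\int[mu]_u (f ord0 u + f ord_max u)%:E = 1)%E ->
  exists phi : Pr R (X * spin)%type,
    (forall a (A : set (borel X)), measurable A ->
       phi (A `*` [set a]) = (\int[mu]_(u in A) (f a u)%:E)%E) /\
    (forall g : X * spin -> R, @bounded_measurable _ (borel (X * spin)%type) R g ->
       (\int[phi]_z (g z))%R =
         (\int[mu]_u (g (u, ord0) * f ord0 u))%R + (\int[mu]_u (g (u, ord_max) * f ord_max u))%R).
Proof.
move=> f0 mf f1.
have fi a : mu.-integrable setT (fun u => (f a u)%:E).
  apply/integrableP; split; first exact/measurable_EFinP.
  apply: (@le_lt_trans _ _ 1%E); last by rewrite ltry.
  rewrite -f1; apply: ge0_le_integral => //.
  - by apply: measurableT_comp => //; exact/measurable_EFinP.
  - by apply/measurable_EFinP; exact: measurable_funD.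
  - move=> u _; rewrite gee0_abs ?lee_fin//.
    by have [->|->] := spinP a; [rewrite lerDl|rewrite lerDr].
pose nu a : {measure set (borel X) -> \bar R} := @with_density _ (borel X) R mu (f a) (f0 a) (fi a).
pose phi0 := spin_sum (nu ord0) (nu ord_max).
have phi0E B : phi0 B = (\int[mu]_(u in with_spin ord0 @^-1` B) (f ord0 u)%:E +
   \int[mu]_(u in with_spin ord_max @^-1` B) (f ord_max u)%:E)%E.
  by rewrite /phi0 /spin_sum measure_addE.
have phi01 : phi0 setT = 1%E.
  rewrite phi0E !preimage_setT -f1 -ge0_integralD//.
  - by move=> u _; rewrite lee_fin.
  - exact/measurable_EFinP.
  - by move=> u _; rewrite lee_fin.
  - exact/measurable_EFinP.
pose phiM := Measure_isProbability.Build _ _ _ phi0 phi01.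
pose phi : Pr R (X * spin)%type := HB.pack (spin_sum (nu ord0) (nu ord_max)) phiM.
exists phi; split.
  move=> a A mA; rewrite [LHS]phi0E.
  have E0 b : b = a -> with_spin b @^-1` (A `*` [set a]) = A.
    by move=> ->; apply/seteqP; split => [u []//|u Au]; split.
  have E1 b : b <> a -> with_spin b @^-1` (A `*` [set a]) = set0.
    by move=> ba; apply/seteqP; split => // u [].
  have [aE|aE] := spinP a; subst a.
    by rewrite (E0 ord0)// (E1 ord_max)// integral_set0 adde0.
  by rewrite (E1 ord0)// (E0 ord_max)// integral_set0 add0e.
move=> g bg; have [mg [C hC]] := bg.
have bga a : @bounded_measurable _ (borel X) R (fun u => g (u, a)).
  split; last by exists C.
  exact: (measurableT_comp mg (@measurable_with_spin a)).
have igf a := integrable_density (fi a) (bga a).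
have nuy a : (nu a setT < +oo)%E.
  by rewrite ltey_eq; apply/orP; left; exact: integrable_fin_num.
rewrite /Rintegral -fineD; last 2 first.
- exact: integrable_fin_num (igf _).
- exact: integrable_fin_num (igf _).
congr fine; rewrite [LHS](_ : _ = \int[phi0]_z (g z)%:E)%E//.
have [i0 e0] := integral_spin_push ord0 bg (nuy ord0).
have [i1 e1] := integral_spin_push ord_max bg (nuy ord_max).
rewrite integral_measure_add// e0 e1; congr (_ + _)%E; exact: integral_with_density.
Qed.

End spin_measure.

(** * Free energy of a state *)

Section density_free_energy.
Context {dY : measure_display} {Y : measurableType dY} {R : realType}.
Variables (mu : probability Y R) (rho : Y -> R).
Hypothesis rho_ge0 : forall u, 0 <= rho u.
Hypothesis rho_int : mu.-integrable setT (fun u => (rho u)%:E).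
Hypothesis rho1 : (\int[mu]_u rho u)%R = 1.
Variable k : Y -> Y -> R.
Local Notation E := (density_mean mu rho).
Local Notation K := (kernel_op E k).
Hypothesis bmk : forall u, bounded_measurable (k u).
Hypothesis bmK : forall f, bounded_measurable f -> bounded_measurable (K f).
Local Notation mf := (density_mean_functional rho_ge0 rho_int rho1).

Let rho_meas : measurable_fun setT rho.
Proof. by have /integrableP[/measurable_EFinP] := rho_int. Qed.

(** A density of a state is controlled only almost everywhere and may be unbounded on a null set;
    al' is a bounded version, to which the algebra of bounded functions applies. *)
Lemma integral_interaction (al al' : Y -> R) : measurable_fun setT al ->
  bounded_measurable al' -> {ae mu, forall u, rho u * al u = rho u * al' u} ->
  (\int[mu]_u \int[mu]_v (rho u * al u * k u v * (rho v * al v))%:E)%E =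
  (E (fun u => al' u * K al' u))%:E.
Proof.
move=> mal bal' aeal.
have inner u : (\int[mu]_v (rho u * al u * k u v * (rho v * al v))%:E)%E =
    (rho u * al u * K al' u)%:E.
  have bka := bounded_measurableM (bmk u) bal'.
  rewrite EFinM /kernel_op density_meanE// -integralZl//; last exact: integrable_density.
  apply: ae_eq_integral => //.
  - apply/measurable_EFinP; apply: measurable_funM; last exact: measurable_funM.
    by apply: measurable_funM => //; case: (bmk u).
  - apply: emeasurable_funM => //; apply/measurable_EFinP.
    by apply: measurable_funM => //; case: bka.
  apply: filterS aeal => v alv _; rewrite -EFinM; congr EFin.
  by rewrite alv; ring.
rewrite (eq_integral (fun u => (rho u * al u * K al' u)%:E)); last by move=> u _; exact: inner.
have bKa := bmK bal'.
rewrite density_meanE//; last exact: bounded_measurableM.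
apply: ae_eq_integral => //.
- apply/measurable_EFinP; apply: measurable_funM; first exact: measurable_funM.
  by case: bKa.
- apply/measurable_EFinP; apply: measurable_funM => //; apply: measurable_funM.
    by case: bal'.
  by case: bKa.
by apply: filterS aeal => u alu _; rewrite alu; congr EFin; ring.
Qed.

Lemma integral_entropy (al : spin -> Y -> R) (m : Y -> R) :
  (forall a, measurable_fun setT (al a)) -> measurable_fun setT m ->
  (forall u, -1 <= m u <= 1) ->
  (forall a, {ae mu, forall u, rho u * al a u = rho u * bern (m u) a}) ->
  (\int[mu]_u (rho u * \sum_(a : spin) al a u * ln (2 * al a u))%:E)%E =
  (E (fun u => neg_entropy (m u)))%:E.
Proof.
move=> mal mm m1 aeal.
have bh := bounded_measurable_neg_entropy mm m1.
rewrite density_meanE//.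
have mterm a : measurable_fun setT (fun u => al a u * ln (2 * al a u)).
  apply: measurable_funM => //.
  have m2 : measurable_fun setT (fun u => 2 * al a u) by exact: measurable_funM.
  exact: (measurableT_comp (@measurable_ln R) m2).
apply: ae_eq_integral => //.
- apply/measurable_EFinP; apply: measurable_funM => //.
  under eq_fun do rewrite sum_spin.
  exact: measurable_funD.
- by apply/measurable_EFinP; apply: measurable_funM => //; case: bh.
have := aeal ord_max; apply: filterS2 (aeal ord0) => u a0 a1 _.
congr EFin; rewrite mulrC.
have [->|r0] := eqVneq (rho u) 0; first by rewrite !mulr0.
congr (_ * _); rewrite sum_spin (mulfI r0 a0) (mulfI r0 a1) /bern sgn0 sgn_max mul1r mulN1r.
rewrite /neg_entropy; by congr (_ * ln _ + _ * ln _); field.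
Qed.

(** Summing (1 + sgn a m)(1 + sgn a m')/4 over a gives (1 + m m')/2: the 1 produces the additive
    constant and explains the factor b/2. The 2 inside the logarithm turns 2 alpha into 1 + sgn a
    m. *)
Lemma free_energy_densityE (b : R) (al : spin -> Y -> R) (m : Y -> R) :
  (forall a, measurable_fun setT (al a)) -> measurable_fun setT m ->
  (forall u, -1 <= m u <= 1) ->
  (forall a, {ae mu, forall u, rho u * al a u = rho u * bern (m u) a}) ->
  (- (b%:E * \sum_(a : spin) \int[mu]_u \int[mu]_v
        (rho u * al a u * k u v * (rho v * al a v))%:E)
   + \int[mu]_u (rho u * \sum_(a : spin) al a u * ln (2 * al a u))%:E)%E =
  (- (b / 2 * E (K (fun=> 1))) + free_energyE E k b m)%:E.
Proof.
move=> mal mm m1 aeal.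
have bm_ : bounded_measurable m by split => //; exists 1 => u; rewrite ler_norml.
have b1 : bounded_measurable (fun=> 1 : R) := bmC mf 1.
have bb a : bounded_measurable (fun u => bern (m u) a).
  rewrite (_ : (fun u => _) = (fun u => 2^-1 + (sgn a / 2) * m u)).
    by apply: (bmD mf); [exact: (bmC mf)|exact: (bmZ mf)].
  by apply/funext => u; rewrite /bern; field.
rewrite (eq_bigr (fun a => (E (fun u => bern (m u) a * K (fun v => bern (m v) a) u))%:E)); last first.
  by move=> a _; apply: integral_interaction => //.
rewrite (integral_entropy mal mm m1 aeal) sumEFin -EFinM -EFinN -EFinD; congr EFin.
rewrite /free_energyE addrA addrAC; congr (_ + _).
have Kb a u : K (fun v => bern (m v) a) u = 2^-1 * K (fun=> 1) u + sgn a / 2 * K m u.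
  rewrite /kernel_op -!(meanZ mf) -?(meanD mf).
  - by congr E; apply/funext => v /=; rewrite /bern; field.
  - by apply: (bmZ mf); apply: (bmM mf).
  - by apply: (bmZ mf); apply: (bmM mf).
  - by apply: (bmM mf).
  - by apply: (bmM mf).
rewrite -opprD -mulrDr; congr (- _).
have bK1 := bmK b1; have bKm := bmK bm_.
have bbK a : bounded_measurable (fun u => bern (m u) a * K (fun v => bern (m v) a) u).
  by apply: (bmM mf) => //; exact: bmK.
have bmKm : bounded_measurable (fun u => m u * K m u) by exact: (bmM mf).
rewrite sum_spin -(meanD mf (bbK _) (bbK _)) -(meanD mf bK1 bmKm).
rewrite -mulrA -(meanZ mf 2^-1 (bmD mf bK1 bmKm)); congr (_ * E _); apply/funext => u.
by rewrite !Kb /bern sgn0 sgn_max; field.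
Qed.

End density_free_energy.

Section densities.
Context {dY : measure_display} {Y : measurableType dY} {R : realType}.
Variables (mu : probability Y R) (rho : Y -> R).
Hypothesis rho_int : mu.-integrable setT (fun u => (rho u)%:E).

(** The difference of the two densities is clamped to [-1, 1], so that the bound on m holds
    everywhere and not only almost everywhere. *)
Lemma density_magnetization (al : spin -> Y -> R) :
  (forall a, measurable_fun setT (al a)) -> (forall a u, 0 <= al a u) ->
  {ae mu, forall u, al ord0 u + al ord_max u = 1} ->
  exists m : Y -> R, [/\ measurable_fun setT m, forall u, -1 <= m u <= 1 &
    {ae mu, forall u a, al a u = bern (m u) a}].
Proof.
move=> mal al0 al1.
exists (fun u => Num.max (-1) (Num.min 1 (al ord0 u - al ord_max u))); split.
- apply: measurable_maxr; first exact: measurable_cst.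
  by apply: measurable_minr; [exact: measurable_cst|exact: measurable_funB].
- by move=> u; rewrite le_max lexx/= ge_max ge_min lexx/= (le_trans _ ler01)// lerN10.
- apply: filterS al1 => u alu a; have := al0 ord0 u; have := al0 ord_max u => h1 h0.
  have -> : Num.min 1 (al ord0 u - al ord_max u) = al ord0 u - al ord_max u.
    by apply/min_idPr; lra.
  have -> : Num.max (-1) (al ord0 u - al ord_max u) = al ord0 u - al ord_max u.
    by apply/max_idPr; lra.
  by rewrite /bern; have [->|->] := spinP a; rewrite ?sgn0 ?sgn_max; lra.
Qed.

Lemma density_unique (f g : Y -> R) : measurable_fun setT f ->
  mu.-integrable setT (fun u => (g u * rho u)%:E) ->
  (forall A, measurable A -> (\int[mu]_(u in A) (f u * rho u)%:E =
      \int[mu]_(u in A) (g u * rho u)%:E)%E) ->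
  {ae mu, forall u, rho u * f u = rho u * g u}.
Proof.
move=> mf ig fg.
have mrho : measurable_fun setT rho by have /integrableP[/measurable_EFinP] := rho_int.
have : ae_eq mu setT (fun u => (g u * rho u)%:E) (fun u => (f u * rho u)%:E).
  apply: integral_ae_eq => //.
    by apply/measurable_EFinP; exact: measurable_funM.
  by move=> A _ mA; rewrite fg.
by apply: filterS => u /(_ I) [gf]; rewrite mulrC -gf mulrC.
Qed.

End densities.

Lemma mean_variance {R : realType} {X : Type} {bm : (X -> R) -> Prop} {E : (X -> R) -> R}
    (mf : mean_functional bm E) (r : X -> R) : bm r ->
  E (fun u => (r u - E r) ^+ 2) = E (fun u => r u ^+ 2) - E r ^+ 2.
Proof.
move=> br; rewrite (_ : (fun u => _) = (fun u => r u ^+ 2 + (E r ^+ 2 - 2 * E r * r u))).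
  rewrite (meanD mf) ?(meanB mf) ?(meanC mf) ?(meanZ mf)//.
  - by ring.
  - exact: (bmC mf).
  - exact: (bmZ mf).
  - exact: (bmX mf).
  - by apply: (bmB mf); [exact: (bmC mf)|exact: (bmZ mf)].
by apply/funext => u; ring.
Qed.

Lemma sandwich0 {R : realFieldType} (x y a w : R) : 0 <= a -> 0 <= w ->
  x + a / 12 + w <= y -> x <= y /\ (y <= x -> a = 0 /\ w = 0).
Proof. by move=> a0 w0 h; split; [lra|move=> h2; split; lra]. Qed.

Lemma sqr_bound {R : realDomainType} (m : R) : -1 <= m <= 1 -> 0 <= m ^+ 2 <= 1.
Proof. by move=> /andP[h1 h2]; rewrite sqr_ge0/=; nra. Qed.

Lemma linear_defect {R : realFieldType} (m delta q : R) : -1 <= m <= 1 -> 0 <= delta ->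
  q <= 1 + delta -> - delta <= m ^+ 2 * (1 - q).
Proof. by move=> /sqr_bound; set p := m ^+ 2 => /andP[h1 h2] h3 h4; nra. Qed.

(** * Minimizers up to sign *)

Section magnetization.
Context {dY : measure_display} {Y : measurableType dY} {R : realType}.
Variables (mu : probability Y R) (rho : Y -> R).
Hypothesis rho_ge0 : forall u, 0 <= rho u.
Hypothesis rho_int : mu.-integrable setT (fun u => (rho u)%:E).
Hypothesis rho1 : (\int[mu]_u rho u)%R = 1.
Variables (k : Y -> Y -> R) (j0 : R) (b : R).
Local Notation E := (density_mean mu rho).
Local Notation K := (kernel_op E k).
Local Notation F := (free_energyE E k b).
Local Notation mf := (density_mean_functional rho_ge0 rho_int rho1).
Local Notation bm := (@bounded_measurable _ Y R).
Hypothesis bmk : forall u, bm (k u).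
Hypothesis bmK : forall f, bm f -> bm (K f).
Hypothesis K_sym : forall f g, bm f -> bm g ->
  E (fun u => f u * K g u) = E (fun u => g u * K f u).
Hypotheses (j0_gt0 : 0 < j0) (kj0 : forall u v, j0 <= k u v).
Hypothesis b_ge0 : 0 <= b.

Variables (Psi : Type) (comp : Psi -> spin -> set Y -> \bar R).

(** [has_densities] and [energy] restate [has_density] and [free_energy] for an abstract measurable
    space and an abstract type of states, known only through its components. The statements on the
    torus are convertible to instances of these. *)
Definition has_densities (phi : Psi) (alpha : spin -> Y -> R) : Prop :=
  [/\ forall a, measurable_fun setT (alpha a), forall a u, 0 <= alpha a u,
      {ae mu, forall u, alpha ord0 u + alpha ord_max u = 1} &
      forall a A, measurable A -> comp phi a A = (\int[mu]_(u in A) (alpha a u * rho u)%:E)%E].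

Definition energy (phi : Psi) : \bar R :=
  if `[< exists alpha, has_densities phi alpha >]
  then let alpha := xget (fun _ _ => 0) [set alpha | has_densities phi alpha] in
    (- (b%:E * \sum_(a : spin) \int[mu]_u \int[mu]_v
        (rho u * alpha a u * k u v * (rho v * alpha a v))%:E)
   + \int[mu]_u (rho u * \sum_(a : spin) alpha a u * ln (2 * alpha a u))%:E)%E
  else +oo%E.

Local Notation mT := (fun m : Y -> R => measurable_fun setT m).
Local Notation pm1 := (fun m : Y -> R => forall u, -1 <= m u <= 1).

Definition has_magnetization (psi : Psi) (m : Y -> R) : Prop :=
  forall (a : spin) (A : set Y), measurable A ->
    comp psi a A = (\int[mu]_(u in A) (bern (m u) a * rho u)%:E)%E.

Definition comp_eq (psi phi : Psi) : Prop :=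
  forall (a : spin) (A : set Y), measurable A -> comp psi a A = comp phi a A.

Let bm_pm1 (m : Y -> R) : mT m -> pm1 m -> bm m.
Proof. by move=> mm m1; split => //; exists 1 => u; rewrite ler_norml. Qed.

Let bernE (m : Y -> R) a : (fun u => bern (m u) a) = (fun u => 2^-1 + (sgn a / 2) * m u).
Proof. by apply/funext => u; rewrite /bern; field. Qed.

Let bm_bern (m : Y -> R) a : bm m -> bm (fun u => bern (m u) a).
Proof.
by move=> bm_; rewrite bernE; apply: (bmD mf); [exact: (bmC mf)|exact: (bmZ mf)].
Qed.

Lemma magnetization_has_density (psi : Psi) (m : Y -> R) : mT m -> pm1 m ->
  has_magnetization psi m -> has_densities psi (fun a u => bern (m u) a).
Proof.
move=> mm m1 hm; split => //.
- by move=> a; case: (bm_bern a (bm_pm1 mm m1)).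
- by move=> a u; exact: bern_ge0.
- by apply: aeW => u; rewrite /bern sgn0 sgn_max; lra.
Qed.

Lemma density_eq_magnetization (psi : Psi) (m : Y -> R) al : mT m -> pm1 m ->
  has_magnetization psi m -> has_densities psi al ->
  forall a, {ae mu, forall u, rho u * al a u = rho u * bern (m u) a}.
Proof.
move=> mm m1 hm [mal al0 al1 hal] a.
apply: (@density_unique _ Y R mu rho rho_int (al a) (fun u => bern (m u) a) (mal a)).
  exact: (integrable_density rho_int (bm_bern a (bm_pm1 mm m1))).
by move=> A mA; have := hal a A mA; rewrite hm.
Qed.

Let c0 := - (b / 2 * E (K (fun=> 1))).

Lemma energy_magnetization (psi : Psi) (m : Y -> R) : mT m -> pm1 m ->
  has_magnetization psi m -> energy psi = (c0 + F m)%:E.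
Proof.
move=> mm m1 hm; have hd := magnetization_has_density mm m1 hm.
have ex : exists al, has_densities psi al by exists (fun a u => bern (m u) a).
rewrite /energy asboolT//.
set al := xget _ _.
have hal : has_densities psi al by apply: (xgetPex (fun _ _ => 0)); exists (fun a u => bern (m u) a).
have [mal _ _ _] := hal.
exact: (free_energy_densityE rho_ge0 rho_int rho1 bmk bmK b mal mm m1 (density_eq_magnetization mm m1 hm hal)).
Qed.

Lemma energy_cases (psi : Psi) : energy psi = +oo%E \/
  exists m : Y -> R, [/\ mT m, pm1 m & has_magnetization psi m].
Proof.
rewrite /energy; case: asboolP => [[al [mal al0 al1 hal]]|]; [right|by left].
have [m [mm m1 aem]] := @density_magnetization _ Y R mu al mal al0 al1.
exists m; split => // a A mA; rewrite hal//.
have mrho : measurable_fun setT rho.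
  by have /integrableP[/measurable_EFinP] := rho_int.
have ig := integrable_density rho_int (bm_bern a (bm_pm1 mm m1)).
apply: ae_eq_integral => //.
- apply: measurable_funTS; apply/measurable_EFinP.
  exact: (@measurable_funM _ Y R setT (al a) rho).
- apply: measurable_funTS.
  by case/integrableP: ig.
- by apply: filterS aem => u /(_ a) -> _.
Qed.

Lemma has_magnetization_eq (psi : Psi) (m m' : Y -> R) : mT m -> pm1 m -> mT m' -> pm1 m' ->
  {ae mu, forall u, rho u * m u = rho u * m' u} ->
  has_magnetization psi m -> has_magnetization psi m'.
Proof.
move=> mm m1 mm' m1' mm'e hm a A mA; rewrite hm//.
have ig := integrable_density rho_int (bm_bern a (bm_pm1 mm m1)).
have ig' := integrable_density rho_int (bm_bern a (bm_pm1 mm' m1')).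
apply: ae_eq_integral => //.
- by apply: measurable_funTS; case/integrableP: ig.
- by apply: measurable_funTS; case/integrableP: ig'.
apply: filterS mm'e => u e _; congr EFin; rewrite /bern.
have -> : (1 + sgn a * m u) / 2 * rho u = rho u / 2 + sgn a / 2 * (rho u * m u) by field.
by rewrite e; field.
Qed.

Lemma magnetization_unique (psi phi : Psi) (m : Y -> R) :
  has_magnetization psi m -> has_magnetization phi m -> comp_eq psi phi.
Proof. by move=> h1 h2 a A mA; rewrite h1// h2. Qed.

Lemma free_energyE_opp (m : Y -> R) : bm m -> F (fun u => - m u) = F m.
Proof.
move=> bm_; rewrite /free_energyE; congr (_ - _ * _).
  by congr E; apply/funext => u; rewrite neg_entropyN.
congr E; apply/funext => u.
have -> : K (fun u => - m u) u = (-1) * K m u.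
  rewrite /kernel_op -(meanZ mf); first by congr E; apply/funext => v; ring.
  by apply: (bmM mf).
by ring.
Qed.

(** For M = 0 the two alternatives coincide and this is plain uniqueness, so [minimizerP] serves
    both situations of the theorem. *)
Definition unique_up_to_sign (M : Y -> R) : Prop :=
  forall m : Y -> R, mT m -> pm1 m -> F M <= F m /\
    (F m <= F M -> {ae mu, forall u, rho u * m u = rho u * M u} \/
                   {ae mu, forall u, rho u * m u = rho u * - M u}).

Lemma minimizerP (M : Y -> R) (phip phim : Psi) : mT M -> pm1 M ->
  unique_up_to_sign M -> has_magnetization phip M -> has_magnetization phim (fun u => - M u) ->
  forall psi, (forall chi, (energy psi <= energy chi)%E) <-> (comp_eq psi phip \/ comp_eq psi phim).
Proof.
move=> mM M1 uM hp hm psi.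
have mNM : mT (fun u => - M u) by exact: measurableT_comp.
have NM1 : pm1 (fun u => - M u) by move=> u; rewrite lerN2 lerNl andbC; exact: M1.
have fp := energy_magnetization mM M1 hp.
have fm := energy_magnetization mNM NM1 hm.
rewrite (free_energyE_opp (bm_pm1 mM M1)) in fm.
split.
  move=> /(_ phip); rewrite fp => le.
  have [e|[m [mm m1 hpsi]]] := energy_cases psi; first by rewrite e in le.
  move: le; rewrite (energy_magnetization mm m1 hpsi) lee_fin lerD2l.
  have [_ uM2] := uM m mm m1 => /uM2[e|e].
    left; apply: magnetization_unique hp.
    exact: (has_magnetization_eq mm m1 mM M1 e hpsi).
  right; apply: magnetization_unique hm.
  exact: (has_magnetization_eq mm m1 mNM NM1 e hpsi).
have meq (phi : Psi) m : has_magnetization phi m -> comp_eq psi phi -> has_magnetization psi m.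
  by move=> h e a A mA; rewrite -h//; exact: e.
move=> h; have e : energy psi = (c0 + F M)%:E.
  case: h => [/(meq _ _ hp)|/(meq _ _ hm)] h; first exact: energy_magnetization.
  by rewrite (energy_magnetization mNM NM1 h) free_energyE_opp//; exact: bm_pm1.
move=> chi; rewrite e.
have [->|[m [mm m1 hchi]]] := energy_cases chi; first by rewrite leey.
rewrite (energy_magnetization mm m1 hchi) lee_fin lerD2l.
by have [] := uM m mm m1.
Qed.

Lemma unique_up_to_sign_positive (M : Y -> R) (c : R) : bm M -> bm (fun u => (M u)^-1) ->
  (forall u, 0 < M u < 1) -> 0 < c -> (forall u, c <= M u) ->
  (forall u, b * K M u = artanh (M u)) -> unique_up_to_sign M.
Proof.
move=> bM bMi M01 c_gt0 cM eM m mm m1.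
have bm_ := bm_pm1 mm m1.
have M0 u : 0 < M u by have /andP[] := M01 u.
(* A positive solution has b K M = artanh M > 0. Positivity of b is what gives the variance term a
   positive coefficient. *)
have b0 : 0 < b.
  rewrite lt_neqAle b_ge0 andbT eq_sym; apply/eqP => b0.
  by have := artanh_gt0 (M01 point); rewrite -eM b0 mul0r ltxx.
have hh := bounded_measurable_neg_entropy mm m1.
have hM : bm (fun u => neg_entropy (M u)).
  apply: bounded_measurable_neg_entropy; first by case: bM.
  by move=> u; have /andP[/ltW a1 /ltW ->] := M01 u; rewrite (le_trans _ a1)// lerN10.
have bg : bm (fun u => b * K M u * (M u)^-1).
  by apply: (bmM mf) => //; apply: (bmZ mf); exact: bmK.
have := @free_energyE_ge R Y bm E mf k bmk bmK K_sym M (fun u => (M u)^-1) j0 c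
  bM bMi M0 (fun=> erefl) (ltW j0_gt0) (ltW c_gt0) kj0 cM b 0 1 m M
  (fun u => b * K M u * (M u)^-1) (ltW b0) bm_ bM bg hh hM.
set A := E (fun u => _ ^+ 2).
set V := E _ - _ ^+ 2.
have A0 : 0 <= A.
  by apply: (mean_ge0 mf) => [|u]; [apply: (bmX mf); apply: (bmB mf); exact: (bmX mf)|exact: sqr_ge0].
have br : bm (fun u => m u * (M u)^-1) by exact: (bmM mf).
pose t := E (fun u => m u * (M u)^-1).
have bV : bm (fun u => (m u * (M u)^-1 - t) ^+ 2).
  by apply: (bmX mf); apply: (bmB mf) => //; exact: (bmC mf).
have VE : V = E (fun u => (m u * (M u)^-1 - t) ^+ 2) by rewrite (mean_variance mf).
have V0 : 0 <= V by rewrite VE; apply: (mean_ge0 mf) => // u; exact: sqr_ge0.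
set w := b / 2 * _.
have w0 : 0 <= w by rewrite /w mulr_ge0 ?divr_ge0 ?(ltW b0)// mulr_ge0// mulr_ge0 ?sqr_ge0 ?(ltW j0_gt0).
move=> H.
have {}H : F M + A / 12 + w <= F m.
  rewrite -[leLHS]subr0 -[X in _ - X](mul0r 2^-1); apply: H.
  - by move=> u; rewrite mul1r.
  - by move=> u; rewrite eM; exact: neg_entropy_tangent.
  - by move=> u; rewrite subrr mulr0 oppr0.
have [le0 eq0] := sandwich0 A0 w0 H; split => // /eq0[A00 w00].
have V00 : V = 0.
  move/eqP: w00; rewrite /w !mulf_eq0 invr_eq0 (gt_eqF b0) (gt_eqF j0_gt0).
  by rewrite (gt_eqF c_gt0) pnatr_eq0/= => /eqP.
have bz : bm (fun u => (m u ^+ 2 - M u ^+ 2) ^+ 2).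
  by apply: (bmX mf); apply: (bmB mf); exact: (bmX mf).
have ae1 := @density_mean_eq0 _ Y R mu rho rho_ge0 rho_int _ bz (fun u => sqr_ge0 _) A00.
rewrite VE in V00.
have ae2 := @density_mean_eq0 _ Y R mu rho rho_ge0 rho_int _ bV (fun u => sqr_ge0 _) V00.
(* Equality makes both defects vanish: wherever rho is not 0, m^2 = M^2 and m = t M with one
   constant t. *)
have key u : (m u ^+ 2 - M u ^+ 2) ^+ 2 * rho u = 0 -> (m u * (M u)^-1 - t) ^+ 2 * rho u = 0 ->
    rho u = 0 \/ m u ^+ 2 = M u ^+ 2 /\ m u = t * M u.
  move=> /eqP + /eqP; rewrite !mulf_eq0 !orbb; have [->|r0] := eqVneq (rho u) 0; first by left.
  rewrite !orbF !subr_eq0 => /eqP e1 /eqP e2; right; split => //.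
  by rewrite -e2 divfK// gt_eqF.
(* Otherwise the two relations contradict each other wherever rho is not 0, so rho would vanish
   almost everywhere, against its integral being 1. *)
have t2 : t ^+ 2 = 1.
  apply/eqP; apply/negP => /negP t2.
  have rho0 : {ae mu, forall u, rho u = 0}.
    apply: filterS2 ae1 ae2 => u h1 h2; have [//|[e1 e2]] := key u h1 h2.
    move: e1; rewrite e2 exprMn -[RHS]mul1r => /mulIf e1.
    by move: t2; rewrite e1 ?eqxx// sqrf_eq0 gt_eqF.
  have : (\int[mu]_u (rho u)%:E = \int[mu]_u 0)%E.
    apply: ae_eq_integral => //; first by case/integrableP: rho_int.
    by apply: filterS rho0 => u -> _.
  rewrite integral0 => e; move: rho1; rewrite /Rintegral e /= => /esym/eqP.
  by rewrite oner_eq0.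
have [t1|t1] : t = 1 \/ t = -1.
  by move/eqP: t2; rewrite sqrf_eq1 => /orP[] /eqP; [left|right].
- left; apply: filterS2 ae1 ae2 => u h1 h2; have [->|[_ ->]] := key u h1 h2; rewrite ?mul0r//.
  by rewrite t1 mul1r.
- right; apply: filterS2 ae1 ae2 => u h1 h2; have [->|[_ ->]] := key u h1 h2; rewrite ?mul0r//.
  by rewrite t1 mulN1r.
Qed.

(** [free_energyE_ge] with M = 0 and slope g = 1, the variance term being suppressed by the lower
    bound 0 for e. Letting delta tend to 0 leaves the mean of m^4, which vanishes only if m = 0
    where rho is not 0. *)
Lemma unique_up_to_sign_zero :
  (forall delta : R, 0 < delta -> exists e : Y -> R, [/\ bm e, bm (fun u => (e u)^-1), forall u, 0 < e u &
     forall u, b * K e u <= (1 + delta) * e u]) -> unique_up_to_sign (fun=> 0).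
Proof.
move=> He m mm m1.
have bm_ := bm_pm1 mm m1.
have b0 : bm (fun=> 0) by exact: (bmC mf).
have bm4 : bm (fun u => (m u ^+ 2) ^+ 2) by apply: (bmX mf); exact: (bmX mf).
have hh := bounded_measurable_neg_entropy mm m1.
have h0 : bm (fun u => neg_entropy 0) by exact: (bmC mf).
have m4 : 0 <= E (fun u => (m u ^+ 2) ^+ 2).
  by apply: (mean_ge0 mf) => // u; exact: sqr_ge0.
have H : F (fun=> 0) + E (fun u => (m u ^+ 2) ^+ 2) / 12 <= F m.
  apply/ler_addgt0Pr => delta delta0.
  have [e [be bei e0 he]] := He _ delta0.
  have := @free_energyE_ge R Y bm E mf k bmk bmK K_sym e (fun u => (e u)^-1) j0 0
    be bei e0 (fun=> erefl) (ltW j0_gt0) (lexx 0) kj0 (fun u => ltW (e0 u))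
    b delta 0 m (fun=> 0) (fun=> 1) b_ge0 bm_ b0 (bmC mf 1) hh h0.
  rewrite expr0n/= mulr0 mul0r mulr0 addr0.
  have -> : (fun u => (m u ^+ 2 - 0) ^+ 2) = (fun u => (m u ^+ 2) ^+ 2).
    by apply/funext => u; rewrite subr0.
  set x := F (fun=> 0); set y := E _; move=> H.
  have {}H : x + y / 12 - delta / 2 <= F m.
    apply: H.
    - by move=> u; rewrite mul0r.
    - move=> u; have := neg_entropy_ge (m1 u); rewrite subr0 neg_entropy0 add0r mulr1.
      by rewrite -exprM.
    - move=> u; rewrite subr0.
      apply: (linear_defect (m1 u) (ltW delta0)).
      by rewrite ler_pdivrMr// he.
  by rewrite -lerBlDr (le_trans _ H)// lerB// ler_pdivrMr// ler_peMr ?(ltW delta0)// ler1n.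
have {}H : F (fun=> 0) + E (fun u => (m u ^+ 2) ^+ 2) / 12 + 0 <= F m by rewrite addr0.
have [le0 eq0] := sandwich0 m4 (lexx 0) H; split => // /eq0[E0 _]; left.
have ae1 := @density_mean_eq0 _ Y R mu rho rho_ge0 rho_int _ bm4 (fun u => sqr_ge0 _) E0.
apply: filterS ae1 => u /eqP; rewrite mulf_eq0 !sqrf_eq0 mulr0 => /orP[/eqP->|/eqP->].
  by rewrite mulr0.
by rewrite mul0r.
Qed.

End magnetization.

(** * Minimizers on the torus *)

Lemma continuous_inv_pos {R : realType} {X : topologicalType} (e : X -> R) :
  continuous e -> (forall u, 0 < e u) -> continuous (fun u => (e u)^-1).
Proof.
move=> ce e0 u; have eu0 : e u != 0 by rewrite gt_eqF.
exact: (cvgV eu0 (ce u)).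
Qed.

Section magnetized_state.
Context {X : ptopologicalType} {R : realType}.
Variables (mu : probability (borel X) R) (rho : X -> R).
Hypothesis rho_ge0 : forall u, 0 <= rho u.
Hypothesis rho_int : mu.-integrable setT (fun u => (rho u)%:E).
Hypothesis rho1 : (\int[mu]_u rho u)%R = 1.
Local Notation E := (@density_mean _ (borel X) R mu rho).
Local Notation mf := (@density_mean_functional _ (borel X) R mu rho rho_ge0 rho_int rho1).

Let rho_meas : measurable_fun setT (rho : borel X -> R).
Proof. by have /integrableP[/measurable_EFinP] := rho_int. Qed.

Definition spin_component (phi : Pr R (X * spin)%type) (a : spin) (A : set (borel X)) : \bar R :=
  phi (A `*` [set a]).

Lemma magnetized_state (m : X -> R) : measurable_fun setT (m : borel X -> R) ->
  (forall u, -1 <= m u <= 1) ->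
  exists phi : Pr R (X * spin)%type, 
    @has_magnetization _ (borel X) R mu rho _ spin_component phi m /\
    (forall g : X * spin -> R, @bounded_measurable _ (borel (X * spin)%type) R g ->
       (\int[phi]_z (g z))%R =
         E (fun u => (g (u, ord0) + g (u, ord_max)) / 2 + m u * ((g (u, ord0) - g (u, ord_max)) / 2))).
Proof.
move=> mm m1.
have mbern a : measurable_fun setT (fun u : borel X => bern (m u) a).
  by apply: measurable_funM => //; apply: measurable_funD => //; exact: measurable_funM.
have bbern a : @bounded_measurable _ (borel X) R (fun u => bern (m u) a).
  split => //; exists 1 => u; rewrite ger0_norm ?bern_ge0//.
  have := m1 u; have := sgn_bound a; have [->|->] := spinP a; rewrite /bern ?sgn0 ?sgn_max; lra.
have [|||phi [hc hi]] := @spin_measure_exists R X mu (fun a u => bern (m u) a * rho u).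
- by move=> a u; rewrite mulr_ge0// bern_ge0.
- by move=> a; exact: measurable_funM.
- under eq_integral => u _.
    rewrite -mulrDl (_ : bern (m u) ord0 + bern (m u) ord_max = 1); last first.
      by rewrite /bern sgn0 sgn_max; lra.
    rewrite mul1r; over.
  rewrite -rho1 /Rintegral fineK//; exact: integrable_fin_num.
exists phi; split; first exact: hc.
move=> g bg; have [mg [C hC]] := bg; rewrite hi//.
have bga a : @bounded_measurable _ (borel X) R (fun u => g (u, a)).
  split; last by exists C.
  exact: (@measurableT_comp _ _ _ _ _ _ (g : borel (X * spin)%type -> R) setT
    (@with_spin X a) mg (measurable_with_spin a)).
have e a : (\int[mu]_u (g (u, a) * (bern (m u) a * rho u)))%R = E (fun u => g (u, a) * bern (m u) a).
  by rewrite /density_mean; congr (Rintegral _ _ _); apply/funext => u; rewrite mulrA.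
rewrite !e -(meanD mf); [|by apply: (bmM mf)..].
by congr E; apply/funext => u; rewrite /bern sgn0 sgn_max; field.
Qed.

End magnetized_state.

Section torus_minimizers.
Context {R : realType} {d : nat}.
Local Notation T := (torus R d).
Local Notation lam := (lambda R d).
Variables (J rho : T -> R) (b : R).
Hypothesis J_cont : continuous J.
Hypothesis J_sym : forall v, J (- v) = J v.
Hypothesis J_gt0 : forall v, 0 < J v.
Hypothesis b_ge0 : 0 <= b.
Hypothesis rho_ge0 : forall u, 0 <= rho u.
Hypothesis rho_int : lam.-integrable setT (fun u => (rho u)%:E).
Hypothesis rho1 : (\int[lam]_u rho u)%R = 1.
Local Notation E := (torus_mean rho).
Local Notation K := (kernel_op E (torus_kernel J)).
Local Notation mT := (fun m : T -> R => measurable_fun setT (m : borel T -> R)).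

Definition magnetized (phi : Pr R (T * spin)%type) (m : T -> R) : Prop :=
  @has_magnetization _ (borel T) R lam rho _ (@component R d) phi m.

Lemma magnetized_density (phi : Pr R (T * spin)%type) (m : T -> R) :
  mT m -> (forall u, -1 <= m u <= 1) -> magnetized phi m ->
  has_density rho phi (fun a u => bern (m u) a).
Proof.
move=> mm m1 hm.
have h := @magnetization_has_density _ (borel T) R lam rho rho_ge0 rho_int rho1
  _ (@component R d) phi m mm m1 hm.
(* Kernel conversion succeeds at once where the unifier unfolds the measurable
   structures of the torus. *)
exact_no_check h.
Qed.

Lemma magnetized_is_magnetization (phi : Pr R (T * spin)%type) (m : T -> R) :
  mT m -> (forall u, -1 <= m u <= 1) -> magnetized phi m -> is_magnetization rho phi m.
Proof.
move=> mm m1 hm; exists (fun a u => bern (m u) a); first exact: magnetized_density.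
exists set0; split => //; first by rewrite /density_measure integral_set0.
move=> u /=; apply; rewrite /bern sgn0 sgn_max; lra.
Qed.

Lemma comp_eqP (phi psi : Pr R (T * spin)%type) :
  @comp_eq _ (borel T) R _ (@component R d) phi psi <-> measure_eq phi psi.
Proof.
split; first exact: spin_measure_eq.
move=> h a A mA; apply: h; exact: measurable_spin_rect.
Qed.

Lemma torus_minimizerP (M : T -> R) (phip phim : Pr R (T * spin)%type) :
  mT M -> (forall u, -1 <= M u <= 1) ->
  @unique_up_to_sign _ (borel T) R lam rho (torus_kernel J) b M ->
  magnetized phip M -> magnetized phim (fun u => - M u) ->
  forall psi, minimizer J rho b psi <-> (measure_eq psi phip \/ measure_eq psi phim).
Proof.
move=> mM M1 uM hp hm psi.
have H := @minimizerP _ (borel T) R lam rho rho_ge0 rho_int rho1 (torus_kernel J) b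
  (kernel_bmT J_cont) (kernel_op_bmT J_cont rho_ge0 rho_int rho1) _ (@component R d)
  M phip phim mM M1 uM hp hm psi.
have {}H : minimizer J rho b psi <->
    @comp_eq _ (borel T) R _ (@component R d) psi phip \/
    @comp_eq _ (borel T) R _ (@component R d) psi phim.
  exact_no_check H.
rewrite H; split.
  by case=> h; [left|right]; apply: (proj1 (comp_eqP _ _)).
by case=> h; [left|right]; apply: (proj2 (comp_eqP _ _)).
Qed.

Let jmin : exists2 j0 : R, 0 < j0 & forall u v : T, j0 <= torus_kernel J u v.
Proof. by have [u0 hu0] := torus_min J_cont; exists (J u0) => // u v; exact: hu0. Qed.

Lemma torus_unique_positive (M : T -> R) : continuous M -> (forall u, 0 < M u < 1) ->
  (forall u, b * K M u = artanh (M u)) ->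
  @unique_up_to_sign _ (borel T) R lam rho (torus_kernel J) b M.
Proof.
move=> cM M01 eM; have [j0 j00 hj] := jmin.
have M0 u : 0 < M u by have /andP[] := M01 u.
have [u0 hu0] := torus_min cM.
exact: (@unique_up_to_sign_positive _ (borel T) R lam rho rho_ge0 rho_int rho1 (torus_kernel J) j0 b
  (kernel_bmT J_cont) (kernel_op_bmT J_cont rho_ge0 rho_int rho1)
  (torus_kernel_op_sym J_cont J_sym rho_ge0 rho_int rho1) j00 hj b_ge0 M (M u0)
  (continuous_bmT cM) (continuous_bmT (continuous_inv_pos cM M0)) M01 (M0 u0) hu0 eM).
Qed.

Lemma torus_unique_zero :
  (forall delta : R, 0 < delta -> exists e : T -> R, [/\ continuous e, forall u, 0 < e u &
     forall u, b * K e u <= (1 + delta) * e u]) ->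
  @unique_up_to_sign _ (borel T) R lam rho (torus_kernel J) b (fun=> 0).
Proof.
move=> He; have [j0 j00 hj] := jmin.
apply: (@unique_up_to_sign_zero _ (borel T) R lam rho rho_ge0 rho_int rho1 (torus_kernel J) j0 b
  (kernel_bmT J_cont) (kernel_op_bmT J_cont rho_ge0 rho_int rho1)
  (torus_kernel_op_sym J_cont J_sym rho_ge0 rho_int rho1) j00 hj b_ge0).
move=> delta /He[e [ce e0 he]]; exists e; split => //; first exact: continuous_bmT.
exact/continuous_bmT/continuous_inv_pos.
Qed.

(** The total masses of the first components are (1 + E M)/2 and (1 - E M)/2, and E M is at least
    the minimum of M, which is positive. *)
Lemma magnetized_neq (M : T -> R) (phip phim : Pr R (T * spin)%type) :
  continuous M -> (forall u, 0 < M u < 1) ->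
  magnetized phip M -> magnetized phim (fun u => - M u) -> ~ measure_eq phip phim.
Proof.
move=> cM M01 hp hm e.
have mf := torus_mean_functional rho_ge0 rho_int rho1.
have bM := continuous_bmT cM.
have M0 u : 0 < M u by have /andP[] := M01 u.
have mE (phi : Pr R (T * spin)%type) m : bmT m -> magnetized phi m ->
    component phi ord0 setT = (E (fun u => 2^-1 + 2^-1 * m u))%:E.
  move=> bm_ h; rewrite h//.
  have := @density_meanE _ (borel T) R lam rho rho_int (fun u => 2^-1 + 2^-1 * m u).
  rewrite -/(torus_mean rho _) => -> //; last first.
    by apply: (bmD mf); [exact: (bmC mf)|exact: (bmZ mf)].
  by apply: eq_integral => u _; congr EFin; rewrite /bern sgn0; field.
have bNM : bmT (fun u => - M u).
  by apply: continuous_bmT => u; exact: (cvgN (cM u)).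
have /comp_eqP/(_ ord0 setT measurableT) := e.
rewrite (mE _ _ bM hp) (mE _ _ bNM hm) => -[].
have Em m : bmT m -> E (fun u => 2^-1 + 2^-1 * m u) = 2^-1 + 2^-1 * E m.
  by move=> bm_; rewrite (meanD mf) ?(meanC mf) ?(meanZ mf)//; [exact: (bmC mf)|exact: (bmZ mf)].
rewrite !Em//.
have -> : E (fun u => - M u) = - E M.
  by rewrite -mulN1r -(meanZ mf)//; congr E; apply/funext => u; rewrite mulN1r.
have [u0 hu0] := torus_min cM.
have : M u0 <= E M.
  by rewrite -(meanC mf (M u0)); apply: (mean_le mf) => //; exact: (bmC mf).
by have := M0 u0; lra.
Qed.

End torus_minimizers.

(** * Near-minimizers on a finite set *)

Definition avg {R : realType} (X : finType) (f : X -> R) : R := #|X|%:R^-1 * \sum_x f x.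

Section average.
Context {R : realType} {X : finType}.
Hypothesis X0 : (0 < #|X|)%N.
Local Notation A := (@avg R X).
Let NR0 : 0 < #|X|%:R :> R. Proof. by rewrite ltr0n. Qed.

Lemma avg_mean_functional : mean_functional (fun _ : X -> R => True) A.
Proof.
split => //.
- by move=> f g _ _; rewrite /avg big_split/= mulrDr.
- by move=> c f _; rewrite /avg -mulr_sumr mulrCA.
- move=> f g _ _ fg; rewrite ler_wpM2l ?invr_ge0 ?(ltW NR0)//.
  by apply: ler_sum => x _.
- by rewrite /avg sumr_const mulVf// gt_eqF.
Qed.
Local Notation mf := avg_mean_functional.

Lemma avg_norm_le (f : X -> R) : `|A f| <= A (fun x => `|f x|).
Proof. exact: (mean_norm_le mf). Qed.

(** Cauchy-Schwarz, obtained from |f| <= f^2 / (2 k) + k / 2. *)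
Lemma avg_norm_of_sqr (f : X -> R) (k : R) : 0 < k -> A (fun x => f x ^+ 2) <= k ^+ 2 ->
  A (fun x => `|f x|) <= k.
Proof.
move=> k0 h.
apply: (@le_trans _ _ (A (fun x => (2 * k)^-1 * f x ^+ 2 + k / 2))).
  apply: (mean_le mf) => // x; rewrite -subr_ge0.
  rewrite (_ : _ - _ = (2 * k)^-1 * (`|f x| - k) ^+ 2).
    by rewrite mulr_ge0 ?sqr_ge0// invr_ge0 mulr_ge0// ltW.
  by rewrite -[f x ^+ 2]real_normK ?num_real//; field; rewrite gt_eqF.
rewrite (meanD mf)// (meanC mf) (meanZ mf)//.
apply: (@le_trans _ _ ((2 * k)^-1 * k ^+ 2 + k / 2)).
  by rewrite lerD2r ler_wpM2l// invr_ge0 mulr_ge0// ltW.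
by rewrite (_ : _ + _ = k)//; field; rewrite gt_eqF.
Qed.

(** Quantitative form of the equality case: a small variance of m/M makes m close to t M with t the
    mean of m/M, closeness of m^2 to M^2 forces t^2 close to 1, and s is the sign of t. *)
Lemma sign_selection (m M : X -> R) (c k : R) : 0 < c -> 0 < k ->
  (forall x, c <= M x <= 1) -> (forall x, -1 <= m x <= 1) ->
  A (fun x => (m x * (M x)^-1) ^+ 2) - A (fun x => m x * (M x)^-1) ^+ 2 <= k ^+ 2 ->
  A (fun x => (m x ^+ 2 - M x ^+ 2) ^+ 2) <= k ^+ 2 ->
  exists2 s : R, s = 1 \/ s = -1 &
    A (fun x => `|m x - s * M x|) <= k * (1 + (2 / c + 1) / c ^+ 2).
Proof.
move=> c0 k0 hM hm hV hA.
have M0 x : 0 < M x by have /andP[h _] := hM x; exact: lt_le_trans h.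
pose r x := m x * (M x)^-1; pose t := A r.
have mE x : m x = r x * M x by rewrite /r divfK// gt_eqF.
have Vt : A (fun x => (r x - t) ^+ 2) <= k ^+ 2 by rewrite (mean_variance mf).
have A1 : A (fun x => `|r x - t|) <= k by exact: avg_norm_of_sqr.
have A2 : A (fun x => `|m x ^+ 2 - M x ^+ 2|) <= k by exact: avg_norm_of_sqr.
have c1 : c <= 1.
  have /card_gt0P[x _] := X0; have /andP[h1 h2] := hM x; exact: le_trans h2.
have ci : 1 <= c^-1 by rewrite invf_ge1.
have rb x : `|r x| <= c^-1.
  have m1 : `|m x| <= 1 by rewrite ler_norml hm.
  rewrite /r normrM -[leRHS]mul1r ler_pM// normfV gtr0_norm// lef_pV2 ?posrE//.
  by have /andP[] := hM x.
have tb : `|t| <= c^-1.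
  apply: le_trans (avg_norm_le r) _; rewrite -(meanC mf c^-1).
  by apply: (mean_le mf).
have A3 : A (fun x => `|m x - t * M x|) <= k.
  apply: le_trans A1; apply: (mean_le mf) => // x.
  rewrite mE -mulrBl normrM (gtr0_norm (M0 x)) ler_piMr//.
  by have /andP[] := hM x.
(* From M^2 (t^2 - 1) = (t M + m)(t M - m) + (m^2 - M^2), where |t M + m| <= 2 / c. *)
have A4 : c ^+ 2 * `|t ^+ 2 - 1| <= (2 / c + 1) * k.
  rewrite -(meanC mf (c ^+ 2 * _)).
  apply: (@le_trans _ _ (A (fun x => 2 / c * `|m x - t * M x| + `|m x ^+ 2 - M x ^+ 2|))).
    apply: (mean_le mf) => // x.
    apply: (@le_trans _ _ (M x ^+ 2 * `|t ^+ 2 - 1|)).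
      rewrite ler_wpM2r// lerXn2r ?nnegrE ?(ltW c0) ?(ltW (M0 x))//.
      by have /andP[] := hM x.
    have -> : M x ^+ 2 * `|t ^+ 2 - 1| = `|M x ^+ 2 * (t ^+ 2 - 1)|.
      by rewrite normrM (ger0_norm (sqr_ge0 (M x))).
    rewrite (_ : M x ^+ 2 * _ = (t * M x + m x) * (t * M x - m x) + (m x ^+ 2 - M x ^+ 2)); last by ring.
    apply: (le_trans (ler_normD _ _)); rewrite lerD2r normrM distrC ler_wpM2r//.
    apply: (le_trans (ler_normD _ _)); rewrite (_ : 2 / c = c^-1 + c^-1); last by field; rewrite gt_eqF.
    apply: lerD; last by apply: (le_trans _ ci); rewrite ler_norml hm.
    rewrite normrM -[leRHS]mulr1 ler_pM// (gtr0_norm (M0 x)).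
    by have /andP[] := hM x.
  have -> : A (fun x => 2 / c * `|m x - t * M x| + `|m x ^+ 2 - M x ^+ 2|) =
      2 / c * A (fun x => `|m x - t * M x|) + A (fun x => `|m x ^+ 2 - M x ^+ 2|).
    by rewrite -(meanZ mf)// -(meanD mf).
  by rewrite [leRHS]mulrDl mul1r; apply: lerD => //; rewrite ler_wpM2l// divr_ge0// ltW.
(* The premise holds when s is the sign of t, because then |t + s| >= 1 in t^2 - 1 = (t - s)(t +
   s). *)
have key (s : R) : `|t - s| <= `|t ^+ 2 - 1| ->
    A (fun x => `|m x - s * M x|) <= k * (1 + (2 / c + 1) / c ^+ 2).
  move=> ts.
  apply: (@le_trans _ _ (A (fun x => `|m x - t * M x| + `|t - s|))).
    apply: (mean_le mf) => // x.
    rewrite (_ : m x - s * M x = m x - t * M x + (t - s) * M x); last by ring.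
    apply: (le_trans (ler_normD _ _)); rewrite lerD2l normrM (gtr0_norm (M0 x)) ler_piMr//.
    by have /andP[] := hM x.
  rewrite (meanD mf)// (meanC mf) mulrDr mulr1 lerD//.
  apply: (le_trans ts); rewrite mulrA ler_pdivlMr ?exprn_gt0//.
  by rewrite mulrC [k * _]mulrC.
have [t0|t0] := leP 0 t.
  exists 1; [by left|apply: key].
  rewrite (_ : t ^+ 2 - 1 = (t - 1) * (t + 1)); last by ring.
  rewrite normrM ler_peMr//.
  by rewrite ger0_norm; lra.
exists (-1); [by right|apply: key].
rewrite (_ : t ^+ 2 - 1 = (t - -1) * (t - 1)); last by ring.
rewrite normrM ler_peMr//.
by rewrite ler0_norm; lra.
Qed.

Variables (J : X -> X -> R) (b j0 : R).
Hypothesis J_sym : forall x y, J x y = J y x.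
Hypotheses (j0_gt0 : 0 < j0) (Jj0 : forall x y, j0 <= J x y) (b_ge0 : 0 <= b).
Local Notation K := (kernel_op A J).

Lemma free_energyX_avg (m : X -> R) : free_energyX J b m = free_energyE A J b m.
Proof.
rewrite /free_energyX /free_energyE /avg; congr (_ - _ * _).
rewrite expr2 -mulrA mulr_sumr; congr (_ * _); apply: eq_bigr => x _.
rewrite /kernel_op /avg !mulr_sumr.
by apply: eq_bigr => y _; ring.
Qed.

Let avg_K_sym (f g : X -> R) : True -> True -> A (fun u => f u * K g u) = A (fun u => g u * K f u).
Proof.
move=> _ _; rewrite /kernel_op /avg; congr (_ * _).
under eq_bigr do rewrite mulrCA mulr_sumr.
under [RHS]eq_bigr do rewrite mulrCA mulr_sumr.
rewrite -!mulr_sumr; congr (_ * _); rewrite exchange_big/=.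
by apply: eq_bigr => x _; apply: eq_bigr => y _; rewrite J_sym; ring.
Qed.

(** On the sites M solves the mean field equation only up to an error. It is measured in units of c,
    since it gets divided by M >= c, and dl then plays delta in [free_energyE_ge]. The lower bound
    b1 keeps the variance estimate uniform while b varies with n. *)
Lemma near_minimizer_positive (m M : X -> R) (c b1 eta dl k : R) :
  0 < c -> 0 < b1 -> b1 <= b -> 0 < k ->
  (forall x, c <= M x) -> (forall x, M x < 1) -> (forall x, -1 <= m x <= 1) ->
  (forall x, `|b * K M x - artanh (M x)| <= c * dl) ->
  12 * (eta + dl) <= k ^+ 2 -> 2 * (eta + dl) <= k ^+ 2 * (b1 * (j0 * c ^+ 2)) ->
  free_energyX J b m <= free_energyX J b M + eta ->
  exists2 s : R, s = 1 \/ s = -1 &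
    A (fun x => `|m x - s * M x|) <= k * (1 + (2 / c + 1) / c ^+ 2).
Proof.
move=> c0 b10 b1b k0 cM M1 m1 hK h1 h2.
have M0 x : 0 < M x by exact: lt_le_trans (cM x).
rewrite !free_energyX_avg => hF.
have := @free_energyE_ge R X (fun _ => True) A mf J (fun=> I) (fun _ _ => I) avg_K_sym
  M (fun x => (M x)^-1) j0 c I I M0 (fun=> erefl) (ltW j0_gt0) (ltW c0) Jj0 cM b dl 1 m M
  (fun x => artanh (M x) * (M x)^-1) b_ge0 I I I I I.
set F0 := free_energyE _ _ _ _ in hF *; set F1 := free_energyE _ _ _ _ in hF *.
set a := A (fun u => _ ^+ 2); set V := A _ - _ ^+ 2.
have V0 : 0 <= V by rewrite /V -(mean_variance mf)// (mean_ge0 mf)// => x; exact: sqr_ge0.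
have a0 : 0 <= a by apply: (mean_ge0 mf) => // x; exact: sqr_ge0.
have d0 : 0 <= dl.
  have /card_gt0P[x _] := X0; have := le_trans (normr_ge0 _) (hK x).
  by rewrite pmulr_rge0.
move=> H; have {}H : F1 + a / 12 + b / 2 * (j0 * c ^+ 2 * V) - dl / 2 <= F0.
  apply: H.
  - by move=> x; rewrite mul1r.
  - by move=> x; rewrite neg_entropy_tangent ?M0 ?M1.
  - move=> x; rewrite -mulrBl mulrA mulrAC; apply: lerNnormlW.
    rewrite !normrM normfV (gtr0_norm (M0 x)).
    apply: (@le_trans _ _ (1 * ((c * dl) / M x))).
      rewrite -mulrA ler_pM// ?mulr_ge0// ?invr_ge0 ?(ltW (M0 x))//.
        have := m1 x; have := M0 x; have := M1 x; move: (m x) (M x) => p q ? ? /andP[? ?].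
        by rewrite ler_norml; apply/andP; split; nra.
      by rewrite [leLHS]mulrC ler_wpM2r ?invr_ge0 ?(ltW (M0 x))// distrC.
    by rewrite mul1r ler_pdivrMr// mulrC ler_wpM2l.
have W0 : 0 <= b / 2 * (j0 * c ^+ 2 * V).
  by rewrite mulr_ge0 ?divr_ge0// mulr_ge0// mulr_ge0 ?(ltW j0_gt0)// sqr_ge0.
apply: sign_selection => //.
- by move=> x; rewrite cM ltW.
- have jc : 0 < j0 * c ^+ 2 by rewrite mulr_gt0// exprn_gt0.
  have b1jc : 0 < b1 * (j0 * c ^+ 2) by rewrite mulr_gt0.
  rewrite -(ler_pM2r b1jc); apply: le_trans h2; rewrite -/V.
  have : V * (b1 * (j0 * c ^+ 2)) <= b * (j0 * c ^+ 2 * V).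
    rewrite (_ : V * _ = b1 * (j0 * c ^+ 2 * V)); last by ring.
    by apply: ler_wpM2r => //; rewrite mulr_ge0// ltW.
  by move: H hF W0 a0 d0; set z := j0 * c ^+ 2 * V; set y := V * _; lra.
- by apply: le_trans h1; rewrite -/a; lra.
Qed.

(** The comparison bounds the mean of m^4. Two applications of [avg_norm_of_sqr] lead from m^4 to
    m^2 and from m^2 to |m|, whence the fourth power of k. *)
Lemma near_minimizer_zero (m e : X -> R) (c eta dl k : R) : 0 < k -> 0 < c ->
  0 <= dl -> (forall x, c <= e x) -> (forall x, -1 <= m x <= 1) ->
  (forall x, b * K e x <= (1 + dl) * e x) ->
  12 * (eta + dl) <= (k ^+ 2) ^+ 2 ->
  free_energyX J b m <= free_energyX J b (fun=> 0) + eta ->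
  A (fun x => `|m x|) <= k.
Proof.
move=> k0 c0 d0 ce m1 hK h1.
have e0 x : 0 < e x by exact: lt_le_trans (ce x).
rewrite !free_energyX_avg => hF.
have := @free_energyE_ge R X (fun _ => True) A mf J (fun=> I) (fun _ _ => I) avg_K_sym
  e (fun x => (e x)^-1) j0 0 I I e0 (fun=> erefl) (ltW j0_gt0) (lexx 0) Jj0 (fun x => ltW (e0 x)) b dl 0 m (fun=> 0)
  (fun=> 1) b_ge0 I I I I I.
rewrite expr0n/= mulr0 mul0r mulr0 addr0.
have -> : (fun u => (m u ^+ 2 - 0) ^+ 2) = (fun u => (m u ^+ 2) ^+ 2).
  by apply/funext => u; rewrite subr0.
set F1 := free_energyE _ _ _ m in hF *; set F0 := free_energyE _ _ _ _ in hF *.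
set a := A (fun u => _ ^+ 2) => H.
have {}H : F0 + a / 12 - dl / 2 <= F1.
  apply: H.
  - by move=> u; rewrite mul0r.
  - move=> u; have := neg_entropy_ge (m1 u); rewrite subr0 neg_entropy0 add0r mulr1.
    by rewrite -exprM.
  - move=> u; rewrite subr0; apply: (linear_defect (m1 u) d0).
    by rewrite ler_pdivrMr// hK.
apply: avg_norm_of_sqr => //.
have -> : A (fun x => m x ^+ 2) = A (fun x => `|m x ^+ 2|).
  by congr A; apply/funext => x; rewrite ger0_norm// sqr_ge0.
apply: avg_norm_of_sqr; first by rewrite exprn_gt0.
by apply: le_trans h1; rewrite -/a; lra.
Qed.

End average.

(** * Integrals with respect to Gibbs and empirical measures *)

Section integral_wdirac.
Context d (T : measurableType d) (R : realType).
Variables (I : finType) (w : I -> {nonneg R}) (p : I -> T).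

Lemma ge0_integral_wdirac (f : T -> \bar R) : measurable_fun setT f -> (forall x, 0 <= f x)%E ->
  (\int[wdirac w p]_x f x = \sum_i (w i)%:num%:E * f (p i))%E.
Proof.
move=> mf f0.
(* [msum] is indexed by natural numbers: the index type is enumerated, and indices beyond its
   cardinality get the zero measure. *)
pose m_ (k : nat) : {measure set T -> \bar R} :=
  if insub k is Some j then mscale (w (enum_val (j : 'I_#|I|))) (dirac (p (enum_val j)))
  else mzero.
have mE (j : 'I_#|I|) : m_ j = mscale (w (enum_val j)) (dirac (p (enum_val j))) :> (set T -> \bar R).
  by rewrite /m_ valK.
rewrite (eq_measure_integral (msum m_ #|I|)) => [|A mA _]; last first.
  transitivity (\sum_i (w i)%:num%:E * \d_(p i) A)%E; first by [].
  transitivity (\sum_(k < #|I|) m_ k A)%E; last by [].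
  rewrite (reindex (@enum_val I (mem I)))/=; last first.
    by exists (@enum_rank I) => i _; [exact: enum_valK|exact: enum_rankK].
  by apply: eq_bigr => j _; rewrite mE.
rewrite ge0_integral_measure_sum//= [RHS](reindex (@enum_val I (mem I)))/=; last first.
  by exists (@enum_rank I) => i _; [exact: enum_valK|exact: enum_rankK].
apply: eq_bigr => j _.
rewrite (eq_measure_integral (mscale (w (enum_val j)) (dirac (p (enum_val j))))) => [|A mA _]; last first.
  by rewrite mE.
by rewrite ge0_integral_mscale// integral_dirac// diracT mul1e.
Qed.

Lemma Rintegral_wdirac (f : T -> R) : measurable_fun setT f ->
  (\int[wdirac w p]_x f x)%R = \sum_i (w i)%:num * f (p i).
Proof.
move=> mf; have mE : measurable_fun setT (EFin \o f) by exact/measurable_EFinP.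
rewrite /Rintegral integralE.
rewrite ge0_integral_wdirac; [|exact: measurable_funepos|by move=> x; exact: funepos_ge0].
rewrite ge0_integral_wdirac; [|exact: measurable_funeneg|by move=> x; exact: funeneg_ge0].
have ep i : ((w i)%:num%:E * (EFin \o f)^\+ (p i) = ((w i)%:num * Num.max (f (p i)) 0)%:E)%E.
  by rewrite funepos.unlock/= -EFin_max -EFinM.
have en i : ((w i)%:num%:E * (EFin \o f)^\- (p i) = ((w i)%:num * Num.max (- f (p i)) 0)%:E)%E.
  by rewrite funeneg.unlock/= -EFin_max -EFinM.
rewrite (eq_bigr _ (fun i _ => ep i)) [X in (_ - X)%E](eq_bigr _ (fun i _ => en i)) !sumEFin -EFinB/=.
rewrite -sumrB; apply: eq_bigr => i _; rewrite -mulrBr; congr (_ * _).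
by rewrite !maxEle; do 2 case: ifP; lra.
Qed.

End integral_wdirac.

Lemma Rintegral_mnormalize_wdirac d (T : measurableType d) (R : realType) (I : finType)
    (w : I -> {nonneg R}) (p : I -> T) (Q : probability T R) (f : T -> R) : measurable_fun setT f ->
  0 < \sum_i (w i)%:num ->
  (\int[mnormalize (wdirac w p) Q]_x f x)%R =
    (\sum_i (w i)%:num)^-1 * \sum_i (w i)%:num * f (p i).
Proof.
move=> mf w0; set W := \sum_i _ in w0 *.
have wT : wdirac w p setT = W%:E.
  by rewrite /wdirac/= -sumEFin; apply: eq_bigr => i _; rewrite diracT mule1.
have W0 i : 0 <= W^-1 * (w i)%:num by rewrite mulr_ge0// invr_ge0 ltW.
pose w' := fun i : I => NngNum (W0 i).
have -> : (\int[mnormalize (wdirac w p) Q]_x f x)%R = (\int[wdirac w' p]_x f x)%R.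
  rewrite /Rintegral; congr fine; apply: eq_measure_integral => A mA _.
  rewrite /= /mnormalize [_ setT]wT/= eqe (gt_eqF w0)/= /wdirac ge0_sume_distrl => [|i _]; last first.
    by rewrite mule_ge0.
  by apply: eq_bigr => i _; rewrite muleC muleA -EFinM.
rewrite Rintegral_wdirac// mulr_sumr; apply: eq_bigr => i _.
by rewrite /= mulrA.
Qed.

Lemma Rintegral_dirac d (T : measurableType d) (R : realType) (x : T) (f : T -> R) :
  measurable_fun setT f -> (\int[dirac x]_u f u)%R = f x.
Proof.
move=> mf; rewrite /Rintegral integral_dirac//; last exact/measurable_EFinP.
by rewrite diracT mul1e.
Qed.

Lemma Rintegral_half_mix d (T : measurableType d) (R : realType) (x y : T) (f : T -> R) :
  measurable_fun setT f ->
  (\int[half_mix (dirac x) (dirac y)]_u f u)%R = (f x + f y) / 2.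
Proof.
move=> mf.
have h0 : 0 <= 2^-1 :> R by rewrite invr_ge0.
pose w := fun _ : bool => NngNum h0.
have -> : (\int[half_mix (dirac x) (dirac y)]_u f u)%R =
    (\int[wdirac w (fun b => if b then x else y)]_u f u)%R.
  rewrite /Rintegral; congr fine; apply: eq_measure_integral => A mA _.
  transitivity ((2^-1 : R)%:E * ((\d_x A : \bar R) + \d_y A))%E.
    by congr (_ * _)%E; exact: measure_addE.
  transitivity (\sum_(c : bool) (w c)%:num%:E * (\d_(if c then x else y) A : \bar R))%E; last by [].
  rewrite big_bool/= -muleDr//.
by rewrite Rintegral_wdirac// big_bool/= -mulrDr mulrC.
Qed.

Lemma Rintegral_distribution d (T : measurableType d) d' (T' : measurableType d') (R : realType)
    (P : probability T R) (X : {RV P >-> T'}) (f : T' -> R) : measurable_fun setT f ->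
  (exists C, forall x, `|f x| <= C) ->
  (\int[distribution P X]_y f y)%R = (\int[P]_x f (X x))%R.
Proof.
move=> mf [C hC]; rewrite /Rintegral integral_distribution//; first exact/measurable_EFinP.
apply: measurable_bounded_integrable => //.
- by rewrite (le_lt_trans (probability_le1 _ _))// ltry.
- exact: (measurableT_comp mf).
- exists C; split; first by rewrite num_real.
  by move=> z Cz u _ /=; rewrite (le_trans (hC _))// ltW.
Qed.

Lemma Rintegral_delta (R : realType) (X : ptopologicalType) (x : X) (f : X -> R) : continuous f ->
  (\int[delta R x]_u f u)%R = f x.
Proof. by move=> cf; apply: (@Rintegral_dirac _ (borel X)); exact: continuous_borel_realfun. Qed.

Section gibbs_integral.
Context (R : realType) (d n : nat) (L : {set dtorus d n}).
Local Notation T := (torus R d).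
Local Notation pt := (fun x : site L => site_pt R (val x)).

Definition site_kernel (J : T -> R) (x y : site L) : R := J (pt x - pt y).

Lemma hamiltonianE (J : T -> R) (beta : R) (s : config L) :
  expR (- beta * hamiltonian J s) = weightX (site_kernel J) beta (s : {ffun site L -> spin}).
Proof.
by rewrite /weightX /hamiltonian mulrNN card_sig.
Qed.

Definition gibbs_weight (J : T -> R) (beta : R) (s : {ffun site L -> spin}) : R :=
  (\sum_(t : {ffun site L -> spin}) weightX (site_kernel J) beta t)^-1 *
   weightX (site_kernel J) beta s.

Lemma partition_gt0 (J : T -> R) (beta : R) :
  0 < \sum_(t : {ffun site L -> spin}) weightX (site_kernel J) beta t.
Proof.
rewrite (bigD1 [ffun=> ord0])//= ltr_pwDl ?expR_gt0// sumr_ge0// => s _; exact: expR_ge0.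
Qed.

Lemma Rintegral_gibbs (J : T -> R) (beta : R) (f : config L -> R) :
  (\int[gibbs J beta L]_s f s)%R = \sum_(s : {ffun site L -> spin}) gibbs_weight J beta s * f s.
Proof.
rewrite [LHS]Rintegral_mnormalize_wdirac//=; last first.
  under eq_bigr do rewrite hamiltonianE; exact: partition_gt0.
rewrite mulr_sumr /gibbs_weight.
under eq_bigr do rewrite hamiltonianE.
under [in RHS]eq_bigr do rewrite -mulrA.
by apply: eq_bigr => s _; rewrite hamiltonianE.
Qed.

Lemma Rintegral_empirical_law (J : T -> R) (beta : R) (f : Pr R (T * spin)%type -> R) :
  continuous f -> bounded_fun f ->
  (\int[empirical_law J beta L]_phi f phi)%R =
    \sum_(s : {ffun site L -> spin}) gibbs_weight J beta s * f (empirical R (s : config L)).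
Proof.
move=> cf [C [_ hC]].
rewrite -Rintegral_gibbs; apply: Rintegral_distribution.
  exact: continuous_borel_realfun.
by exists (C + 1) => x; apply: hC => //; rewrite ltrDl.
Qed.

Lemma Rintegral_empirical (s : config L) (g : T * spin -> R) : L != finset.set0 -> continuous g ->
  (\int[empirical R s]_z g z)%R = #|site L|%:R^-1 * \sum_(x : site L) g (pt x, s x).
Proof.
move=> L0 cg.
have -> : (\int[empirical R s]_z g z)%R = (\int[wdirac (fun _ : site L => (#|L|%:R^-1)%:nng)
    (fun x => (pt x, s x) : borel (T * spin)%type)]_z g z)%R.
  rewrite /Rintegral; congr fine; apply: eq_measure_integral => A mA _.
  exact: (congr1 (fun h => h A) (@empiricalE R d n L s L0)).
rewrite Rintegral_wdirac/=; last exact: continuous_borel_realfun.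
by rewrite -mulr_sumr card_sig.
Qed.

End gibbs_integral.

(** * Site averages *)

Lemma continuous_funM {R : realType} {X : topologicalType} (f g : X -> R) :
  continuous f -> continuous g -> continuous (fun u => f u * g u).
Proof. by move=> cf cg u; exact: cvgM (cf u) (cg u). Qed.

Section site_average.
Context (R : realType) (d : nat).
Local Notation T := (torus R d).
Local Notation lam := (lambda R d).
Variables (L : forall n, {set dtorus d n}) (rho : T -> R).
Hypothesis d_gt0 : (0 < d)%N.
Hypothesis rho_ge0 : forall u, 0 <= rho u.
Hypothesis rho_int : lam.-integrable setT (fun u => (rho u)%:E).
Hypothesis L_rho : cvg_density L rho.
Hypothesis N_gt0 : 0 < (\int[lam]_u rho u)%R.

Local Notation N := (\int[lam]_u rho u)%R.
Local Notation rhot := (fun u : T => N^-1 * rho u).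
Local Notation pt n := (fun x : site (L n) => site_pt R (val x)).

Lemma normalized_ge0 u : 0 <= rhot u.
Proof. by rewrite mulr_ge0// invr_ge0 ltW. Qed.

Lemma normalized_integrable : lam.-integrable setT (fun u => (rhot u)%:E).
Proof. exact: (@integrableZl _ (borel T) R lam setT measurableT N^-1 (fun u => (rho u)%:E) rho_int). Qed.

Lemma normalized_mean (f : T -> R) : bmT f -> torus_mean rhot f = N^-1 * (\int[lam]_u (f u * rho u))%R.
Proof.
move=> bf; rewrite /torus_mean /density_mean.
have i := @integrable_density _ (borel T) R lam rho rho_int f bf.
rewrite -(@RintegralZl _ (borel T) R lam setT (fun u => f u * rho u) N^-1 measurableT i).
by congr (Rintegral _ _ _); apply/funext => u; ring.
Qed.

Lemma normalized_integral : (\int[lam]_u rhot u)%R = 1.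
Proof.
rewrite (@RintegralZl _ (borel T) R lam setT rho N^-1 measurableT rho_int).
by rewrite mulVf// gt_eqF.
Qed.

Let continuous_bounded (f : T -> R) : continuous f -> bounded_fun f.
Proof.
move=> /torus_bounded[C _ hC]; exists C; split; first by rewrite num_real.
by move=> x Cx u _ /=; rewrite (le_trans (hC _))// ltW.
Qed.

Lemma site_sum_cvg (f : T -> R) : continuous f ->
  (n ^ d)%:R^-1 * (\sum_(x : site (L n)) f (site_pt R (val x))) @[n --> \oo] -->
    (\int[lam]_u (f u * rho u))%R.
Proof.
move=> cf; have := L_rho cf (continuous_bounded cf).
apply: cvg_trans; apply: near_eq_cvg; apply: nearW => n.
rewrite Rintegral_wdirac/=; last exact: continuous_borel_realfun.
by rewrite -mulr_sumr.
Qed.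

Let site_density_cvg : (n ^ d)%:R^-1 * (#|site (L n)|%:R : R) @[n --> \oo] --> N.
Proof.
have := @site_sum_cvg (fun=> 1) (@cst_continuous _ _ _).
under eq_fun do rewrite sumr_const.
by under [X in _ --> X -> _]eq_Rintegral do rewrite mul1r.
Qed.

(** The test function 1 shows that the number of sites is eventually at least (N/2) n^d, hence at
    least (N/2) n because d > 0. *)
Lemma site_card_near (A : R) : \forall n \near \oo, A <= #|site (L n)|%:R.
Proof.
have N20 : N / 2 < N by rewrite ltr_pdivrMr// ltr_pMr// ltr1n.
have N0 : 0 < N / 2 by rewrite divr_gt0.
near=> n.
have n0 : (0 < n)%N by near: n; exact: nbhs_infty_gt.
have h1 : N / 2 <= (n ^ d)%:R^-1 * (#|site (L n)|%:R : R).
  by near: n; apply: cvgr_ge site_density_cvg _ N20.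
have nd : 0 < (n ^ d)%:R :> R by rewrite ltr0n expn_gt0 n0.
have h2 : N / 2 * n%:R <= #|site (L n)|%:R.
  rewrite ler_pdivlMl// in h1; apply: le_trans h1.
  rewrite [leLHS]mulrC; apply: ler_wpM2r; first exact: ltW.
  by rewrite ler_nat -[leqLHS]expn1 leq_pexp2l.
apply: le_trans h2; rewrite mulrC -ler_pdivrMr//.
by near: n; exact: nbhs_infty_ger.
Unshelve. all: by end_near. Qed.

Lemma site_near : \forall n \near \oo, (0 < #|site (L n)|)%N.
Proof. by apply: filterS (site_card_near 1) => n; rewrite ler1n. Qed.

Lemma site_avg_cvg (f : T -> R) : continuous f ->
  avg (fun x : site (L n) => f (site_pt R (val x))) @[n --> \oo] --> torus_mean rhot f.
Proof.
move=> cf; rewrite normalized_mean; last exact: continuous_bmT.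
have Nn0 : N != 0 by rewrite gt_eqF.
have c : ((n ^ d)%:R^-1 * #|site (L n)|%:R)^-1 *
    ((n ^ d)%:R^-1 * (\sum_(x : site (L n)) f (site_pt R (val x)))) @[n --> \oo] -->
    N^-1 * (\int[lam]_u (f u * rho u))%R.
  by apply: cvgM; [exact: cvgV Nn0 site_density_cvg|exact: site_sum_cvg].
apply: cvg_trans c; apply: near_eq_cvg; near=> n.
have n0 : (0 < n)%N by near: n; exact: nbhs_infty_gt.
have nd : (n ^ d)%:R != 0 :> R by rewrite pnatr_eq0 -lt0n expn_gt0 n0.
have L0 : (0 < #|site (L n)|)%N by near: n; exact: site_near.
have c0 : #|site (L n)|%:R != 0 :> R by rewrite pnatr_eq0 -lt0n.
by rewrite /avg /=; field; rewrite nd c0.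
Unshelve. all: by end_near. Qed.

(** Weak convergence gives the limit for each fixed u. It becomes uniform by using it at one point
    of each of finitely many boxes and moving u to that point by the uniform continuity of J. *)
Lemma site_kernel_cvg (J f : T -> R) (e : R) : continuous J -> (forall v, J (- v) = J v) ->
  continuous f -> 0 < e ->
  \forall n \near \oo, forall u : T,
    `|avg (fun x : site (L n) => J (u - site_pt R (val x)) * f (site_pt R (val x)))
      - kernel_op (torus_mean rhot) (torus_kernel J) f u| <= e.
Proof.
move=> cJ J_sym cf e0.
have mf := torus_mean_functional normalized_ge0 normalized_integrable normalized_integral.
have [C C0 hC] := torus_bounded cf.
have e1 : 0 < e / (3 * (C + 1)) by rewrite divr_gt0// mulr_gt0// ltr_wpDl.
have e3 : 0 < e / 3 by rewrite divr_gt0.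
have [k _ /(_ k (leqnn k)) hk] := color_continuous cJ e1.
(* A colour without points would get the default 0; the estimates only pass through
   [rep (color k u)], which has the colour of u. *)
pose rep (i : {ffun 'I_d -> 'I_k.+1}) : T := xget 0 [set u | color k u = i].
have rep_color (u : T) : color k (rep (color k u)) = color k u.
  by rewrite /rep; exact: (xgetPex 0 (P := [set v | color k v = color k u]) (ex_intro _ u erefl)).
pose Kn n (u : T) := avg (fun x : site (L n) => J (u - site_pt R (val x)) * f (site_pt R (val x))).
pose K (u : T) := kernel_op (torus_mean rhot) (torus_kernel J) f u.
have pointwise (u : T) : Kn n u @[n --> \oo] --> K u.
  have c : continuous (fun v => torus_kernel J u v * f v).
    exact: continuous_funM (@torus_kernel_continuous R d J cJ u) cf.
  exact: (site_avg_cvg c).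
have reps : \forall n \near \oo, forall i, `|Kn n (rep i) - K (rep i)| <= e / 3.
  apply: filter_forall => i; have /cvgrPdist_le/(_ _ e3) := pointwise (rep i).
  by apply: filterS => n; rewrite distrC.
have Jd (u v : T) : `|J (u - v) - J (rep (color k u) - v)| <= e / (3 * (C + 1)).
  by apply: hk; rewrite rep_color.
have Jfd (u v : T) : `|J (u - v) * f v - J (rep (color k u) - v) * f v| <= e / 3.
  rewrite -mulrBl normrM; apply: (@le_trans _ _ (e / (3 * (C + 1)) * (C + 1))).
    by apply: ler_pM => //; rewrite (le_trans (hC v))// lerDl.
  by rewrite le_eqVlt; apply/orP; left; apply/eqP; field; rewrite gt_eqF// ltr_wpDl.
have bf := continuous_bmT cf.
have bJ (u : T) : bmT (fun v => J (u - v) * f v).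
  by apply: (bmM mf) => //; exact: (kernel_bmT cJ u).
have Kd (u : T) : `|K u - K (rep (color k u))| <= e / 3.
  rewrite /K /kernel_op /torus_kernel -(meanB mf)//.
  have bd : bmT (fun v => J (u - v) * f v - J (rep (color k u) - v) * f v) by exact: (bmB mf).
  apply: le_trans (mean_norm_le mf bd (@bounded_measurable_norm _ (borel T) R _ bd)) _.
  rewrite -(meanC mf (e / 3)); apply: (mean_le mf) => //.
    exact: (@bounded_measurable_norm _ (borel T) R _ bd).
  exact: (bmC mf).
near=> n => u; rewrite -/(Kn n u) -/(K u).
have L0 : (0 < #|site (L n)|)%N by near: n; exact: site_near.
have mfn := @avg_mean_functional R _ L0.
have Knd : `|Kn n u - Kn n (rep (color k u))| <= e / 3.
  rewrite /Kn -(meanB mfn)//; apply: le_trans (mean_norm_le mfn I I) _.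
  by rewrite -(meanC mfn (e / 3)); apply: (mean_le mfn).
have h3 : `|Kn n (rep (color k u)) - K (rep (color k u))| <= e / 3.
  by move: (color k u); near: n.
have -> : Kn n u - K u = (Kn n u - Kn n (rep (color k u))) +
   ((Kn n (rep (color k u)) - K (rep (color k u))) - (K u - K (rep (color k u)))) by ring.
apply: le_trans (ler_normD _ _) _.
have := ler_normB (Kn n (rep (color k u)) - K (rep (color k u))) (K u - K (rep (color k u))).
move: Knd h3 (Kd u); set a := `|_|; set b := `|_|; set c := `|_|; set z := `|_|; lra.
Unshelve. all: by end_near. Qed.

End site_average.

(** * Stability of near-minimizers, uniformly in n *)

Section near_minimizers.
Context (R : realType) (d : nat).
Local Notation T := (torus R d).
Local Notation lam := (lambda R d).
Variables (L : forall n, {set dtorus d n}) (rho : T -> R).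
Hypothesis d_gt0 : (0 < d)%N.
Hypothesis rho_ge0 : forall u, 0 <= rho u.
Hypothesis rho_int : lam.-integrable setT (fun u => (rho u)%:E).
Hypothesis L_rho : cvg_density L rho.
Hypothesis N_gt0 : 0 < (\int[lam]_u rho u)%R.

Local Notation N := (\int[lam]_u rho u)%R.
Local Notation rhot := (fun u : T => N^-1 * rho u).

Variables (J : T -> R) (beta_ : nat -> R) (beta : R).
Hypothesis J_cont : continuous J.
Hypothesis J_gt0 : forall v, 0 < J v.
Hypothesis J_sym : forall v, J (- v) = J v.
Hypothesis beta_n_ge0 : forall n, 0 <= beta_ n.
Hypothesis beta_ge0 : 0 <= beta.
Hypothesis beta_cvg : beta_ n @[n --> \oo] --> beta.

Local Notation K := (kernel_op (torus_mean rhot) (torus_kernel J)).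
Local Notation rt0 := (normalized_ge0 rho_ge0 N_gt0).
Local Notation rti := (normalized_integrable rho_int).
Local Notation rt1 := (normalized_integral rho_int N_gt0).

(** Stability of M and -M in the mean absolute distance, with eta independent of n; the sign may
    depend on m. For M = 0 it expresses closeness to 0. *)
Definition near_minimizers (M : T -> R) : Prop := forall kappa : R, 0 < kappa ->
  exists2 eta : R, 0 < eta & \forall n \near \oo, forall m : site (L n) -> R,
    (forall x, -1 <= m x <= 1) ->
    free_energyX (@site_kernel R d n (L n) J) (beta_ n) m <=
      free_energyX (@site_kernel R d n (L n) J) (beta_ n) (fun x => M (site_pt R (val x))) + eta ->
    exists2 s : R, s = 1 \/ s = -1 &
      avg (fun x => `|m x - s * M (site_pt R (val x))|) <= kappa.

Lemma beta_kernel_cvg (f : T -> R) (e : R) : continuous f -> 0 < e ->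
  \forall n \near \oo, forall x : site (L n),
    `|beta_ n * kernel_op (@avg R (site (L n))) (@site_kernel R d n (L n) J)
         (fun y => f (site_pt R (val y))) x - beta * K f (site_pt R (val x))| <= e.
Proof.
move=> cf e0.
have cK := @kernel_op_continuous R d J J_cont rhot rt0 rti rt1 f (continuous_bmT cf).
have [C C0 hC] := torus_bounded cK.
have b1 : 0 < beta + 1 by rewrite ltr_wpDl.
have e1 : 0 < e / (2 * (beta + 1)) by rewrite divr_gt0// mulr_gt0.
have C1 : 0 < C + 1 by rewrite ltr_wpDl.
have e2 : 0 < e / (2 * (C + 1)) by rewrite divr_gt0// mulr_gt0.
have hb : \forall n \near \oo, `|beta - beta_ n| <= e / (2 * (C + 1)).
  by have /cvgrPdist_le/(_ _ e2) := beta_cvg.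
have hk := site_kernel_cvg d_gt0 rho_ge0 rho_int L_rho N_gt0 J_cont J_sym cf e1.
apply: filter_app hk; near=> n => hk x.
set Kn := kernel_op _ _ _ x; set Kx := K f _.
have h1 : `|Kn - Kx| <= e / (2 * (beta + 1)) by exact: hk.
have h2 : `|beta - beta_ n| <= e / (2 * (C + 1)).
  by near: n.
have h3 : `|Kx| <= C + 1 by rewrite (le_trans (hC _))// lerDl.
have h4 : `|beta_ n| <= beta + 1.
  rewrite ger0_norm//; near: n; apply: (cvgr_le _ beta_cvg); by rewrite ltrDl.
rewrite (_ : beta_ n * Kn - beta * Kx = beta_ n * (Kn - Kx) - (beta - beta_ n) * Kx); last by ring.
apply: (le_trans (ler_normB _ _)); rewrite !normrM [leRHS]splitr; apply: lerD.
  apply: (@le_trans _ _ ((beta + 1) * (e / (2 * (beta + 1))))); first exact: ler_pM.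
  by rewrite le_eqVlt; apply/orP; left; apply/eqP; field; rewrite gt_eqF.
apply: (@le_trans _ _ (e / (2 * (C + 1)) * (C + 1))); first exact: ler_pM.
by rewrite le_eqVlt; apply/orP; left; apply/eqP; field; rewrite gt_eqF.
Unshelve. all: by end_near. Qed.

Let site_kernel_sym n x y : @site_kernel R d n (L n) J x y = @site_kernel R d n (L n) J y x.
Proof. by rewrite /site_kernel -J_sym opprB. Qed.

Lemma near_minimizers_positive (M : T -> R) : continuous M -> (forall u, 0 < M u < 1) ->
  (forall u, beta * K M u = artanh (M u)) -> near_minimizers M.
Proof.
move=> cM M01 eM kappa kappa0.
have [u0 hu0] := torus_min cM; have [v0 hv0] := torus_min J_cont.
have c0 : 0 < M u0 by have /andP[] := M01 u0.
set c := M u0 in c0 hu0.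
have b0 : 0 < beta.
  rewrite lt_neqAle beta_ge0 andbT eq_sym; apply/eqP => b0.
  by have := artanh_gt0 (M01 0); rewrite -eM b0 mul0r ltxx.
pose C : R := 1 + (2 / c + 1) / c ^+ 2.
have C0 : 0 < C.
  rewrite ltr_pwDl// divr_ge0// ?exprn_ge0 ?(ltW c0)//.
  by rewrite addr_ge0// divr_ge0// ltW.
pose k := kappa / C; have k0 : 0 < k by rewrite divr_gt0.
have w0 : 0 < k ^+ 2 * (beta / 2 * (J v0 * c ^+ 2)).
  by rewrite mulr_gt0 ?exprn_gt0// mulr_gt0 ?divr_gt0// mulr_gt0// exprn_gt0.
have k20 : 0 < k ^+ 2 by rewrite exprn_gt0.
(* Both eta and the discretization error are set to dl, and the two bounds are what the two
   numerical conditions of [near_minimizer_positive] require of 2 dl, with b1 = beta / 2. *)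
pose dl := Num.min (k ^+ 2 / 24) (k ^+ 2 * (beta / 2 * (J v0 * c ^+ 2)) / 4).
have dl0 : 0 < dl by rewrite lt_min !divr_gt0.
have dl1 : dl <= k ^+ 2 / 24 by rewrite ge_min lexx.
have dl2 : dl <= k ^+ 2 * (beta / 2 * (J v0 * c ^+ 2)) / 4 by rewrite ge_min lexx orbT.
exists dl => //.
have cdl0 : 0 < c * dl by rewrite mulr_gt0.
have hK := beta_kernel_cvg cM cdl0.
near=> n => m m1 hF.
have L0 : (0 < #|site (L n)|)%N by near: n; exact: (site_near d_gt0 L_rho N_gt0).
have b1 : beta / 2 <= beta_ n.
  near: n; apply: (cvgr_ge _ beta_cvg).
  by rewrite ltr_pdivrMr// ltr_pMr// ltr1n.
have := @near_minimizer_positive R (site (L n)) L0 (@site_kernel R d n (L n) J) (beta_ n) (J v0)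
  (@site_kernel_sym n) (J_gt0 v0) (fun x y => hv0 _) (beta_n_ge0 n) m
  (fun x => M (site_pt R (val x))) c (beta / 2) dl dl k c0 (divr_gt0 b0 (ltr0n R 2)) b1 k0
  (fun x => hu0 _).
rewrite -/C (_ : k * C = kappa); last by rewrite /k divfK// gt_eqF.
apply => //.
- by move=> x; have /andP[] := M01 (site_pt R (val x)).
- move=> x; rewrite -eM; move: x; near: n; exact: hK.
- by move: dl1; lra.
- by move: dl2; set z := k ^+ 2 * _; lra.
Unshelve. all: by end_near. Qed.

Lemma near_minimizers_zero :
  (forall delta : R, 0 < delta -> exists e : T -> R, [/\ continuous e, forall u, 0 < e u &
     forall u, beta * K e u <= (1 + delta) * e u]) ->
  near_minimizers (fun=> 0).
Proof.
move=> He k k0.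
(* Half of dl is spent on the defect of e in the limit equation, the other half on passing to the
   sites; with eta = dl as well, 12 (eta + dl) equals k^4. *)
pose dl := (k ^+ 2) ^+ 2 / 24.
have dl0 : 0 < dl by rewrite divr_gt0// !exprn_gt0.
have [e [ce e0 he]] := He _ (divr_gt0 dl0 (ltr0n R 2)).
have [u0 hu0] := torus_min ce; have [v0 hv0] := torus_min J_cont.
have w0 : 0 < e u0 * (dl / 2) by rewrite mulr_gt0// divr_gt0.
have hK := beta_kernel_cvg ce w0.
exists dl => //; apply: filter_app hK; near=> n => hK m m1 hF.
have L0 : (0 < #|site (L n)|)%N by near: n; exact: (site_near d_gt0 L_rho N_gt0).
exists 1; first by left.
rewrite (_ : (fun x => _) = (fun x => `|m x|)); last by apply/funext => x; rewrite mulr0 subr0.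
apply: (@near_minimizer_zero R (site (L n)) L0 (@site_kernel R d n (L n) J) (beta_ n) (J v0)
  (@site_kernel_sym n) (J_gt0 v0) (fun x y => hv0 _) (beta_n_ge0 n) m
  (fun x => e (site_pt R (val x))) (e u0) dl dl k k0 (e0 u0) (ltW dl0) (fun x => hu0 _) m1) => //.
- move=> x; set Kn := kernel_op _ _ _ _.
  have : `|beta_ n * Kn - beta * K e (site_pt R (val x))| <= e u0 * (dl / 2).
    exact: hK.
  rewrite ler_norml => /andP[_]; rewrite lerBlDr => h; apply: (le_trans h).
  have h2 : e u0 * (dl / 2) <= e (site_pt R (val x)) * (dl / 2) by rewrite ler_wpM2r// ltW// divr_gt0.
  have h3 := he (site_pt R (val x)).
  rewrite (_ : (1 + dl) * _ = e (site_pt R (val x)) * (dl / 2) + (1 + dl / 2) * e (site_pt R (val x))); last by field.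
  exact: lerD.
- by rewrite /dl; set z := _ ^+ 2 ^+ 2; lra.
Unshelve. all: by end_near. Qed.

End near_minimizers.

(** * Concentration *)

(** With c as chosen, c (x + 1) <= 1 + x a / (p + 1) <= exp(x a / (p + 1)); the power p + 1 of this
    beats (x + 1)^p by one factor x + 1, which absorbs the constants once x is large. *)
Lemma polynomial_mul_expRN_le {R : realType} (p : nat) (a e : R) : 0 < a -> 0 < e ->
  exists A : R, forall x : R, A <= x -> (x + 1) ^+ p * expR (- (x * a)) <= e.
Proof.
move=> a0 e0; pose c := Num.min 1 (a / p.+1%:R).
have c0 : 0 < c by rewrite lt_min ltr01 divr_gt0.
exists (Num.max 0 (c^-1 ^+ p.+1 / e)) => x; rewrite ge_max => /andP[x0 xe].
have x1 : 0 < x + 1 by rewrite ltr_wpDl.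
rewrite expRN ler_pdivrMr ?expR_gt0//.
have -> : x * a = p.+1%:R * (x * a / p.+1%:R).
  by rewrite [RHS]mulrC divfK// pnatr_eq0.
rewrite expRM_natl.
have h : c * (x + 1) <= expR (x * a / p.+1%:R).
  apply: le_trans (expR_ge1Dx _); rewrite mulrDr mulr1 addrC lerD ?ge_min ?lexx//.
  by rewrite mulrC -mulrA ler_wpM2l// ge_min lexx orbT.
have h2 : (c * (x + 1)) ^+ p.+1 <= expR (x * a / p.+1%:R) ^+ p.+1.
  by apply: lerXn2r => //; rewrite nnegrE ?expR_ge0// mulr_ge0// ltW.
apply: (@le_trans _ _ (e * (c * (x + 1)) ^+ p.+1)); last by rewrite ler_pM2l.
rewrite exprMn [(x + 1) ^+ p.+1]exprS mulrA mulrA -[leLHS]mul1r ler_wpM2r ?exprn_ge0 ?(ltW x1)//.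
have xe1 : c^-1 ^+ p.+1 / e <= x + 1 by rewrite (le_trans xe)// lerDl.
rewrite -ler_pdivrMl; last by rewrite mulr_gt0// exprn_gt0.
by rewrite mulr1 invfM -exprVn mulrC.
Qed.

Lemma half_rate_le {R : realFieldType} (x y eta : R) : x <= y -> 8 * y <= eta ->
  eta / 2 <= eta - 4 * x.
Proof. lra. Qed.

Lemma quarter_split {R : realFieldType} (r : R) : r = r / 4 + (r / 4 + r / 4 + r / 4).
Proof. by field. Qed.

Section concentration.
Context (R : realType) (d : nat).
Local Notation T := (torus R d).
Local Notation lam := (lambda R d).
Variables (L : forall n, {set dtorus d n}) (rho : T -> R).
Hypothesis d_gt0 : (0 < d)%N.
Hypothesis rho_ge0 : forall u, 0 <= rho u.
Hypothesis rho_int : lam.-integrable setT (fun u => (rho u)%:E).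
Hypothesis L_rho : cvg_density L rho.
Hypothesis N_gt0 : 0 < (\int[lam]_u rho u)%R.

Local Notation N := (\int[lam]_u rho u)%R.
Local Notation rhot := (fun u : T => N^-1 * rho u).
Local Notation E := (torus_mean rhot).

Variables (J : T -> R) (beta_ : nat -> R) (beta : R).
Hypothesis J_cont : continuous J.
Hypothesis J_gt0 : forall v, 0 < J v.
Hypothesis J_sym : forall v, J (- v) = J v.
Hypothesis beta_n_ge0 : forall n, 0 <= beta_ n.
Hypothesis beta_ge0 : 0 <= beta.
Hypothesis beta_cvg : beta_ n @[n --> \oo] --> beta.

Local Notation rt0 := (normalized_ge0 rho_ge0 N_gt0).
Local Notation rti := (normalized_integrable rho_int).
Local Notation rt1 := (normalized_integral rho_int N_gt0).

Definition site_color k n (x : site (L n)) := color k (site_pt R (val x)).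

(** The kernel varies by 2 e when both arguments move within their boxes. The assumption on e then
    leaves at least eta / 2 of the exponential rate, against a polynomial whose degree is the number
    of boxes. *)
Lemma bad_mass_near (M : T -> R) (k : nat) (e eta eps : R) :
  (forall u, -1 < M u < 1) ->
  (forall u u', color k u = color k u' -> forall v, `|J (u + v) - J (u' + v)| <= e) ->
  0 <= e -> 0 < eta -> 8 * (beta + 1) * e <= eta -> 0 < eps ->
  \forall n \near \oo,
    \sum_(s : {ffun site (L n) -> spin} |
        free_energyX (@site_kernel R d n (L n) J) (beta_ n) (fun x => M (site_pt R (val x))) + eta <
        free_energyX (@site_kernel R d n (L n) J) (beta_ n) (block_mean (@site_color k n) s))
      gibbs_weight J (beta_ n) s <= eps.
Proof.
move=> M1 hk e0 eta0 ee eps0.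
have [A hA] := @polynomial_mul_expRN_le R #|{ffun 'I_d -> 'I_k.+1}| (eta / 2) eps (divr_gt0 eta0 (ltr0n R 2)) eps0.
near=> n.
have L0 : (0 < #|site (L n)|)%N by near: n; exact: (site_near d_gt0 L_rho N_gt0).
have LA : A <= #|site (L n)|%:R by near: n; exact: (site_card_near d_gt0 L_rho N_gt0).
have b1 : beta_ n <= beta + 1.
  by near: n; apply: (cvgr_le _ beta_cvg); rewrite ltrDl.
have Z0 := @partition_gt0 R d n (L n) J (beta_ n).
have J0 (x y : site (L n)) : 0 <= @site_kernel R d n (L n) J x y by exact/ltW/J_gt0.
have Je (x y x' y' : site (L n)) : site_color k x = site_color k x' -> site_color k y = site_color k y' ->
    `|@site_kernel R d n (L n) J x y - @site_kernel R d n (L n) J x' y'| <= 2 * e.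
  move=> cx cy; rewrite /site_kernel; set u := site_pt R (val x); set u' := site_pt R (val x').
  set v := site_pt R (val y); set v' := site_pt R (val y').
  rewrite -(subrKA (J (u' - v))) (mulrC 2) mulr_natr mulr2n.
  apply: (le_trans (ler_normD _ _)); apply: lerD; first exact: hk.
  rewrite -[J (u' - v)]J_sym -[J (u' - v')]J_sym !opprB; exact: hk.
have := @sum_weightX_le R (site (L n)) _ (@site_color k n) (@site_kernel R d n (L n) J) (beta_ n) L0
  (beta_n_ge0 n) J0 (fun x => M (site_pt R (val x))) (2 * e) eta (fun x => M1 _) Je.
move=> H; rewrite /gibbs_weight -mulr_sumr [leLHS]mulrC ler_pdivrMr//.
apply: (le_trans H); rewrite ler_wpM2r ?(ltW Z0)//.
apply: le_trans (hA _ LA); rewrite natrX -addn1 natrD ler_wpM2l ?exprn_ge0//.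
rewrite ler_expR lerN2 ler_wpM2l//.
have : beta_ n * e <= (beta + 1) * e by rewrite ler_wpM2r.
set x := beta_ n * e; set y := (beta + 1) * e => xy.
rewrite (_ : 8 * (beta + 1) * e = 8 * y) in ee; last by rewrite /y; ring.
rewrite (_ : 2 * beta_ n * (2 * e) = 4 * x); last by rewrite /x; ring.
exact: half_rate_le xy ee.
Unshelve. all: by end_near. Qed.

Lemma block_mean_avg k n (s : {ffun site (L n) -> spin}) (g : T -> R) (e : R) :
  (0 < #|site (L n)|)%N ->
  (forall u u', color k u = color k u' -> `|g u - g u'| <= e) ->
  `|avg (fun x => sgn (s x) * g (site_pt R (val x)))
    - avg (fun x => block_mean (@site_color k n) s x * g (site_pt R (val x)))| <= 2 * e.
Proof.
move=> L0 hg.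
have := @sum_block_mean_le R _ _ (@site_color k n) s (fun x => g (site_pt R (val x))) e
  (fun x y => hg _ _).
rewrite /avg -mulrBr normrM normfV normr_nat -sumrB.
have c0 : 0 < #|site (L n)|%:R :> R by rewrite ltr0n.
move=> H; rewrite [leLHS]mulrC ler_pdivrMr//; move: H; congr (`|_| <= _).
by apply: eq_bigr => x _; ring.
Qed.

(** The integral of g against the state of magnetization M, with g split into its spin-even and
    spin-odd parts as in [spin_decomposition]. *)
Definition spin_mean (M : T -> R) (g : spin -> T -> R) : R :=
  E (fun u => (g ord0 u + g ord_max u) / 2 + M u * ((g ord0 u - g ord_max u) / 2)).

Definition flip (a : spin) : spin := if a == ord0 then ord_max else ord0.

Lemma sgn_flip a : sgn (flip a) = - sgn a :> R.
Proof. by rewrite /flip; have [->|->] := spinP a; rewrite ?sgn0 ?sgn_max ?opprK. Qed.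

Lemma spin_decomposition (g : spin -> R) a :
  g a = (g ord0 + g ord_max) / 2 + sgn a * ((g ord0 - g ord_max) / 2).
Proof. by have [->|->] := spinP a; rewrite ?sgn0 ?sgn_max; field. Qed.

(** Finitely many test functions are treated with one common sign c, as a weak neighbourhood
    requires. The flipped configuration is included because it lies near the state of the opposite
    sign. *)
Lemma concentration (M : T -> R) (I : finType) (g : I -> spin -> T -> R) (r eps : R) :
  near_minimizers L J beta_ M -> continuous M -> (forall u, -1 < M u < 1) ->
  (forall i a, continuous (g i a)) -> 0 < r -> 0 < eps ->
  \forall n \near \oo, exists2 good : pred {ffun site (L n) -> spin},
    \sum_(s | ~~ good s) gibbs_weight J (beta_ n) s <= eps &
    forall s, good s -> exists2 c : R, c = 1 \/ c = -1 & forall i,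
      `|avg (fun x => g i (s x) (site_pt R (val x))) - spin_mean (fun u => c * M u) (g i)| <= r /\
      `|avg (fun x => g i (flip (s x)) (site_pt R (val x))) - spin_mean (fun u => - c * M u) (g i)| <= r.
Proof.
move=> hM cM M1 cg r0 eps0.
(* Even and odd part in the spin: the average of [ga] involves the sites only, and all dependence on
   the spins sits in [gd]. *)
pose ga i u := (g i ord0 u + g i ord_max u) / 2.
pose gd i u := (g i ord0 u - g i ord_max u) / 2.
have cga i : continuous (ga i).
  apply: continuous_funM; last exact: cst_continuous.
  by move=> u; exact: cvgD (cg i ord0 u) (cg i ord_max u).
have cgd i : continuous (gd i).
  apply: continuous_funM; last exact: cst_continuous.
  by move=> u; exact: cvgB (cg i ord0 u) (cg i ord_max u).
have cMgd i : continuous (fun u => M u * gd i u) by exact: continuous_funM.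
have [C C0 hC] : exists2 C : R, 0 < C & forall i u, `|gd i u| <= C.
  have /choice[Ci hCi] : forall i, exists c : R, 0 <= c /\ forall u, `|gd i u| <= c.
    by move=> i; have [c c0 hc] := torus_bounded (cgd i); exists c.
  exists (1 + \sum_i Ci i); first by rewrite ltr_pwDl// sumr_ge0// => i _; have [] := hCi i.
  move=> i u; apply: le_trans (proj2 (hCi i) u) _.
  rewrite (bigD1 i)//= addrCA lerDl addr_ge0// sumr_ge0// => j _; have [//] := hCi j.
have r4 : 0 < r / 4 by rewrite divr_gt0.
have r8 : 0 < r / 8 by rewrite divr_gt0.
have kap0 : 0 < r / 4 / C by rewrite divr_gt0.
have [eta eta0 hn] := hM _ kap0.
have b1 : 0 < 8 * (beta + 1) by rewrite mulr_gt0// ltr_wpDl.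
have e0 : 0 < eta / (8 * (beta + 1)) by rewrite divr_gt0.
(* The stability of M has fixed eta; the mesh is chosen afterwards, fine enough for eta and for the
   test functions, and before n. *)
have [k hkJ hkg] : exists2 k, 
    (forall u u' : T, color k u = color k u' -> forall v, `|J (u + v) - J (u' + v)| <= eta / (8 * (beta + 1))) &
    forall i (u u' : T), color k u = color k u' -> `|gd i u - gd i u'| <= r / 8.
  have h1 := color_continuous J_cont e0.
  have h2 : \forall k \near \oo, forall i (u u' : T), color k u = color k u' ->
      forall v, `|gd i (u + v) - gd i (u' + v)| <= r / 8.
    by apply: filter_forall => i; exact: color_continuous.
  have [k _ /(_ k (leqnn k))[hk1 hk2]] := filterI h1 h2.
  exists k => // i u u' uu'; have := hk2 i u u' uu' 0; by rewrite !addr0.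
have hga : \forall n \near \oo, forall i,
    `|avg (fun x : site (L n) => ga i (site_pt R (val x))) - E (ga i)| <= r / 4.
  apply: filter_forall => i.
  have /cvgrPdist_le/(_ _ r4) := site_avg_cvg d_gt0 rho_int L_rho N_gt0 (cga i).
  by apply: filterS => n; rewrite distrC.
have hgM : \forall n \near \oo, forall i,
    `|avg (fun x : site (L n) => M (site_pt R (val x)) * gd i (site_pt R (val x)))
      - E (fun u => M u * gd i u)| <= r / 4.
  apply: filter_forall => i.
  have /cvgrPdist_le/(_ _ r4) := site_avg_cvg d_gt0 rho_int L_rho N_gt0 (cMgd i).
  by apply: filterS => n; rewrite distrC.
have hbad := @bad_mass_near M k _ eta eps M1 hkJ (ltW e0) eta0.
rewrite mulrC divfK ?gt_eqF// in hbad; have {}hbad := hbad (lexx _) eps0.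
apply: filter_app hbad; apply: filter_app hgM; apply: filter_app hga; apply: filter_app hn.
near=> n => hn hga hgM hbad.
have L0 : (0 < #|site (L n)|)%N by near: n; exact: (site_near d_gt0 L_rho N_gt0).
have mf := @avg_mean_functional R _ L0.
have tm := torus_mean_functional rt0 rti rt1.
exists (fun s => free_energyX (@site_kernel R d n (L n) J) (beta_ n) (block_mean (@site_color k n) s) <=
   free_energyX (@site_kernel R d n (L n) J) (beta_ n) (fun x => M (site_pt R (val x))) + eta).
  by under eq_bigl do rewrite -ltNge.
move=> s hs.
have [c hc hcM] := hn _ (block_mean_bound (@site_color k n) s) hs.
have c1 : `|c| = 1 by case: hc => ->; rewrite ?normrN1 ?normr1.
exists c => // i.
have meanE c' : spin_mean (fun u => c' * M u) (g i) = E (ga i) + c' * E (fun u => M u * gd i u).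
  rewrite /spin_mean -(meanZ tm); last exact: continuous_bmT (cMgd i).
  rewrite -(meanD tm); last 2 first.
  - exact: continuous_bmT (cga i).
  - by apply: (bmZ tm); exact: continuous_bmT (cMgd i).
  by congr E; apply/funext => u; rewrite -mulrA.
have avgE (t : site (L n) -> spin) : avg (fun x : site (L n) => g i (t x) (site_pt R (val x))) =
   avg (fun x : site (L n) => ga i (site_pt R (val x)))
     + avg (fun x : site (L n) => sgn (t x) * gd i (site_pt R (val x))).
  rewrite -(meanD mf)//; congr avg; apply/funext => x.
  exact: (spin_decomposition (fun a => g i a (site_pt R (val x)))).
have avgN : avg (fun x : site (L n) => sgn (flip (s x)) * gd i (site_pt R (val x))) =
   - avg (fun x : site (L n) => sgn (s x) * gd i (site_pt R (val x))).
  rewrite -mulN1r -(meanZ mf)//; congr avg; apply/funext => x.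
  by rewrite sgn_flip; ring.
rewrite !meanE !avgE avgN.
have h1 := hga i.
have h2 := block_mean_avg s L0 (hkg i).
have h3 : `|avg (fun x : site (L n) => block_mean (@site_color k n) s x * gd i (site_pt R (val x)))
    - c * avg (fun x : site (L n) => M (site_pt R (val x)) * gd i (site_pt R (val x)))| <= r / 4.
  rewrite -(meanZ mf)// -(meanB mf)//.
  apply: le_trans (mean_norm_le mf Logic.I Logic.I) _.
  rewrite -[leRHS](divfK (lt0r_neq0 C0)) mulrC.
  apply: (@le_trans _ _ (C * avg (fun x : site (L n) =>
      `|block_mean (@site_color k n) s x - c * M (site_pt R (val x))|))); last first.
    by rewrite ler_pM2l.
  rewrite -(meanZ mf)//; apply: (mean_le mf) => // x.
  by rewrite mulrA -mulrBl normrM mulrC ler_wpM2r.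
have h4 : `|c * avg (fun x : site (L n) => M (site_pt R (val x)) * gd i (site_pt R (val x)))
     - c * E (fun u => M u * gd i u)| <= r / 4.
  by rewrite -mulrBr normrM c1 mul1r; exact: hgM.
have key : `|avg (fun x : site (L n) => sgn (s x) * gd i (site_pt R (val x)))
    - c * E (fun u => M u * gd i u)| <= r / 4 + r / 4 + r / 4.
  move: h2 h3 h4; set x1 := avg _; set x2 := avg _; set x3 := avg _; set x4 := E _ => h2 h3 h4.
  rewrite (_ : x1 - c * x4 = (x1 - x2) + (x2 - c * x3) + (c * x3 - c * x4)); last by ring.
  apply: (le_trans (ler_normD _ _)); apply: lerD => //.
  apply: (le_trans (ler_normD _ _)); apply: lerD => //.
  by apply: (le_trans h2); rewrite (_ : 2 * (r / 8) = r / 4)//; field.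
move: h1 key; set x1 := avg _; set x2 := E _; set x3 := avg _; set x4 := E _ => h1 key.
split.
  rewrite (_ : _ - _ = (x1 - x2) + (x3 - c * x4)); last by ring.
  by apply: (le_trans (ler_normD _ _)); rewrite [leRHS]quarter_split lerD.
rewrite (_ : _ - _ = (x1 - x2) - (x3 - c * x4)); last by ring.
by apply: (le_trans (ler_normB _ _)); rewrite [leRHS]quarter_split lerD.
Unshelve. all: by end_near. Qed.

End concentration.

(** * Weak convergence *)

Section weak_neighborhoods.
Context (R : realType) (X : ptopologicalType).

(** Sets containing all psi that agree with phi up to r on finitely many bounded continuous
    functions; this reduces continuity on the space of measures to finitely many integrals. *)
Definition test_neighborhood (phi : Pr R X) : set_system (Pr R X) := [set A : set (Pr R X) |
  exists (I : finType) (g : I -> Cb R X) (r : R), 0 < r /\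
    forall psi : Pr R X, (forall i, `|(\int[psi]_x sval (g i) x)%R - (\int[phi]_x sval (g i) x)%R| <= r) -> A psi].

Lemma test_neighborhood_filter phi : Filter (test_neighborhood phi).
Proof.
split.
- by exists void, (of_void _), 1.
- move=> A B [I [g [r [r0 hA]]]] [I' [g' [r' [r0' hB]]]].
  exists (I + I')%type, (fun i => match i with inl i => g i | inr i => g' i end), (Num.min r r').
  split; first by rewrite lt_min r0.
  move=> psi h; split.
    by apply: hA => i; apply: le_trans (h (inl i)) _; rewrite ge_min lexx.
  by apply: hB => i; apply: le_trans (h (inr i)) _; rewrite ge_min lexx orbT.
- move=> A B AB [I [g [r [r0 hA]]]]; exists I, g, r; split => // psi h.
  exact/AB/hA.
Qed.

(** The inclusion says that the filter of test neighbourhoods converges to phi. Convergence in a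
    supremum of topologies is checked for each of them, so one function at a time suffices. *)
Lemma nbhs_test_neighborhood (phi : Pr R X) : nbhs phi `<=` test_neighborhood phi.
Proof.
have ff := test_neighborhood_filter phi.
suff : test_neighborhood phi --> phi by [].
apply/cvg_sup => -[f [cf bf]] A /=.
rewrite (@nbhsE (initial_topology (fun mu : probability (borel X) R => \int[mu]_x f x)%R)) => -[B [[C oC <-] Cphi] sBA].
apply: filterS sBA _.
have /nbhs_ballP[r /= r0 hr] : nbhs (\int[phi]_x f x)%R C by exact: open_nbhs_nbhs.
exists unit, (fun=> exist _ f (conj cf bf)), (r / 2); split; first by rewrite divr_gt0.
move=> psi /(_ tt)/= h; apply: hr; rewrite /ball/= distrC.
by apply: le_lt_trans h _; rewrite ltr_pdivrMr// ltr_pMr// ltr1n.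
Qed.

Lemma continuous_test (f : Pr R X -> R) (phi : Pr R X) (e : R) : continuous f -> 0 < e ->
  exists (I : finType) (g : I -> Cb R X) (r : R), 0 < r /\
    forall psi : Pr R X, (forall i, `|(\int[psi]_x sval (g i) x)%R - (\int[phi]_x sval (g i) x)%R| <= r) ->
      `|f psi - f phi| <= e.
Proof.
move=> cf e0; have /cvgrPdist_le/(_ _ e0)/nbhs_test_neighborhood := cf phi.
move=> [I [g [r [r0 h]]]]; exists I, g, r; split => // psi /h.
by rewrite distrC.
Qed.

End weak_neighborhoods.

Lemma continuous_with_spin (X : ptopologicalType) (R : realType) (g : X * spin -> R) (a : spin) :
  continuous g -> continuous (fun u => g (u, a)).
Proof.
move=> cg u; apply: (cvg_comp (fun u : X => (u, a)) g _ (cg (u, a))).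
move=> A [[P Q] /= [uP aQ] PQA]; apply: filterS uP => v Pv; apply: PQA.
by split => //=; exact: nbhs_singleton.
Qed.

Lemma normr_half_le {R : realFieldType} (x y B : R) : `|x| <= B -> `|y| <= B -> `|(x + y) / 2| <= B.
Proof.
move=> hx hy; rewrite normrM normfV normr_nat ler_pdivrMr// mulr_natr mulr2n.
by apply: (le_trans (ler_normD _ _)); apply: lerD.
Qed.

Section empirical_law_cvg.
Context (R : realType) (d : nat).
Local Notation T := (torus R d).
Local Notation lam := (lambda R d).
Variables (L : forall n, {set dtorus d n}) (rho : T -> R).
Hypothesis d_gt0 : (0 < d)%N.
Hypothesis rho_ge0 : forall u, 0 <= rho u.
Hypothesis rho_int : lam.-integrable setT (fun u => (rho u)%:E).
Hypothesis L_rho : cvg_density L rho.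
Hypothesis N_gt0 : 0 < (\int[lam]_u rho u)%R.
Variables (J : T -> R) (beta_ : nat -> R) (beta : R).
Hypothesis J_cont : continuous J.
Hypothesis J_gt0 : forall v, 0 < J v.
Hypothesis J_sym : forall v, J (- v) = J v.
Hypothesis beta_n_ge0 : forall n, 0 <= beta_ n.
Hypothesis beta_ge0 : 0 <= beta.
Hypothesis beta_cvg : beta_ n @[n --> \oo] --> beta.

Lemma flipK : involutive flip.
Proof. by move=> a; have [->|->] := spinP a. Qed.

Definition flip_config n (s : {ffun site (L n) -> spin}) : {ffun site (L n) -> spin} :=
  [ffun x => flip (s x)].

Lemma flip_configK n : involutive (@flip_config n).
Proof. by move=> s; apply/ffunP => x; rewrite !ffunE flipK. Qed.

Lemma gibbs_weight_flip n b (s : {ffun site (L n) -> spin}) :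
  gibbs_weight J b (flip_config s) = gibbs_weight J b s.
Proof.
rewrite /gibbs_weight /weightX; congr (_ * expR (_ * (_ * _))).
apply: eq_bigr => x _; apply: eq_bigr => y _.
by rewrite !ffunE (inj_eq (inv_inj flipK)).
Qed.

Lemma gibbs_weight_ge0 n b (s : {ffun site (L n) -> spin}) : 0 <= gibbs_weight J b s.
Proof. by rewrite mulr_ge0 ?invr_ge0 ?expR_ge0// ltW// partition_gt0. Qed.

Lemma sum_gibbs_weight n b : \sum_(s : {ffun site (L n) -> spin}) gibbs_weight J b s = 1.
Proof. by rewrite -mulr_sumr mulVf// gt_eqF// partition_gt0. Qed.

(** Averaging over a configuration and its flip is the source of the weights 1/2: of the two, one is
    near [phip] and the other near [phim], whichever sign the configuration has selected. *)
Lemma sum_gibbs_symmetric n b (F : {ffun site (L n) -> spin} -> R) :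
  \sum_s gibbs_weight J b s * F s = \sum_s gibbs_weight J b s * ((F s + F (flip_config s)) / 2).
Proof.
have e : \sum_s gibbs_weight J b s * F s = \sum_s gibbs_weight J b s * F (flip_config s).
  rewrite (reindex_inj (inv_inj (@flip_configK n))); apply: eq_bigr => s _.
  by rewrite gibbs_weight_flip.
under [RHS]eq_bigr do rewrite mulrA mulrDr.
by rewrite -mulr_suml big_split/= -e; field.
Qed.

Local Notation N := (\int[lam]_u rho u)%R.
Local Notation rhot := (fun u : T => N^-1 * rho u).

(** Stated for a pair of states so that it covers both situations of the theorem; when M = 0 the
    same state is used twice. *)
Lemma empirical_law_integral_cvg (M : T -> R) (phip phim : Pr R (T * spin)%type) (f : Pr R (T * spin)%type -> R) :
  near_minimizers L J beta_ M -> continuous M -> (forall u, -1 < M u < 1) ->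
  (forall g : T * spin -> R, continuous g -> bounded_fun g ->
    (\int[phip]_z g z)%R = spin_mean rho M (fun a u => g (u, a))) ->
  (forall g : T * spin -> R, continuous g -> bounded_fun g ->
    (\int[phim]_z g z)%R = spin_mean rho (fun u => - M u) (fun a u => g (u, a))) ->
  continuous f -> bounded_fun f ->
  (\int[empirical_law J (beta_ n) (L n)]_psi f psi)%R @[n --> \oo] --> (f phip + f phim) / 2.
Proof.
move=> hM cM M1 hp hm cf bf.
have [B B0 hB] : exists2 B : R, 0 < B & forall psi, `|f psi| <= B.
  have [C [_ hC]] := bf; exists (`|C| + 1); first by rewrite ltr_wpDl.
  by move=> psi; apply: hC => //; rewrite (le_lt_trans (ler_norm C))// ltrDl.
apply/cvgrPdist_le => e e0; have e2 : 0 < e / 2 by rewrite divr_gt0.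
have [Ip [gp [rp [rp0 hfp]]]] := continuous_test phip cf e2.
have [Im [gm [rm [rm0 hfm]]]] := continuous_test phim cf e2.
pose G (i : (Ip + Im)%type) : Cb R (T * spin)%type := match i with inl i => gp i | inr i => gm i end.
have r0 : 0 < Num.min rp rm by rewrite lt_min rp0.
(* On the bad configurations the integrand differs from its limit by at most 2 B, so that mass e /
   (4 B) contributes e / 2. *)
have eB : 0 < e / (4 * B) by rewrite divr_gt0// mulr_gt0.
have cG i : continuous (sval (G i)) by case: (svalP (G i)).
have bG i : bounded_fun (sval (G i)) by case: (svalP (G i)).
have := concentration d_gt0 rho_ge0 rho_int L_rho N_gt0 J_cont J_gt0 J_sym beta_n_ge0 beta_ge0 beta_cvg
  hM cM M1 (fun i a => @continuous_with_spin T R (sval (G i)) a (cG i)) r0 eB.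
apply: filter_app; near=> n => -[good hbad hgood].
have L0 : (0 < #|site (L n)|)%N by near: n; exact: (site_near d_gt0 L_rho N_gt0).
have L1 : L n != finset.set0 by rewrite card_sig in L0; rewrite -card_gt0.
rewrite Rintegral_empirical_law// (@sum_gibbs_symmetric n _ (fun s => f (empirical R (s : config (L n))))).
set q := (f phip + f phim) / 2.
have -> : q = \sum_(s : {ffun site (L n) -> spin}) gibbs_weight J (beta_ n) s * q.
  by rewrite -mulr_suml sum_gibbs_weight mul1r.
rewrite -sumrB; apply: (le_trans (ler_norm_sum _ _ _)).
have near_state s : good s ->
    `|q - (f (empirical R (s : config (L n))) + f (empirical R (flip_config s : config (L n)))) / 2| <= e / 2.
  move=> /hgood[c hc hi].
  set a := f _ ; set b := f (empirical _ _).
  have int_s i : (\int[empirical R (s : config (L n))]_z sval (G i) z)%R =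
      avg (fun x => sval (G i) (site_pt R (val x), s x)) by rewrite Rintegral_empirical.
  have int_fs i : (\int[empirical R (flip_config s : config (L n))]_z sval (G i) z)%R =
      avg (fun x => sval (G i) (site_pt R (val x), flip (s x))).
    by rewrite Rintegral_empirical// /avg; under eq_bigr do rewrite ffunE.
  have Mp : (fun u => 1 * M u) = M by apply/funext => u; rewrite mul1r.
  have Mm : (fun u => - 1 * M u) = (fun u => - M u) by apply/funext => u; rewrite mulN1r.
  have tri (x y : R) : `|x - f phip| <= e / 2 -> `|y - f phim| <= e / 2 -> `|q - (x + y) / 2| <= e / 2.
    move=> hx hy; rewrite /q (_ : _ - _ = - ((x - f phip) + (y - f phim)) / 2); last by field.
    by rewrite mulNr normrN; exact: normr_half_le.
  have le_p (x : R) : x <= Num.min rp rm -> x <= rp by move=> h; apply: (le_trans h); rewrite ge_min lexx.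
  have le_m (x : R) : x <= Num.min rp rm -> x <= rm by move=> h; apply: (le_trans h); rewrite ge_min lexx orbT.
  case: hc => cE; rewrite cE ?opprK Mp Mm in hi.
    apply: tri.
      apply: hfp => i; have [h _] := hi (inl i).
      by rewrite (hp _ (cG (inl i)) (bG (inl i))) (int_s (inl i)); exact: le_p.
    apply: hfm => i; have [_ h] := hi (inr i).
    by rewrite (hm _ (cG (inr i)) (bG (inr i))) (int_fs (inr i)); exact: le_m.
  (* For the sign -1 the configuration and its flip exchange roles, which the symmetric average does
     not see. *)
  rewrite [a + b]addrC; apply: tri.
    apply: hfp => i; have [_ h] := hi (inl i).
    by rewrite (hp _ (cG (inl i)) (bG (inl i))) (int_fs (inl i)); exact: le_p.
  apply: hfm => i; have [h _] := hi (inr i).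
  by rewrite (hm _ (cG (inr i)) (bG (inr i))) (int_s (inr i)); exact: le_m.
have hq : `|q| <= B by exact: normr_half_le.
have far s : `|q - (f (empirical R (s : config (L n))) + f (empirical R (flip_config s : config (L n)))) / 2| <= 2 * B.
  apply: (le_trans (ler_normB _ _)); rewrite (_ : 2 * B = B + B); last by rewrite mulr_natl mulr2n.
  by apply: lerD => //; exact: normr_half_le.
under eq_bigr do rewrite -mulrBr normrM (ger0_norm (gibbs_weight_ge0 _ _)).
rewrite (bigID good)/= [leRHS]splitr; apply: lerD.
  apply: (@le_trans _ _ (\sum_(s | good s) gibbs_weight J (beta_ n) s * (e / 2))).
    by apply: ler_sum => s gs; rewrite ler_wpM2l ?gibbs_weight_ge0// near_state.
  rewrite -mulr_suml ler_piMl ?(ltW e2)// -(@sum_gibbs_weight n (beta_ n)) [leRHS](bigID good)/= lerDl.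
  by apply: sumr_ge0 => s _; exact: gibbs_weight_ge0.
apply: (@le_trans _ _ (\sum_(s | ~~ good s) gibbs_weight J (beta_ n) s * (2 * B))).
  by apply: ler_sum => s gs; rewrite ler_wpM2l ?gibbs_weight_ge0// far.
rewrite -mulr_suml; apply: (@le_trans _ _ (e / (4 * B) * (2 * B))).
  by rewrite ler_wpM2r// mulr_ge0// ltW.
by rewrite le_eqVlt; apply/orP; left; apply/eqP; field; rewrite gt_eqF.
Unshelve. all: by end_near. Qed.

End empirical_law_cvg.

Lemma torus_state {R : realType} {d : nat} (rho : torus R d -> R)
    (rho_ge0 : forall u, 0 <= rho u)
    (rho_int : (lambda R d).-integrable setT (fun u => (rho u)%:E))
    (N_gt0 : 0 < (\int[lambda R d]_u rho u)%R) (m : torus R d -> R) :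
  continuous m -> (forall u, -1 <= m u <= 1) ->
  exists phi : Pr R (torus R d * spin)%type,
    magnetized (fun u => (\int[lambda R d]_u rho u)%R^-1 * rho u) phi m /\
    forall g : torus R d * spin -> R, continuous g -> bounded_fun g ->
      (\int[phi]_z g z)%R = spin_mean rho m (fun a u => g (u, a)).
Proof.
move=> cm m1; pose rhot := fun u : torus R d => (\int[lambda R d]_u rho u)%R^-1 * rho u.
have mm : measurable_fun setT (m : borel (torus R d) -> R) by exact: continuous_borel_realfun.
have [phi [h1 h2]] := @magnetized_state (torus R d) R (lambda R d) rhot
  (normalized_ge0 rho_ge0 N_gt0) (normalized_integrable rho_int) (normalized_integral rho_int N_gt0) m mm m1.
exists phi; split; first exact_no_check h1.
move=> g cg [C [_ hC]].
have bg : @bounded_measurable _ (borel (torus R d * spin)%type) R g.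
  split; first exact: continuous_borel_realfun.
  by exists (C + 1) => z; apply: hC => //; rewrite ltrDl.
have h := h2 g bg; exact_no_check h.
Qed.

Theorem proposition2p15 (R : realType) (d : nat) (J : torus R d -> R)
    (Lambda : forall n : nat, {set dtorus d n})
    (rho : torus R d -> R) (beta_ : nat -> R) (beta : R)
    (hd : (0 < d)%N)
    (J_cont : continuous J)
    (J_gt0 : forall v, 0 < J v)
    (J_sym : forall v, J (- v) = J v)
    (J_int : (\int[lambda R d]_u J u)%R = 1)
    (rho_meas : measurable_fun setT (rho : borel (torus R d) -> R))
    (rho_ge0 : forall u, 0 <= rho u)
    (rho_int : (lambda R d).-integrable setT (fun u => (rho u)%:E))
    (Lambda_rho : cvg_density Lambda rho)
    (N_gt0 : 0 < (\int[lambda R d]_u rho u)%R)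
    (beta_n_ge0 : forall n, 0 <= beta_ n) (beta_ge0 : 0 <= beta)
    (beta_cvg : beta_ n @[n --> \oo] --> beta) :
  let N := (\int[lambda R d]_u rho u)%R in
  let rhot := fun u : torus R d => N^-1 * rho u in
  let P := fun n : nat => empirical_law J (beta_ n) (Lambda n) in
  (exists phi : Pr R (torus R d * spin)%type,
    [/\ forall psi, minimizer J rhot beta psi <-> measure_eq psi phi,
        forall (a : spin) (A : set (borel (torus R d))), measurable A ->
          component phi a A = density_measure (fun u => 2^-1 * rhot u) A,
        is_magnetization rhot phi (fun=> 0) &
        P n @[n --> \oo] --> delta R phi])
  \/
  (exists (phip phim : Pr R (torus R d * spin)%type) (m : torus R d -> R),
    [/\ ~ measure_eq phip phim /\
        (forall psi,
          minimizer J rhot beta psi <-> (measure_eq psi phip \/ measure_eq psi phim)),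
        is_magnetization rhot phip m,
        {ae density_measure rhot, forall u, 0 < m u},
        is_magnetization rhot phim (fun u => - m u) &
        P n @[n --> \oo] --> (half_mix (delta R phip) (delta R phim) :
                               Pr R (Pr R (torus R d * spin)%type))]).
Proof.
move=> N rhot P.
have rt0 : forall u, 0 <= rhot u := normalized_ge0 rho_ge0 N_gt0.
have rti := normalized_integrable rho_int; rewrite -/N -/rhot in rti.
have rt1 := normalized_integral rho_int N_gt0; rewrite -/N -/rhot in rt1.
have state := torus_state rho_ge0 rho_int N_gt0.
have mT (M : torus R d -> R) : continuous M -> measurable_fun setT (M : borel (torus R d) -> R).
  exact: continuous_borel_realfun.
(* A positive solution of the mean field equation leads to situation (b), its absence to situation
   (a). *)
have [[M [cM M01 eM]]|He] := torus_dichotomy J_cont rt0 rti rt1 J_gt0 beta_ge0.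
  right.
  have M1 u : -1 <= M u <= 1 by have /andP[h1 /ltW ->] := M01 u; rewrite (le_trans _ (ltW h1))// lerN10.
  have M1' u : -1 < M u < 1 by have /andP[h1 ->] := M01 u; rewrite (lt_trans _ h1)// ltrN10.
  have cNM : continuous (fun u => - M u) by move=> u; exact: (cvgN (cM u)).
  have NM1 u : -1 <= - M u <= 1 by rewrite lerN2 lerNl andbC.
  have [phip [hp ip]] := state M cM M1.
  have [phim [hm im]] := state (fun u => - M u) cNM NM1.
  exists phip, phim, M; split.
  - split; first exact: (magnetized_neq rt0 rti rt1 cM M01 hp hm).
    exact: (torus_minimizerP J_cont rt0 rti rt1 (mT _ cM) M1
      (torus_unique_positive J_cont J_sym J_gt0 beta_ge0 rt0 rti rt1 cM M01 eM) hp hm).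
  - exact: (magnetized_is_magnetization rt0 rti rt1 (mT _ cM) M1 hp).
  - exists set0; split => //; first by rewrite /density_measure integral_set0.
    by move=> u /=; apply; have /andP[] := M01 u.
  - exact: (magnetized_is_magnetization rt0 rti rt1 (mT _ cNM) NM1 hm).
  - apply/cvg_PrP => f cf bf.
    have -> : (\int[half_mix (delta R phip) (delta R phim)]_x f x)%R = (f phip + f phim) / 2.
      by apply: (@Rintegral_half_mix _ (borel (Pr R (torus R d * spin)%type))); exact: continuous_borel_realfun.
    exact: (empirical_law_integral_cvg hd rho_ge0 rho_int Lambda_rho N_gt0 J_cont J_gt0 J_sym
      beta_n_ge0 beta_ge0 beta_cvg
      (near_minimizers_positive hd rho_ge0 rho_int Lambda_rho N_gt0 J_cont J_gt0 J_sym
        beta_n_ge0 beta_ge0 beta_cvg cM M01 eM) cM M1' ip im cf bf).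
left.
have c0 : continuous (fun=> 0 : R) := @cst_continuous (torus R d) R 0.
have z1 (u : torus R d) : -1 <= (0 : R) <= 1 by rewrite lerN10 ler01.
have z1' (u : torus R d) : -1 < (0 : R) < 1 by rewrite ltrN10 ltr01.
have [phi [hphi iphi]] := state (fun=> 0) c0 z1.
(* Identifies the state of magnetization -0 with that of magnetization 0, so that the results for
   pairs apply with [phi] in both places. *)
have N0 : (fun _ : torus R d => - 0 : R) = (fun=> 0) by apply/funext => u; rewrite oppr0.
exists phi; split.
- move=> psi.
  have hm : magnetized rhot phi (fun u => - 0) by rewrite N0.
  have H := torus_minimizerP J_cont rt0 rti rt1 (mT _ c0) z1
    (torus_unique_zero J_cont J_sym J_gt0 beta_ge0 rt0 rti rt1 He) hphi hm psi.
  by rewrite H; split => [[]|] //; left.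
- move=> a A mA; rewrite (hphi a A mA) /density_measure; apply: eq_integral => u _.
  by rewrite /bern mulr0 addr0 div1r.
- exact: (magnetized_is_magnetization rt0 rti rt1 (mT _ c0) z1 hphi).
- apply/cvg_PrP => f cf bf; rewrite Rintegral_delta//.
  have -> : f phi = (f phi + f phi) / 2 by field.
  have im (g : torus R d * spin -> R) : continuous g -> bounded_fun g ->
      (\int[phi]_z g z)%R = spin_mean rho (fun u => - 0) (fun a u => g (u, a)).
    by rewrite N0; exact: iphi.
  exact: (empirical_law_integral_cvg hd rho_ge0 rho_int Lambda_rho N_gt0 J_cont J_gt0 J_sym
    beta_n_ge0 beta_ge0 beta_cvg
    (near_minimizers_zero hd rho_ge0 rho_int Lambda_rho N_gt0 J_cont J_gt0 J_sym
      beta_n_ge0 beta_ge0 beta_cvg He) c0 z1' iphi im cf bf).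
Qed.
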